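(* Let $n\ge 2$, let $W$ be the Coxeter group of type $\tilde A_{n-1}$ and let $c$ be any Coxeter element of $W$. Then the group of fractions $G(P_c)$ of the monoid $M(P_c)$ is isomorphic to the Artin-Tits group $B(\tilde A_{n-1})$ of type $\tilde A_{n-1}$.
   Context: Let $W$ be the Coxeter group of type $\tilde A_{n-1}$ with Coxeter generators $s_1,\dots,s_n$, where $s_i$ and $s_{i+1}$ are joined in the Coxeter diagram (indices mod $n$). Let $R$ be the set of reflections (conjugates of the $s_i$). For $w\in W$ let $l_R(w)$ be the least number of factors in an expression of $w$ as a product of elements of $R$. For $v,w\in W$, $v$ divides $w$ if $w=vv'$ with $l_R(w)=l_R(v)+l_R(v')$ (equivalently, as $R$ is stable under conjugation, $w=v''v$ with $l_R(w)=l_R(v'')+l_R(v)$). A Coxeter element $c$ is a product of all the $s_i$, each occurring once, in an arbitrary order. $P_c$ is the set of divisors of $c$. $M(P_c)$ is the monoid generated by a set $\underline P_c=\{\underline w\mid w\in P_c\}$ in bijection with $P_c$, with relations $\underline w.\underline{w'}=\underline{ww'}$ whenever $w,w',ww'\in P_c$ and $l_R(ww')=l_R(w)+l_R(w')$. $G(P_c)$ is the group given by the same presentation (the group of fractions of $M(P_c)$). $B(\tilde A_{n-1})$ is the group generated by $\mathbf s_1,\dots,\mathbf s_n$ with relations, for $n\ge 3$, $\mathbf s_i\mathbf s_{i+1}\mathbf s_i=\mathbf s_{i+1}\mathbf s_i\mathbf s_{i+1}$ for $i=1,\dots,n$ (with $\mathbf s_{n+1}=\mathbf s_1$) and $\mathbf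 s_i\mathbf s_j=\mathbf s_j\mathbf s_i$ if $i\ne j$ and $i\not\equiv j\pm1\pmod n$; for $n=2$ it is the free group on $\mathbf s_1,\mathbf s_2$. *)

(* Defs.v *)
From HB Require Import structures.
From mathcomp Require Import all_boot.
From mathcomp Require Import boolp.

Set Implicit Arguments.
Unset Strict Implicit.
Unset Printing Implicit Defensive.

Local Open Scope group_scope.
Local Open Scope quotient_scope.

(* Groups presented by generators x : X and relations u = v between positive
   words. A letter (x, false) stands for x and (x, true) for its inverse. *)
Section Presentation.
Variables (X : choiceType) (rel : seq X -> seq X -> Prop).

Definition positive (u : seq X) : seq (X * bool) := [seq (x, false) | x <- u].

Inductive pres_eq : seq (X * bool) -> seq (X * bool) -> Prop :=
| pres_refl u : pres_eq u u
| pres_sym u v : pres_eq u v -> pres_eq v u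
| pres_trans u v w : pres_eq u v -> pres_eq v w -> pres_eq u w
| pres_cat u u' v v' : pres_eq u u' -> pres_eq v v' ->
    pres_eq (u ++ v) (u' ++ v')
| pres_inv x b : pres_eq [:: (x, b); (x, ~~ b)] [::]
| pres_rel u v : rel u v -> pres_eq (positive u) (positive v).

Definition pres_eqb u v : bool := `[< pres_eq u v >].

Fact pres_eqb_refl : reflexive pres_eqb.
Proof. by move=> u; apply/asboolP/pres_refl. Qed.

Fact pres_eqb_sym : symmetric pres_eqb.
Proof. by move=> u v; apply/asboolP/asboolP => /pres_sym. Qed.

Fact pres_eqb_trans : transitive pres_eqb.
Proof.
by move=> v u w /asboolP uv /asboolP vw; apply/asboolP/(pres_trans uv).
Qed.

Canonical pres_equiv := EquivRel pres_eqb
  pres_eqb_refl pres_eqb_sym pres_eqb_trans.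

Definition presented := {eq_quot pres_equiv}.
HB.instance Definition _ := Choice.on presented.

Definition pres_class (u : seq (X * bool)) : presented :=
  \pi_{eq_quot pres_equiv} u.

Definition pres_repr (g : presented) : seq (X * bool) :=
  repr (g : {eq_quot pres_equiv}).

Lemma pres_reprK g : pres_class (pres_repr g) = g.
Proof. exact: reprK. Qed.

Lemma pres_classP u v : pres_class u = pres_class v <-> pres_eq u v.
Proof. by split=> [/eqmodP/asboolP | uv]; last by apply/eqmodP/asboolP. Qed.

Lemma pres_reprE u : pres_eq (pres_repr (pres_class u)) u.
Proof. by apply/pres_classP; rewrite pres_reprK. Qed.

Definition winv (u : seq (X * bool)) : seq (X * bool) :=
  rev [seq (a.1, ~~ a.2) | a <- u].

Lemma winvK : involutive winv.
Proof.
move=> u; rewrite /winv map_rev revK -map_comp map_id_in // => -[x b] _ /=.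
by rewrite negbK.
Qed.

Lemma pres_cat_winv u : pres_eq (u ++ winv u) [::].
Proof.
elim: u => [|[x b] u IHu]; first exact: pres_refl.
rewrite /winv /= rev_cons -cats1 catA -/(winv u).
apply: (pres_trans _ (pres_inv x b)).
rewrite -[X in pres_eq _ X]/([:: (x, b)] ++ [::] ++ [:: (x, ~~ b)]).
rewrite -[X in pres_eq X _]/([:: (x, b)] ++ (u ++ winv u) ++ [:: (x, ~~ b)]).
by apply: pres_cat (pres_refl _) (pres_cat IHu (pres_refl _)).
Qed.

Lemma pres_winv_cat u : pres_eq (winv u ++ u) [::].
Proof. by rewrite -{2}[u]winvK; apply: pres_cat_winv. Qed.

Lemma pres_winv u v : pres_eq u v -> pres_eq (winv u) (winv v).
Proof.
move=> uv; have := pres_cat (pres_winv_cat u) (pres_refl (winv v)).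
apply: pres_trans; apply: pres_sym.
rewrite -catA -[X in pres_eq _ X]cats0; apply: pres_cat (pres_refl _) _.
exact: pres_trans (pres_cat uv (pres_refl _)) (pres_cat_winv v).
Qed.

Definition pmul (g h : presented) : presented :=
  pres_class (pres_repr g ++ pres_repr h).
Definition pinv (g : presented) : presented := pres_class (winv (pres_repr g)).

Lemma pmulE u v : pmul (pres_class u) (pres_class v) = pres_class (u ++ v).
Proof. by apply/pres_classP/pres_cat; apply: pres_reprE. Qed.

Lemma pinvE u : pinv (pres_class u) = pres_class (winv u).
Proof. by apply/pres_classP/pres_winv/pres_reprE. Qed.

Fact pmulA : associative pmul.
Proof.
move=> g h k; rewrite -(pres_reprK g) -(pres_reprK h) -(pres_reprK k).
by rewrite !pmulE catA.
Qed.

Fact pmul1g : left_id (pres_class [::]) pmul.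
Proof. by move=> g; rewrite -(pres_reprK g) pmulE. Qed.

Fact pmulg1 : right_id (pres_class [::]) pmul.
Proof. by move=> g; rewrite -(pres_reprK g) pmulE cats0. Qed.

Fact pmulVg : left_inverse (pres_class [::]) pinv pmul.
Proof.
move=> g; rewrite -(pres_reprK g) pinvE pmulE.
exact/pres_classP/pres_winv_cat.
Qed.

Fact pmulgV : right_inverse (pres_class [::]) pinv pmul.
Proof.
move=> g; rewrite -(pres_reprK g) pinvE pmulE.
exact/pres_classP/pres_cat_winv.
Qed.

HB.instance Definition _ := isGroup.Build presented
  pmulA pmul1g pmulg1 pmulVg pmulgV.

Definition pres_gen (x : X) : presented := pres_class [:: (x, false)].

End Presentation.

Definition isomorphic (G H : groupType) : Prop :=
  exists f : {multiplicative G -> H}, bijective f.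

(* The relators of a Coxeter group are (x y)^(m x y), with m x y = 0 encoding
   an infinite order (the relation is then trivial). *)
Inductive coxeter_rel (I : choiceType) (m : I -> I -> nat) :
    seq I -> seq I -> Prop :=
| CoxeterRel x y : coxeter_rel m (flatten (nseq (m x y) [:: x; y])) [::].

Definition coxeter_group (I : choiceType) (m : I -> I -> nat) : groupType :=
  presented (coxeter_rel m).

(* Indices are taken in {0, ..., n-1}; ordS i is i + 1 mod n. *)
Definition affA_adj (n : nat) (i j : 'I_n) : bool :=
  (j == ordS i) || (i == ordS j).

Definition affA_mx (n : nat) (i j : 'I_n) : nat :=
  if i == j then 1%N
  else if affA_adj i j then (if n == 2 then 0%N else 3%N)
  else 2%N.

Section DualMonoid.
Variable n : nat.

Definition affW : groupType := coxeter_group (@affA_mx n).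

Definition simple_refl (i : 'I_n) : affW := pres_gen (coxeter_rel _) i.

Definition is_reflection (r : affW) : Prop :=
  exists (i : 'I_n) (w : affW), r = simple_refl i ^ w.

Definition refl_product (w : affW) (k : nat) : Prop :=
  exists rs : seq affW,
    [/\ size rs = k, forall r, r \in rs -> is_reflection r
      & w = \prod_(r <- rs) r].

Lemma simple_refl_inv (i : 'I_n) b :
  pres_class (coxeter_rel (@affA_mx n)) [:: (i, b)] = simple_refl i.
Proof.
case: b => //; apply/pres_classP.
have ii : pres_eq (coxeter_rel (@affA_mx n)) [:: (i, false); (i, false)] [::].
  by have := pres_rel (CoxeterRel (@affA_mx n) i i); rewrite /affA_mx eqxx.
have := pres_cat (pres_refl _ [:: (i, true)]) ii; rewrite cats0.
move/pres_sym => /pres_trans; apply.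
exact: (pres_cat (pres_inv _ i true) (pres_refl _ [:: (i, false)])).
Qed.

Lemma refl_product_ex (w : affW) : exists k, `[< refl_product w k >].
Proof.
rewrite -(pres_reprK w); elim: (pres_repr w) => [|[i b] u [k /asboolP[rs]]].
  by exists 0%N; apply/asboolP; exists [::]; split=> //; rewrite big_nil.
case=> szrs rsP uE; exists k.+1; apply/asboolP; exists (simple_refl i :: rs).
split=> /= [|r|]; first by rewrite szrs.
  rewrite inE => /orP[/eqP->|/rsP//].
  by exists i, 1; rewrite conjg1.
by rewrite big_cons -uE -(simple_refl_inv i b); symmetry; apply: pmulE.
Qed.

Definition lR (w : affW) : nat := ex_minn (refl_product_ex w).

Definition divides (v w : affW) : Prop :=
  exists v' : affW, w = v * v' /\ lR w = (lR v + lR v')%N.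

Definition coxeter_element (c : affW) : Prop :=
  exists s : seq 'I_n,
    perm_eq s (enum 'I_n) /\ c = \prod_(i <- s) simple_refl i.

Definition divisors_of (c : affW) : choiceType :=
  {v : affW | `[< divides v c >]}.

(* The relations presenting both the monoid M(P_c) and the group G(P_c). *)
Inductive dual_rel (c : affW) :
    seq (divisors_of c) -> seq (divisors_of c) -> Prop :=
| DualRel (w w' ww' : divisors_of c) :
    val ww' = val w * val w' ->
    lR (val ww') = (lR (val w) + lR (val w'))%N ->
    dual_rel [:: w; w'] [:: ww'].

Definition dual_group (c : affW) : groupType := presented (@dual_rel c).

(* For n = 2 there is no relation: the two generators are adjacent, so that
   the group is free on them. *)
Inductive affA_braid_rel : seq 'I_n -> seq 'I_n -> Prop :=
| AffABraid i : 3 <= n ->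
    affA_braid_rel [:: i; ordS i; i] [:: ordS i; i; ordS i]
| AffAComm i j : i != j -> ~~ affA_adj i j ->
    affA_braid_rel [:: i; j] [:: j; i].

Definition affA_artin : groupType := presented affA_braid_rel.

End DualMonoid.

(* Main.v *)
Require Import Defs.
From HB Require Import structures.
From mathcomp Require Import all_boot all_order all_algebra.
From mathcomp Require Import boolp zify.

(* After conjugation, c = s_n ... s_(p+1) s_1 ... s_p with n = p + q, and the
   reflections act on the integers as periodic transpositions, i.e. as arcs in
   an annulus with p outer and q inner marked points. The shift s_i |-> s_(i+1)
   of the Artin group B followed by conjugation by one of the two factors of c
   gives two commuting automorphisms of B fixing c. Translating reflections by
   them yields a set L of lifts of the simple arcs, and a Hurwitz move applied
   to the lifts of two non-crossing arcs stays in L.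
   The Hurwitz action is transitive on the reduced reflection factorizations
   of c, so every such factorization lifts uniquely to L, with product the
   Coxeter element of B. Multiplying lifts along a factorization of a divisor
   of c therefore defines a map from P_c to B, which induces an inverse of the
   map from B to G(P_c) sending s_i to the generator of P_c it names. *)

Set Implicit Arguments.
Unset Strict Implicit.
Unset Printing Implicit Defensive.

Import Order.TTheory GRing.Theory Num.Theory.
Local Open Scope group_scope.

(** * Presented groups *)

(** The set [P_c] is infinite, and a lift to the Artin group carried along Hurwitz moves could
    depend on the chosen chain of moves. The set [L] removes this ambiguity: an element of [L] is
    determined by its image in [W], so a factorization has at most one lift with entries in [L]. A
    move on two crossing arcs would in general leave [L], so pairwise non-crossing has to be carried
    along the moves together with membership in [L]. It depends on the order of the factors when
    arcs share an endpoint; a parity condition on four comparisons handles shared endpoints and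
    translates uniformly. The shift does not fix the lifted Coxeter element [u v]: it turns it into
    [v u]. This is why the shift is corrected by one of the two factors, and why the correction
    yields one rotation for each boundary circle. Transitivity comes from Coxeter length. A
    factorization is a path of partial products starting at 1; at a peak of the path a Hurwitz move
    lowers the peak, and the last step of an increasing path allows the exchange condition to delete
    a letter of [c]. *)

Section PresentedGroups.
Variables (X : choiceType) (rel : seq X -> seq X -> Prop).

Section Evaluation.
Variables (G : groupType) (f : X -> G).

Definition letter_eval (a : X * bool) : G := if a.2 then (f a.1)^-1 else f a.1.

Lemma prod_positive (u : seq X) :
  \prod_(a <- positive u) letter_eval a = \prod_(x <- u) f x.
Proof. by rewrite big_map. Qed.

Hypothesis frel : forall u v, rel u v ->
  \prod_(x <- u) f x = \prod_(x <- v) f x.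

Lemma pres_eq_eval u v : pres_eq rel u v ->
  \prod_(a <- u) letter_eval a = \prod_(a <- v) letter_eval a.
Proof.
elim=> {u v} // [u v w _ -> _ -> //|u u' v v' _ IHu _ IHv|x b|u v /frel uv].
- by rewrite !big_cat IHu IHv.
- by rewrite !big_cons big_nil mulg1; case: b; rewrite ?mulgV ?mulVg.
- by rewrite !prod_positive.
Qed.

Lemma pres_lift_ex :
  exists F : UMagmaMorphism.type (presented rel) G,
    forall x, F (pres_gen rel x) = f x.
Proof.
pose F (g : presented rel) := \prod_(a <- pres_repr g) letter_eval a.
have FE u : F (pres_class rel u) = \prod_(a <- u) letter_eval a.
  exact/pres_eq_eval/pres_reprE.
have FM : monoid.monoid_morphism F.
  split=> [|g h]; first by rewrite [LHS]FE big_nil.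
  rewrite -(pres_reprK g) -(pres_reprK h).
  by rewrite [_ * _]pmulE !FE big_cat.
pose FF := HB.pack_for (UMagmaMorphism.type (presented rel) G) F
  (isUMagmaMorphism.Build _ _ F FM).
by exists FF => x; rewrite /= FE big_seq1.
Qed.

End Evaluation.

Lemma pres_class_cons a u :
  pres_class rel (a :: u) =
  letter_eval (pres_gen rel) a * pres_class rel u.
Proof.
transitivity (pres_class rel [:: a] * pres_class rel u).
  by symmetry; apply: pmulE.
congr (_ * _); case: a => x [] //; rewrite /letter_eval /=.
exact/esym/(pinvE rel [:: (x, false)]).
Qed.

Lemma pres_ind (P : presented rel -> Prop) :
  P 1 -> (forall x g, P g -> P (pres_gen rel x * g)) ->
  (forall x g, P g -> P ((pres_gen rel x)^-1 * g)) -> forall g, P g.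
Proof.
move=> P1 PM PV g; rewrite -(pres_reprK g).
elim: (pres_repr g) => [|[x b] u IHu]; first exact: P1.
by rewrite pres_class_cons /letter_eval; case: b => /=; [apply: PV|apply: PM].
Qed.

Lemma pres_hom_ext (G : groupType)
  (F F' : UMagmaMorphism.type (presented rel) G) :
  (forall x, F (pres_gen rel x) = F' (pres_gen rel x)) -> F =1 F'.
Proof.
move=> FF'; elim/pres_ind => [|x g IHg|x g IHg]; first by rewrite !gmulf1.
  by rewrite !gmulfM FF' IHg.
by rewrite !gmulfM !gmulfV FF' IHg.
Qed.

Lemma pres_relP u v : rel u v ->
  \prod_(x <- u) pres_gen rel x = \prod_(x <- v) pres_gen rel x.
Proof.
have E w : \prod_(x <- w) pres_gen rel x = pres_class rel (positive w).
  by elim: w => [|x w IHw]; rewrite ?big_nil // big_cons pres_class_cons IHw.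
by move=> uv; rewrite !E; apply/pres_classP/pres_rel.
Qed.

End PresentedGroups.

(** * Conjugation identities and fans of reflections *)

Section GroupIdentities.
Variable G : groupType.
Implicit Types a b c x y : G.

Lemma conjg_commute x y : commute x y -> x ^ y = x.
Proof. by move=> xy; rewrite /conjg xy mulKg. Qed.

Lemma commuteJ x y z : commute (x ^ z) (y ^ z) <-> commute x y.
Proof.
rewrite /commute -!conjMg; split=> [|-> //]; exact: conjg_inj.
Qed.

Lemma commuteJl x y z : commute x y -> commute z y -> commute (x ^ z) y.
Proof. by move=> xy zy; rewrite -(conjg_commute (commute_sym zy)); apply/commuteJ. Qed.

Lemma braid_conj a b : a * b * a = b * a * b -> b ^ a^-1 = a ^ b.
Proof.
move=> ab; apply: (mulgI b); apply: (mulIg a).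
by rewrite /conjg invgK !mulgA mulgVK mulgV mul1g ab.
Qed.

End GroupIdentities.

Lemma gmulfJV (G H : groupType) (f : UMagmaMorphism.type G H) x y :
  f (x ^ y^-1) = f x ^ (f y)^-1.
Proof. by rewrite gmulfJ gmulfV. Qed.

Section Fan.
Variables (G : groupType) (s : int -> G) (p : nat).
Variables (F Fi H : UMagmaMorphism.type G G).
Hypotheses (FK : cancel F Fi).
Local Notation x := (s p).
Hypothesis Fs : forall j : int, (1 <= j <= p%:Z - 2)%R -> F (s j) = s (j + 1)%R.
Hypothesis Fx : (2 <= p)%N -> F (x ^ (s (p%:Z - 1))^-1) = x.
Hypothesis Hs : forall j : int, (1 <= j <= p%:Z - 1)%R -> H (s j) = s j.
Hypothesis sbraid : (2 <= p)%N ->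
  s (p%:Z - 1) * x * s (p%:Z - 1) = x * s (p%:Z - 1) * x.
Hypothesis scomm : forall i j : int,
  (1 <= i)%R -> (i + 2 <= j <= p)%R -> commute (s i) (s j).

(** The arcs from a fixed point of one boundary to successive points of the other, obtained by
    turning the bridge [s p]. The section is used twice: with the outer letters, and with the
    reversed inner letters [s_opp], where the two turns exchange their roles. *)
Definition fan k : G := iter k Fi x.

Lemma fan1 k : (k.+1 < p)%N -> fan k.+1 = fan k ^ (s (p%:Z - k%:Z - 1))^-1.
Proof.
clear Hs sbraid scomm.
elim: k => [|k IHk] kp; first by rewrite subr0 -[RHS]FK (Fx kp).
rewrite /fan iterS -/(fan k.+1) [in LHS](IHk (ltnW kp)) gmulfJV; congr (_ ^ _^-1).
by rewrite -[RHS]FK; congr (Fi _); rewrite Fs; [congr s|]; lia.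
Qed.

(** Since [s i] exchanges [i] and [i + 1], this conjugate of [s (a + k)] is the lift of an arc
    joining the boundary points [a] and [a + k + 1]. *)
Fixpoint chord (a : int) k : G :=
  if k is k'.+1 then chord (a + 1) k' ^ (s a)^-1 else s a.

Lemma chord_fix a k : (1 <= a)%R -> (a + k%:Z <= p%:Z - 1)%R ->
  H (chord a k) = chord a k.
Proof.
clear FK Fs Fx sbraid scomm.
elim: k a => [|k IHk] a a1 ap /=; first by rewrite Hs //; lia.
by rewrite gmulfJV IHk ?Hs //; lia.
Qed.

Lemma chord_shift a k : (1 <= a)%R -> (a + k%:Z <= p%:Z - 2)%R ->
  F (chord a k) = chord (a + 1) k.
Proof.
clear FK Fx Hs sbraid scomm.
elim: k a => [|k IHk] a a1 ap /=; first by rewrite Fs //; lia.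
by rewrite gmulfJV IHk ?Fs //; lia.
Qed.

Lemma chord_iter a k e : (1 <= a)%R -> (a + k%:Z + e%:Z <= p%:Z - 1)%R ->
  iter e F (chord a k) = chord (a + e%:Z) k.
Proof.
clear FK Fx Hs sbraid scomm.
elim: e a => [|e IHe] a a1 ap; first by rewrite addr0.
by rewrite iterSr chord_shift ?IHe //; [congr chord|..]; lia.
Qed.

Lemma chord_commute a k : (1 <= a)%R -> (a + k%:Z <= p%:Z - 2)%R ->
  commute x (chord a k).
Proof.
clear FK Fs Fx Hs sbraid.
elim: k a => [|k IHk] a a1 ap /=; first by apply/commute_sym/scomm; lia.
apply: commute_sym; apply: commuteJl; first by apply/commute_sym/IHk; lia.
by apply/commute_sym/commuteV/commute_sym/scomm; lia.
Qed.

(** Triangle relation for two arcs of the fan and the chord closing them. The base case is the braid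
    relation; at each step the new letter extends both the fan arc and the chord by conjugation, and
    it commutes with the bridge. *)
Lemma fan_chord k : (k.+1 < p)%N ->
  fan k.+1 * chord (p%:Z - k%:Z - 1) k = x * fan k.+1 /\
  chord (p%:Z - k%:Z - 1) k * x = x * fan k.+1.
Proof.
clear Hs.
elim: k => [|k IHk] kp.
  have fE : fan 1 = x ^ (s (p%:Z - 1))^-1 by rewrite fan1 // subr0.
  have xf : x * fan 1 = s (p%:Z - 1) * x.
    by rewrite fE (braid_conj (sbraid kp)) /conjg mulVKg.
  have -> : chord (p%:Z - 0%:Z - 1) 0 = s (p%:Z - 1) by rewrite /= subr0.
  by rewrite xf; split=> //; rewrite fE /conjg invgK mulgA mulgVK.
have [IH1 IH2] := IHk (ltnW kp).
have cx : x ^ (s (p%:Z - k.+1%:Z - 1))^-1 = x.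
  by apply/conjg_commute/commuteV/commute_sym/scomm; lia.
rewrite (fan1 kp) /=.
have -> : (p%:Z - k.+1%:Z - 1 + 1 = p%:Z - k%:Z - 1)%R by lia.
split; first by rewrite -conjMg IH1 conjMg cx.
by rewrite -{1}cx -conjMg IH2 conjMg cx.
Qed.

End Fan.

(** * Twisted endomorphisms and iteration over the integers *)

Definition twist (G : groupType) (f : G -> G) (u g : G) : G := f g ^ u.

Section Twist.
Variables (G : groupType) (f : UMagmaMorphism.type G G) (u : G).

Fact twist_morph : monoid.monoid_morphism (twist f u).
Proof.
by split=> [|g h]; rewrite /twist ?gmulf1 ?conj1g // gmulfM conjMg.
Qed.

HB.instance Definition _ := isUMagmaMorphism.Build G G (twist f u) twist_morph.
End Twist.

Section IterInt.
Variables (T : Type) (f g : T -> T).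

Definition iterz (m : int) : T -> T :=
  match m with Posz k => iter k f | Negz k => iter k.+1 g end.

Hypotheses (fK : cancel f g) (gK : cancel g f).

Lemma iterz1 m t : iterz (m + 1) t = f (iterz m t).
Proof.
case: m => k; first by have -> : (k%:Z + 1)%R = k.+1 by lia.
case: k => [|k]; first by rewrite /= gK.
have -> : (Negz k.+1 + 1)%R = Negz k by lia.
by rewrite [in RHS]/iterz iterS gK.
Qed.

Lemma iterzB1 m t : iterz (m - 1) t = g (iterz m t).
Proof. by rewrite -{2}[m](subrK 1%R) iterz1 fK. Qed.

Lemma iterzD m k t : iterz (m + k) t = iterz m (iterz k t).
Proof.
elim/int_ind: m => [|m IHm|m IHm]; first by rewrite add0r.
  have -> : (m.+1%:Z + k = m%:Z + k + 1)%R by lia.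
  by rewrite iterz1 IHm -iterz1; congr (iterz _ _); lia.
have -> : (- m.+1%:Z + k = - m%:Z + k - 1)%R by lia.
by rewrite iterzB1 IHm -iterzB1; congr (iterz _ _); lia.
Qed.

Lemma iterz_commute h m t : (forall t, f (h t) = h (f t)) ->
  iterz m (h t) = h (iterz m t).
Proof.
move=> fh.
have gh t' : g (h t') = h (g t') by rewrite -[LHS](congr1 (g \o h) (gK t')) /= -fh fK.
case: m => k; first by elim: k => //= k ->.
by rewrite /iterz; elim: k.+1 => //= l ->.
Qed.

Lemma iterz_fix m t : f t = t -> iterz m t = t.
Proof. by move=> ft; apply: (iterz_commute m t (h := fun=> t)). Qed.

Lemma iterzN m t : iterz (- m%:Z) t = iter m g t.
Proof. by case: m. Qed.

End IterInt.

Lemma iterzM (G : groupType) (f g : UMagmaMorphism.type G G) m :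
  {morph iterz f g m : x y / x * y}.
Proof.
move=> x y; case: m => k; first by elim: k => //= k ->; rewrite gmulfM.
by rewrite /iterz; elim: k.+1 => //= l ->; rewrite gmulfM.
Qed.

(** * Ascending and descending words in consecutive generators *)

Section Words.
Variables (G : groupType) (s : int -> G).
Fixpoint up (i : int) k : G := if k is k'.+1 then s i * up (i + 1) k' else 1.
Fixpoint dn (i : int) k : G := if k is k'.+1 then dn (i + 1) k' * s i else 1.

Lemma upS i k : up i k.+1 = up i k * s (i + k%:Z).
Proof.
elim: k i => [|k IHk] i; first by rewrite /= mulg1 mul1g addr0.
rewrite [LHS]/= -/(up (i + 1) k.+1) IHk mulgA.
by congr (_ * s _); lia.
Qed.

Lemma dnS i k : dn i k.+1 = s (i + k%:Z) * dn i k.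
Proof.
elim: k i => [|k IHk] i; first by rewrite /= mulg1 mul1g addr0.
rewrite [LHS]/= -/(dn (i + 1) k.+1) IHk -mulgA.
by congr (s _ * _); lia.
Qed.

Lemma up_commute g i k :
  (forall j : int, (i <= j < i + k%:Z)%R -> commute g (s j)) -> commute g (up i k).
Proof.
elim: k i => [|k IHk] i H; first exact: commute1.
by apply: commuteM; [apply: H; lia|apply: IHk => j ij; apply: H; lia].
Qed.

Lemma dn_commute g i k :
  (forall j : int, (i <= j < i + k%:Z)%R -> commute g (s j)) -> commute g (dn i k).
Proof.
elim: k i => [|k IHk] i H; first exact: commute1.
by apply: commuteM; [apply: IHk => j ij; apply: H|apply: H]; lia.
Qed.

Variable n : nat.
Hypothesis braid : (3 <= n)%N -> forall i : int,
  s i * s (i + 1)%R * s i = s (i + 1)%R * s i * s (i + 1)%R.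
Hypothesis scomm : forall i j : int,
  (i + 2 <= j <= i + n%:Z - 2)%R -> commute (s i) (s j).

(** Both [s j] and [s (j + 1)] occur in the word: one braid relation does the work and the other
    letters commute past. The bound [k < n] keeps the word from closing up around the cycle. *)
Lemma up_shift i j k : (k < n)%N -> (i <= j <= i + k%:Z - 2)%R ->
  up i k * s j = s (j + 1)%R * up i k.
Proof.
elim: k i => [|k IHk] i kn ij; first lia.
have [ij' | ij'] : (i < j)%R \/ i = j by lia.
  by rewrite /= -mulgA IHk ?mulgA ?(scomm (i := i)) //; lia.
case: k IHk kn ij => [|k] _ kn ij; first lia.
rewrite -ij' /= -!mulgA.
have -> : up (i + 1 + 1) k * s i = s i * up (i + 1 + 1) k.
  by apply/esym/up_commute => l il; apply: scomm; lia.
by rewrite !mulgA braid //; lia.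
Qed.

Lemma dn_shift i j k : (k < n)%N -> (i <= j <= i + k%:Z - 2)%R ->
  dn i k * s (j + 1)%R = s j * dn i k.
Proof.
elim: k i => [|k IHk] i kn ij; first lia.
have [ij' | ij'] : (i < j)%R \/ i = j by lia.
  rewrite /= -mulgA (_ : commute (s i) (s (j + 1)%R)); last by apply: scomm; lia.
  by rewrite mulgA IHk ?mulgA //; lia.
case: k IHk kn ij => [|k] _ kn ij; first lia.
rewrite -ij' /= !mulgA.
have -> : s i * dn (i + 1 + 1) k = dn (i + 1 + 1) k * s i.
  by apply/dn_commute => l il; apply: scomm; lia.
rewrite -!mulgA; congr (_ * _); rewrite !mulgA braid //; lia.
Qed.

End Words.

(** * Lifts of arcs to the Artin group *)

Section Lifts.
Variables (G : groupType) (s : int -> G) (p q : nat).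
Variables (sg sgi : UMagmaMorphism.type G G).
Hypotheses (p_gt0 : (0 < p)%N) (q_gt0 : (0 < q)%N).
Local Notation n := (p + q)%N.
Hypothesis per : forall i : int, s (i + n%:Z)%R = s i.
Hypothesis braid : (3 <= n)%N -> forall i : int,
  s i * s (i + 1)%R * s i = s (i + 1)%R * s i * s (i + 1)%R.
Hypothesis scomm : forall i j : int,
  (i + 2 <= j <= i + n%:Z - 2)%R -> commute (s i) (s j).
Hypothesis sgs : forall i : int, sg (s i) = s (i + 1)%R.
Hypotheses (sgK : cancel sg sgi) (sgiK : cancel sgi sg).
Hypothesis sgn : forall g, iter n sg g = g.

Local Notation up := (up s).
Local Notation dn := (dn s).

Definition inner_word : G := dn (p%:Z + 1) q.
Local Notation u := inner_word.
Definition outer_word : G := up 1 p.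
Local Notation v := outer_word.
Definition cox_word : G := u * v.
Local Notation cox := cox_word.

(** By [shift_cox] the shift maps [u * v] to [v * u]; conjugating by [u] or by [v] restores [u * v].
    On arcs, this version moves the outer endpoints one step and leaves the inner ones, and
    [inner_turn] does the opposite. *)
Definition outer_turn : UMagmaMorphism.type G G := twist sg u^-1.
Local Notation Fo := outer_turn.
Definition outer_unturn : UMagmaMorphism.type G G := twist sgi (sgi u).
Local Notation Foi := outer_unturn.
Definition inner_turn : UMagmaMorphism.type G G := twist sg v.
Local Notation Fi := inner_turn.
Definition inner_unturn : UMagmaMorphism.type G G := twist sgi (sgi v)^-1.
Local Notation Fii := inner_unturn.

Lemma outer_turnE g : Fo g = sg g ^ u^-1. Proof. by []. Qed.
Lemma inner_turnE g : Fi g = sg g ^ v. Proof. by []. Qed.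

Lemma outer_turnK : cancel Fo Foi.
Proof. by move=> g; rewrite /= /twist gmulfJ gmulfV sgK conjgKV. Qed.
Lemma outer_unturnK : cancel Foi Fo.
Proof. by move=> g; rewrite /= /twist gmulfJ !sgiK conjgK. Qed.
Lemma inner_turnK : cancel Fi Fii.
Proof. by move=> g; rewrite /= /twist gmulfJ sgK conjgK. Qed.
Lemma inner_unturnK : cancel Fii Fi.
Proof. by move=> g; rewrite /= /twist gmulfJ gmulfV !sgiK conjgKV. Qed.

Lemma shift_up i k : sg (up i k) = up (i + 1) k.
Proof. by elim: k i => [|k IHk] i /=; rewrite ?gmulf1 ?gmulfM ?sgs ?IHk. Qed.

Lemma shift_dn i k : sg (dn i k) = dn (i + 1) k.
Proof. by elim: k i => [|k IHk] i /=; rewrite ?gmulf1 ?gmulfM ?sgs ?IHk. Qed.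

Lemma shift_cox : sg u * sg v = v * u.
Proof.
rewrite /u /v shift_up shift_dn.
case: (q) (p) q_gt0 p_gt0 per scomm => [|b] [|a] // _ _ per' scomm'.
(* On the left the first letter is [s (n + 1)], which is [s 1] by periodicity, and the last is
   [s (p + 1)]. Removing these from both sides leaves words in [s 2, ..., s p] and in
   [s (p + 2), ..., s n], which commute. *)
rewrite dnS upS [up 1 _]/= [X in _ = _ * X]/=.
rewrite -(per' 1%R) -!mulgA; congr (s _ * _); first by lia.
rewrite !mulgA; congr (_ * s _); last by lia.
apply: up_commute => j ij; apply/commute_sym/dn_commute => i ji.
by apply: scomm'; lia.
Qed.

Lemma outer_turn_cox : Fo cox = cox.
Proof. by rewrite outer_turnE gmulfM shift_cox /cox /conjg invgK !mulgA mulgK. Qed.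

Lemma outer_inner_turn g : Fo (Fi g) = Fi (Fo g).
Proof.
rewrite !(outer_turnE, inner_turnE) !gmulfJ gmulfV -!conjgM; congr (_ ^ _).
by apply: (mulgI (sg u)); rewrite mulVKg mulgA shift_cox mulgK.
Qed.

Lemma outer_turn_outer (j : int) : (1 <= j <= p%:Z - 2)%R -> Fo (s j) = s (j + 1)%R.
Proof.
move=> jp; rewrite outer_turnE sgs; apply/conjg_commute/commuteV/dn_commute => i ij.
by apply: scomm; lia.
Qed.

Lemma outer_turn_inner (j : int) : (p%:Z + 1 <= j <= n%:Z - 1)%R -> Fo (s j) = s j.
Proof.
move=> jp; rewrite outer_turnE sgs /conjg invgK mulgA (dn_shift braid scomm) ?mulgK //; lia.
Qed.

Lemma inner_turn_inner (j : int) : (p%:Z + 1 <= j <= n%:Z - 2)%R -> Fi (s j) = s (j + 1)%R.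
Proof.
move=> jp; rewrite inner_turnE sgs; apply/conjg_commute/up_commute => i ij.
by apply/commute_sym/scomm; lia.
Qed.

Lemma inner_turn_outer (j : int) : (1 <= j <= p%:Z - 1)%R -> Fi (s j) = s j.
Proof.
move=> jp; rewrite inner_turnE sgs /conjg -(up_shift braid scomm) ?mulKg //; lia.
Qed.

Lemma outer_turn_bridge : (2 <= p)%N -> Fo (s p ^ (s (p%:Z - 1))^-1) = s p.
Proof.
move=> p2; have n3 : (3 <= n)%N by lia.
have := braid n3 (p%:Z - 1)%R; rewrite subrK => /braid_conj ->.
(* The braid relation has replaced the argument by [s (p - 1) ^ s p]. After the shift the conjugator
   [s (p + 1)] cancels against the last letter of [u], and the rest of [u] commutes with [s p]. *)
rewrite outer_turnE gmulfJ !sgs subrK -conjgM /u.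
case: (q) q_gt0 scomm => // b _ scomm'.
rewrite /= invgM mulVKg; apply/conjg_commute/commuteV/dn_commute => i ij.
by apply: scomm'; lia.
Qed.

Lemma inner_turn_bridge : (2 <= q)%N -> Fi (s p) = s p ^ (s (p%:Z + 1)%R)^-1.
Proof.
move=> q2; have n3 : (3 <= n)%N by lia.
have sb := esym (braid n3 p); rewrite inner_turnE sgs (braid_conj sb) /v.
case: (p) p_gt0 scomm => // a _ scomm'.
rewrite upS conjgM (_ : 1 + a%:Z = a.+1)%R; last by lia.
congr (_ ^ _).
apply/conjg_commute/up_commute => i ij.
by apply/commute_sym/scomm'; lia.
Qed.

(* The p x q array with entries s (a + i + j), read by rows and by columns. *)
Fixpoint word_rows (a : int) i j : G :=
  if i is i'.+1 then word_rows a i' j * dn (a + i'%:Z) j else 1.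
Fixpoint word_cols (a : int) i j : G :=
  if j is j'.+1 then up (a + j'%:Z) i * word_cols a i j' else 1.

(** The two readings differ by commutations only: a new corner letter [s (a + i + j)] commutes with
    every letter of the rectangle before it, since the indices differ by at least 2 and at most
    [n - 2]. *)
Lemma word_rows_cols a i j : (i <= p)%N -> (j <= q)%N -> word_rows a i j = word_cols a i j.
Proof.
elim: i => [|i IHi] ip jq /=; first by elim: {jq}j => //= j <-; rewrite mulg1.
rewrite {}IHi; [|lia..].
elim: j jq => [|j IHj] jq; first by rewrite mulg1.
rewrite dnS [word_cols _ i _]/= -mulgA (mulgA _ (s _)).
have -> : word_cols a i j * s (a + i%:Z + j%:Z) = s (a + i%:Z + j%:Z) * word_cols a i j.
  suff H l : (l <= j)%N -> commute (s (a + i%:Z + j%:Z)) (word_cols a i l) by exact/esym/H.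
  elim: l => [|l IHl] lj; first exact: commute1.
  apply: commuteM; last by apply: IHl; lia.
  by apply: up_commute => k ik; apply/commute_sym/scomm; lia.
rewrite [word_cols _ _ j.+1]/= -IHj; last by lia.
rewrite -[s _ * up _ _]/(up _ i.+1) upS !mulgA.
by congr (_ * s _ * _ * _); lia.
Qed.

Lemma iter_outer_turn k g : iter k Fo g = iter k sg g ^ (word_rows (p%:Z + 1) k q)^-1.
Proof.
have sg_rows l : u * sg (word_rows (p%:Z + 1) l q) = word_rows (p%:Z + 1) l.+1 q.
  elim: l => [|l IHl]; first by rewrite /= gmulf1 mulg1 mul1g addr0.
  rewrite [word_rows _ l.+1 _]/= gmulfM mulgA IHl shift_dn [RHS]/=.
  by congr (_ * dn _ _); lia.
elim: k => [|k IHk]; first by rewrite /= invg1 conjg1.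
by rewrite iterS IHk outer_turnE gmulfJV -conjgM -invgM sg_rows.
Qed.

Lemma iter_inner_turn k g : iter k Fi g = iter k sg g ^ word_cols 1 p k.
Proof.
have sg_cols l : sg (word_cols 1 p l) * v = word_cols 1 p l.+1.
  elim: l => [|l IHl]; first by rewrite /= gmulf1 mulg1 mul1g addr0.
  rewrite [word_cols _ _ l.+1]/= gmulfM -mulgA IHl shift_up [RHS]/=.
  by congr (up _ _ * _); lia.
elim: k => [|k IHk]; first by rewrite /= conjg1.
by rewrite iterS IHk inner_turnE gmulfJ -conjgM sg_cols.
Qed.

(** The two iterates contribute conjugations by the inverse of the row word and by the shifted
    column word. These are readings of the same array and cancel, leaving [n] shifts. Turning both
    boundaries once around is thus the trivial deck translation. *)
Lemma full_turn g : iter p Fo (iter q Fi g) = g.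
Proof.
rewrite iter_outer_turn iter_inner_turn.
have -> l h x : iter l sg (h ^ x) = iter l sg h ^ iter l sg x.
  by elim: l => //= l ->; rewrite gmulfJ.
have sgup l i k : iter l sg (up i k) = up (i + l%:Z) k.
  by elim: l => [|l IHl] /=; rewrite ?addr0 // IHl shift_up; congr up; lia.
have -> : iter p sg (word_cols 1 p q) = word_cols (p%:Z + 1) p q.
  elim: (q) => [|k IHk] /=.
    by elim: (p) => //= l ->; rewrite gmulf1.
  rewrite -IHk -sgup; have {}IHk l x y : iter l sg (x * y) = iter l sg x * iter l sg y.
    by elim: l => //= l ->; rewrite gmulfM.
  rewrite IHk sgup; congr (_ * _); rewrite sgup; congr up; lia.
by rewrite -iterD sgn word_rows_cols // conjgK.
Qed.

Definition turn a b g : G := iterz Fo Foi a (iterz Fi Fii b g).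
Local Notation T := turn.

Lemma turnD a a' b b' g : T (a + a') (b + b') g = T a b (T a' b' g).
Proof.
rewrite /T (iterzD inner_turnK inner_unturnK) (iterzD outer_turnK outer_unturnK); congr (iterz _ _ a _).
apply/esym/(iterz_commute inner_turnK inner_unturnK) => h.
by apply/esym/(iterz_commute outer_turnK outer_unturnK) => {}h; apply: outer_inner_turn.
Qed.

Lemma turn0 g : T 0 0 g = g. Proof. by []. Qed.

Lemma turnM a b : {morph T a b : g h / g * h}.
Proof. by move=> g h; rewrite /T !iterzM. Qed.

Lemma turnV a b g : T a b g^-1 = (T a b g)^-1.
Proof.
apply/esym/mulg1_eq; rewrite -turnM mulgV.
by apply: (mulgI (T a b 1)); rewrite -turnM !mulg1.
Qed.

Lemma turn_commute a b g h : commute g h -> commute (T a b g) (T a b h).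
Proof. by rewrite /commute -!turnM => ->. Qed.

Lemma turn_full a b g : T (a + p%:Z) (b + q%:Z) g = T a b g.
Proof. by rewrite turnD /T /= full_turn. Qed.

Lemma turn_periodic m a b g : T (a + m * p%:Z) (b + m * q%:Z) g = T a b g.
Proof.
elim/int_ind: m => [|m IHm|m IHm]; first by rewrite !mul0r !addr0.
  by rewrite -IHm -[RHS]turn_full; congr T; lia.
by rewrite -IHm -[LHS]turn_full; congr T; lia.
Qed.

Lemma turn_inner_fix b g : Fi g = g -> T 0 b g = g.
Proof. by move=> gF; rewrite /T /= (iterz_fix inner_turnK inner_unturnK). Qed.

Lemma turn_outer_fix a g : Fo g = g -> T a 0 g = g.
Proof. by move=> gF; rewrite /T /= (iterz_fix outer_turnK outer_unturnK). Qed.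

Definition s_opp (i : int) : G := s (n%:Z - i).

Lemma s_opp_q : s_opp q = s p. Proof. by congr s; lia. Qed.

Lemma inner_unturn_opp (j : int) : (1 <= j <= q%:Z - 2)%R -> Fii (s_opp j) = s_opp (j + 1)%R.
Proof.
by move=> jq; rewrite -[RHS]inner_turnK /s_opp inner_turn_inner; [do 2!congr (_ _)|]; lia.
Qed.

Lemma outer_unturn_opp (j : int) : (1 <= j <= q%:Z - 1)%R -> Foi (s_opp j) = s_opp j.
Proof. by move=> jq; rewrite -[RHS]outer_turnK /s_opp outer_turn_inner //; lia. Qed.

Lemma inner_unturn_bridge : (2 <= q)%N -> Fii (s_opp q ^ (s_opp (q%:Z - 1))^-1) = s_opp q.
Proof.
move=> q2; rewrite s_opp_q -[RHS]inner_turnK inner_turn_bridge //; congr (Fii (_ ^ (s _)^-1)); lia.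
Qed.

Lemma s_opp_braid : (2 <= q)%N ->
  s_opp (q%:Z - 1) * s_opp q * s_opp (q%:Z - 1) =
  s_opp q * s_opp (q%:Z - 1) * s_opp q.
Proof.
move=> q2; rewrite s_opp_q /s_opp.
have -> : (n%:Z - (q%:Z - 1) = p%:Z + 1)%R by lia.
by apply/esym/braid; lia.
Qed.

Lemma s_opp_commute (i j : int) :
  (1 <= i)%R -> (i + 2 <= j <= q)%R -> commute (s_opp i) (s_opp j).
Proof. by move=> i1 ij; apply/commute_sym/scomm; lia. Qed.

Lemma s_braid : (2 <= p)%N ->
  s (p%:Z - 1) * s p * s (p%:Z - 1) = s p * s (p%:Z - 1) * s p.
Proof.
by move=> p2; have := @braid _ (p%:Z - 1)%R; rewrite subrK; apply; lia.
Qed.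

Lemma s_commute (i j : int) :
  (1 <= i)%R -> (i + 2 <= j <= p)%R -> commute (s i) (s j).
Proof. by move=> i1 ij; apply: scomm; lia. Qed.

Definition cross_lift a b : G := T a b (s p).
Local Notation X := cross_lift.

Lemma turn_cross a b a' b' : T a b (X a' b') = X (a + a') (b + b').
Proof. by rewrite /X turnD. Qed.

Lemma fan_outer k : fan s p Foi k = X (- k%:Z) 0.
Proof. by rewrite /X /T /= iterzN. Qed.

Lemma fan_inner k : fan s_opp q Fi k = X 0 k%:Z.
Proof. by rewrite /fan s_opp_q. Qed.

(** Meant for [0 < k < p]. The chord joins the points [p - k] and [p], whose outer indices are [-k]
    and 0 because indexing starts at the bridge; turning by [a + k] brings them to [a] and
    [a + k]. *)
Definition outer_lift a (k : int) : G := T (a + k) 0 (chord s (p%:Z - k) `|k - 1|).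
Local Notation y := outer_lift.
Definition inner_lift b (k : int) : G := T 0 b (chord s_opp (q%:Z - k) `|k - 1|).
Local Notation z := inner_lift.

(** Chords slide along under the outer turn and are fixed by the inner one. The freedom in [e] and
    [b] allows a chord and a crossing arc to be written as images under one and the same [T], so
    that relations near the bridge can be transported. *)
Lemma outer_liftE a b (k e : int) : (0 < k <= e)%R -> (e < p%:Z)%R ->
  y a k = T (a + e) b (chord s (p%:Z - e) `|k - 1|).
Proof.
move=> ke ep; rewrite /y.
have /(chord_iter outer_turn_outer) : (p%:Z - e + `|k - 1|%N + `|e - k|%N <= p%:Z - 1)%R by lia.
have -> : (p%:Z - e + `|e - k|%N = p%:Z - k)%R by lia.
move=> <-; last by lia.
set g := chord _ _ _.
have -> : T (a + e) b g = T (a + e) 0 g.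
  rewrite -[(a + e)%R]addr0 -[b]add0r turnD turn_inner_fix ?addr0 //.
  by apply: (chord_fix inner_turn_outer); lia.
have -> : iter `|e - k|%N Fo g = T (e - k) 0 g.
  by rewrite /T /=; have -> : (e - k = `|e - k|%N)%R by lia.
rewrite -turnD; congr T; lia.
Qed.

Lemma inner_liftE a b (k e : int) : (0 < k <= e)%R -> (e < q%:Z)%R ->
  z b k = T a (b + k - e) (chord s_opp (q%:Z - e) `|k - 1|).
Proof.
move=> ke eq; rewrite /z.
have /(chord_iter inner_unturn_opp) : (q%:Z - e + `|k - 1|%N + `|e - k|%N <= q%:Z - 1)%R by lia.
have -> : (q%:Z - e + `|e - k|%N = q%:Z - k)%R by lia.
move=> <-; last by lia.
set g := chord _ _ _.
have gF : Fo g = g.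
  have gF : Foi g = g by apply: (chord_fix outer_unturn_opp); lia.
  by rewrite -{1}gF outer_unturnK.
have -> : T a (b + k - e) g = T 0 (b + k - e) g.
  by rewrite -[a]add0r -[(b + k - e)%R]addr0 turnD turn_outer_fix // addr0.
have -> : iter `|e - k|%N Fii g = T 0 (k - e) g.
  rewrite (_ : k - e = - `|e - k|%N%:Z)%R; last by lia.
  by rewrite /T iterzN.
rewrite -turnD; congr T; lia.
Qed.

Lemma cross_lift_periodic a b m : X (a + m * p%:Z) (b + m * q%:Z) = X a b.
Proof. exact: turn_periodic. Qed.

Lemma outer_lift_periodic a k m : (0 < k < p%:Z)%R -> y (a + m * p%:Z) k = y a k.
Proof.
move=> kp; have k1 : (0 < k <= k)%R by lia.
rewrite (outer_liftE _ (0 + m * q%:Z) k1); last by lia.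
by rewrite /y -[RHS](turn_periodic m); congr T; lia.
Qed.

Lemma inner_lift_periodic b k m : (0 < k < q%:Z)%R -> z (b + m * q%:Z) k = z b k.
Proof.
move=> kq; have k1 : (0 < k <= k)%R by lia.
rewrite (inner_liftE (0 + m * p%:Z) _ k1); last by lia.
by rewrite /z -[RHS](turn_periodic m); congr T; lia.
Qed.

Lemma cross_outer a b k : (0 < k < p%:Z)%R ->
  X a b * y a k = X (a + k) b * X a b /\ y a k * X (a + k) b = X (a + k) b * X a b.
Proof.
move=> kp; have k1 : (0 < k <= k)%R by lia.
have /(fan_chord outer_turnK outer_turn_outer outer_turn_bridge s_braid s_commute) :
  (`|k - 1|.+1 < p)%N by lia.
rewrite fan_outer (outer_liftE a b k1); last by lia.
have -> : (p%:Z - `|k - 1|%N%:Z - 1 = p%:Z - k)%R by lia.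
have -> : (- `|k - 1|%N.+1%:Z = - k)%R by lia.
have -> : X a b = T (a + k) b (X (- k) 0) by rewrite turn_cross addr0 addrK.
by rewrite -!turnM => -[-> ->].
Qed.

Lemma cross_inner a b k : (0 < k < q%:Z)%R ->
  X a (b + k) * z b k = X a b * X a (b + k) /\ z b k * X a b = X a b * X a (b + k).
Proof.
move=> kq; have k1 : (0 < k <= k)%R by lia.
have /(fan_chord inner_unturnK inner_unturn_opp inner_unturn_bridge s_opp_braid s_opp_commute) :
  (`|k - 1|.+1 < q)%N by lia.
rewrite s_opp_q fan_inner (inner_liftE a b k1); last by lia.
have -> : (q%:Z - `|k - 1|%N%:Z - 1 = q%:Z - k)%R by lia.
have -> : (`|k - 1|%N.+1%:Z = k)%R by lia.
have -> : X a (b + k) = T a b (X 0 k) by rewrite turn_cross addr0.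
by rewrite addrK -!turnM => -[-> ->].
Qed.

Lemma cross_outer_commute a b k e : (0 < k < e)%R -> (e < p%:Z)%R ->
  commute (X (a + e) b) (y a k).
Proof.
move=> ke ep; rewrite (outer_liftE a b (e := e)); [|lia..].
by apply/turn_commute/(chord_commute s_commute); lia.
Qed.

Lemma cross_inner_commute a b k e : (0 < k < e)%R -> (e < q%:Z)%R ->
  commute (X a (b + e)) (z b k).
Proof.
move=> ke eq; rewrite (inner_liftE (a - p%:Z) b (e := k + q%:Z - e)); [|lia..].
have -> : X a (b + e) = T (a - p%:Z) (b + k - (k + q%:Z - e)) (s p).
  by rewrite -(cross_lift_periodic _ _ (-1)); congr T; lia.
by rewrite -s_opp_q; apply/turn_commute/(chord_commute s_opp_commute); lia.
Qed.

Lemma cross_lift_outer k : (k < p)%N -> X (- k%:Z) 0 = s p ^ (up (p%:Z - k%:Z) k)^-1.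
Proof.
rewrite -fan_outer; elim: k => [|k IHk] kp; first by rewrite /= invg1 conjg1.
rewrite (fan1 outer_turnK outer_turn_outer outer_turn_bridge) // {}IHk; last by lia.
rewrite -conjgM -invgM; congr (_ ^ _^-1); rewrite /=.
by congr (s _ * up _ _); lia.
Qed.

Lemma cross_lift_inner k : (k < q)%N -> X 0 k%:Z = s p ^ (dn (p%:Z + 1) k)^-1.
Proof.
rewrite -fan_inner; elim: k => [|k IHk] kq; first by rewrite /= invg1 conjg1 s_opp_q.
rewrite (fan1 inner_unturnK inner_unturn_opp inner_unturn_bridge) // {}IHk; last by lia.
rewrite -conjgM -invgM dnS; congr (_ ^ (_ * _)^-1).
by rewrite /s_opp; congr s; lia.
Qed.

Lemma dn_dn i k : (k.+1 < n)%N -> dn i k.+1 * dn (i + 1) k = dn i k * dn i k.+1.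
Proof.
move=> kn.
suff H l j : (i <= j)%R -> (j + l%:Z <= i + k%:Z)%R ->
    dn i k.+1 * dn (j + 1) l = dn j l * dn i k.+1 by apply: H; lia.
elim: l j => [|l IHl] j ij jl; first by rewrite /= mulg1 mul1g.
rewrite -[dn (j + 1) l.+1]/(dn (j + 1 + 1) l * s (j + 1)).
rewrite -[dn j l.+1]/(dn (j + 1) l * s j) mulgA IHl; [|lia..].
by rewrite -(mulgA _ _ (s (j + 1))) (dn_shift braid scomm) ?mulgA //; lia.
Qed.

Lemma cross_lift_last_conj : dn (p%:Z + 1) q.-1 * X 1 0 = s n * dn (p%:Z + 1) q.-1.
Proof.
have -> : X 1 0 = s (p%:Z + 1) ^ u^-1 by rewrite -sgs.
have [b qE] : exists b, q = b.+1 by exists q.-1; lia.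
have D : dn (p%:Z + 1) b.+1 * dn (p%:Z + 1 + 1) b = dn (p%:Z + 1) b * dn (p%:Z + 1) b.+1.
  by apply: dn_dn; lia.
have nE : dn (p%:Z + 1) b.+1 = s n * dn (p%:Z + 1) b.
  by rewrite dnS; congr (s _ * _); lia.
have -> : u = dn (p%:Z + 1) b.+1 by rewrite /u qE.
have -> : dn (p%:Z + 1) q.-1 = dn (p%:Z + 1) b by rewrite qE.
have dE : dn (p%:Z + 1) b.+1 = dn (p%:Z + 1 + 1) b * s (p%:Z + 1) by [].
rewrite -nE /conjg invgK; move: (dn _ b) (dn _ b) (dn _ b.+1) D dE => d0 d' d1 D dE.
by apply: (mulIg d1); rewrite !mulgA mulgVK -D -mulgA -dE.
Qed.

(** The letter [s n] is the second bridge between the boundaries. The identity shows that it too is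
    a lift obtained from [s p], like the other letters. *)
Lemma cross_lift_last : X 1 (q%:Z - 1) = s n.
Proof.
have -> : X 1 (q%:Z - 1) = Fo (X 0 q.-1%:Z).
  by rewrite (_ : q%:Z - 1 = q.-1%:Z)%R //; lia.
rewrite cross_lift_inner; last by lia.
rewrite gmulfJV; set D := dn _ _.
have -> : Fo D = D.
  have H k i : (p%:Z + 1 <= i)%R -> (i + k%:Z <= n%:Z)%R -> Fo (dn i k) = dn i k.
    elim: k i => [|k IHk] i ip iq; first by rewrite gmulf1.
    by rewrite -[dn i k.+1]/(dn (i + 1) k * s i) gmulfM IHk ?outer_turn_inner //; lia.
  by apply: H; lia.
by rewrite /conjg invgK mulgA -[Fo (s p)]/(X 1 0) cross_lift_last_conj mulgK.
Qed.

(** Arcs with the same endpoints that differ by winding. The product [X 1 0 * X (1 - p) 0] equals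
    [D^-1 * cox * A^-1]. Outer turns fix [cox] and [D]; inner turns fix [A], so by periodicity [p]
    outer turns fix it as well. Hence [p] outer turns fix the product, and turning gives all [a] and
    [b]. *)
Lemma cross_affine a b : X (a + p%:Z) b * X a b = X a b * X (a - p%:Z) b.
Proof.
set A := up 1 p.-1; set D := dn (p%:Z + 1) q.-1.
have AF : Fi A = A.
  have H k i : (1 <= i)%R -> (i + k%:Z <= p%:Z)%R -> Fi (up i k) = up i k.
    elim: k i => [|k IHk] i i1 ip; first by rewrite gmulf1.
    by rewrite [up _ _]/= gmulfM IHk ?inner_turn_outer //; lia.
  by apply: H; lia.
have DF : Fo D = D.
  have H k i : (p%:Z + 1 <= i)%R -> (i + k%:Z <= n%:Z)%R -> Fo (dn i k) = dn i k.
    elim: k i => [|k IHk] i ip iq; first by rewrite gmulf1.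
    by rewrite -[dn i k.+1]/(dn (i + 1) k * s i) gmulfM IHk ?outer_turn_inner //; lia.
  by apply: H; lia.
have cE : cox = D * (X 1 0 * X (1 - p%:Z) 0) * A.
  have -> : (1 - p%:Z = - p.-1%:Z)%R by lia.
  rewrite cross_lift_outer; last by lia.
  have -> : (p%:Z - p.-1%:Z = 1)%R by lia.
  have DX : D * X 1 0 = s n * D := cross_lift_last_conj.
  have uE : u = s n * D.
    by rewrite /u -{1}(prednK q_gt0) dnS; congr (s _ * _); lia.
  have vE : v = A * s p.
    by rewrite /v -{1}(prednK p_gt0) upS; congr (_ * s _); lia.
  rewrite /cox uE vE -/A; clear uE vE AF DF; clearbody A D.
  move: (X 1 0) DX => x1 DX.
  by rewrite /conjg invgK !mulgA DX mulgVK.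
have {cE} : X 1 0 * X (1 - p%:Z) 0 = D^-1 * cox * A^-1.
  by rewrite cE -!mulgA mulgV mulg1 mulKg.
move=> XX.
have AT : T p%:Z 0 A = A.
  have := turn_periodic 1 0 0 A; rewrite turn0 => {2}<-.
  by rewrite -{1}(turn_inner_fix q AF) -turnD; congr T; lia.
have {AT} XT : T p%:Z 0 (X 1 0 * X (1 - p%:Z) 0) = X 1 0 * X (1 - p%:Z) 0.
  by rewrite XX 2!turnM !turnV (turn_outer_fix _ outer_turn_cox) (turn_outer_fix _ DF) AT.
have := congr1 (T (a - 1) b) XT.
rewrite -turnD (turnM _ _ (X 1 0) (X (1 - p%:Z) 0)) (turnM (a - 1) _ (X 1 0)) !turn_cross.
have -> : (a - 1 + p%:Z + 1 = a + p%:Z)%R by lia.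
have -> : (a - 1 + p%:Z + (1 - p%:Z) = a)%R by lia.
have -> : (a - 1 + 1 = a)%R by lia.
have -> : (a - 1 + (1 - p%:Z) = a - p%:Z)%R by lia.
by rewrite !addr0.
Qed.

Lemma cross_fan_commute i j : (0 < i < p)%N -> (0 < j < q)%N ->
  commute (X 0 j%:Z) (X (- i%:Z) 0).
Proof.
move=> ip jq; rewrite -fan_outer -fan_inner.
have sX (l : int) k : (k < q)%N -> (1 <= l <= p%:Z - 2)%R ->
    commute (s l) (fan s_opp q Fi k).
  move=> kq lp; rewrite fan_inner cross_lift_inner //; apply: commute_sym.
  have scom m : (p%:Z <= m <= p%:Z + k%:Z)%R -> commute (s m) (s l).
    by move=> mp; apply/commute_sym/scomm; lia.
  apply: commuteJl; first by apply: scom; lia.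
  apply/commute_sym/commuteV/dn_commute => m mk.
  by apply/commute_sym/scom; lia.
elim: i ip => // -[|i] IHi ip; last first.
  rewrite (fan1 outer_turnK outer_turn_outer outer_turn_bridge); last by lia.
  apply/commute_sym/commuteJl; first by apply/commute_sym/IHi; lia.
  by apply/commute_sym/commuteV/commute_sym/sX; lia.
have fE : fan s p Foi 1 = s (p%:Z - 1) ^ s p.
  rewrite (fan1 outer_turnK outer_turn_outer outer_turn_bridge) ?subr0; last by lia.
  by apply/braid_conj/s_braid; lia.
clear IHi; elim: j jq => // -[|j] IHj jq; last first.
  rewrite (fan1 inner_unturnK inner_unturn_opp inner_unturn_bridge); last by lia.
  apply: commuteJl; first by apply: IHj; lia.
  have scom m : (p%:Z - 1 <= m <= p%:Z)%R -> commute (s m) (s_opp (q%:Z - j.+1%:Z - 1)).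
    by move=> mp; apply/scomm; lia.
  rewrite fE; apply/commute_sym/commuteV; apply: commuteJl; apply: scom; lia.
(* In the remaining case [i = j = 1] both arcs are conjugates by [s p], of [s (p - 1)] and of
   [s (p + 1)], which commute. *)
rewrite fE (fan1 inner_unturnK inner_unturn_opp inner_unturn_bridge); last by lia.
rewrite subr0 (braid_conj (s_opp_braid _)) ?s_opp_q; last by lia.
by apply/commuteJ/commute_sym/scomm; lia.
Qed.

Lemma cross_cross_commute a b i j : (0 < i < p%:Z)%R -> (0 < j < q%:Z)%R ->
  commute (X (a + i) (b + j)) (X a b).
Proof.
move=> ip jq.
have -> : X (a + i) (b + j) = T (a + i) b (X 0 `|j|%N) by rewrite turn_cross; congr X; lia.
have -> : X a b = T (a + i) b (X (- `|i|%N%:Z) 0) by rewrite turn_cross; congr X; lia.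
by apply/turn_commute/cross_fan_commute; lia.
Qed.

Lemma outer_lift_simple (j : int) : (1 <= j <= p%:Z - 1)%R -> y (j - p%:Z) 1 = s j.
Proof.
move=> jp; rewrite (outer_liftE _ 0 (e := p%:Z - j)); [|lia..].
have -> : (j - p%:Z + (p%:Z - j) = 0)%R by lia.
by rewrite turn0 /=; congr s; lia.
Qed.

Lemma inner_lift_simple (j : int) : (p%:Z + 1 <= j <= n%:Z - 1)%R ->
  z (j - p%:Z - 1) 1 = s j.
Proof.
move=> jq; rewrite (inner_liftE 0 _ (e := j - p%:Z)); [|lia..].
have -> : (j - p%:Z - 1 + 1 - (j - p%:Z) = 0)%R by lia.
by rewrite turn0 /= /s_opp; congr s; lia.
Qed.

End Lifts.

(** * Hurwitz moves on pairs of lifts *)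

Section HurwitzPair.
Variables (G : groupType) (L : G -> Prop).

Definition hurwitz_closed t1 t2 := L (t2 ^ t1^-1) /\ L (t1 ^ t2).

Lemma hurwitz_closedI t1 t2 t3 t4 : L t3 -> L t4 ->
  t1 * t2 = t3 * t1 -> t1 * t2 = t2 * t4 -> hurwitz_closed t1 t2.
Proof.
move=> L3 L4 E3 E4; split.
  by rewrite /conjg invgK mulgA E3 mulgK.
by rewrite /conjg E4 mulKg.
Qed.

Lemma hurwitz_closedC t1 t2 : L t1 -> L t2 -> commute t1 t2 ->
  hurwitz_closed t1 t2.
Proof. by move=> L1 L2 c12; apply: (hurwitz_closedI L2 L1). Qed.

End HurwitzPair.

Lemma int_mod_window (p : nat) (a b : int) : (0 < p)%N ->
  exists m : int, (b < a + m * p%:Z <= b + p%:Z)%R.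
Proof.
move=> p0; exists (- ((a - b - 1) %/ p%:Z)%Z)%R.
have pN0 : (p%:Z != 0)%R by lia.
have := divz_eq (a - b - 1)%R p; have p0' : (0 < p%:Z)%R by lia.
have := ltz_pmod (a - b - 1)%R p0'.
have := modz_ge0 (a - b - 1)%R pN0; rewrite mulNr.
by move: (_ %/ _)%Z (_ %% _)%Z => u v; lia.
Qed.

(** * Fans with a common apex and their chords *)

Section FanCalculus.
Variables (G : groupType) (X : int -> G) (y : int -> int -> G) (p : nat).
Hypothesis p_gt0 : (0 < p)%N.
Hypothesis Xy1 : forall a k : int, (0 < k < p%:Z)%R ->
  X a * y a k = X (a + k)%R * X a.
Hypothesis Xy2 : forall a k : int, (0 < k < p%:Z)%R ->
  y a k * X (a + k)%R = X (a + k)%R * X a.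
Hypothesis y_turn : forall a k m : int, (0 < k < p%:Z)%R ->
  y (a + m * p%:Z)%R k = y a k.
Hypothesis Xyc : forall a k e m : int, (0 < k < e)%R -> (e < p%:Z)%R ->
  commute (X (a + e + m * p%:Z)%R) (y a k).

(** Deduced from the fan alone: multiply by the fan arc at [a + k + l] on the right, or at [a] on
    the left. It passes through the chord that avoids its endpoint and turns the others into fan
    arcs; then cancel it. *)
Lemma chord_triangle (a k l : int) : (0 < k)%R -> (0 < l)%R -> (k + l < p%:Z)%R ->
  y (a + k) l * y a (k + l) = y a k * y (a + k) l /\
  y a (k + l) * y a k = y a k * y (a + k) l.
Proof.
move=> k0 l0 kl.
have ac : X a * y a (k + l) = X (a + k + l) * X a by rewrite Xy1 ?addrA //; lia.
have ac' : y a (k + l) * X (a + k + l) = X (a + k + l) * X a.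
  by rewrite -addrA Xy2 //; lia.
have ca : commute (X a) (y (a + k) l).
  have := @Xyc (a + k) l (p%:Z - k) (-1).
  by rewrite (_ : a + k + (p%:Z - k) + -1 * p%:Z = a)%R; [apply|]; lia.
have cc : commute (X (a + k + l)) (y a k).
  have := @Xyc a k (k + l) 0.
  by rewrite (_ : a + (k + l) + 0 * p%:Z = a + k + l)%R; [apply|]; lia.
split.
  apply: (mulIg (X (a + k + l))).
  rewrite -mulgA ac' mulgA Xy2; last by lia.
  rewrite -!mulgA Xy2; last by lia.
  by rewrite [in RHS]mulgA -cc -mulgA Xy2 //; lia.
apply: (mulgI (X a)); rewrite mulgA ac -mulgA Xy1; last by lia.
rewrite mulgA -Xy1; last by lia.
by rewrite -mulgA -ca !mulgA Xy1 //; lia.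
Qed.

Lemma y_conj a k : (0 < k < p%:Z)%R -> y a k = X (a + k) ^ X a.
Proof. by move=> kp; rewrite /conjg -Xy1 // mulKg. Qed.

Lemma y_commute_X a b k : (0 < k < p%:Z)%R ->
  (exists m : int, (a + k < b + m * p%:Z < a + p%:Z)%R) -> commute (X b) (y a k).
Proof.
move=> kp [m bm].
have := @Xyc a k (b + m * p%:Z - a) (- m).
by rewrite (_ : a + _ + _ = b)%R; [apply|]; lia.
Qed.

Lemma chord_disjoint a k e l : (0 < k < e)%R -> (0 < l)%R -> (e + l < p%:Z)%R ->
  commute (y a k) (y (a + e) l).
Proof.
move=> ke l0 el; rewrite [y (a + e) l]y_conj; last by lia.
by apply/commute_sym/commuteJl; apply: y_commute_X; try exists 0%R; lia.
Qed.

Lemma chord_nested a k e l : (0 < e)%R -> (0 < l)%R -> (e + l < k)%R -> (k < p%:Z)%R ->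
  commute (y a k) (y (a + e) l).
Proof.
move=> e0 l0 el kp; rewrite [y a k]y_conj; last by lia.
by apply: commuteJl; apply: y_commute_X; [|exists 0%R| |exists 1%R]; lia.
Qed.

Variable L : G -> Prop.
Hypotheses (LX : forall a, L (X a)) (Ly : forall a k, (0 < k < p%:Z)%R -> L (y a k)).

(** The forbidden window contains [b + k] but not [b]: in this order the arc may share the first
    endpoint of the chord, where the triangle relation applies, but not the second. In the remaining
    allowed positions the two commute. *)
Lemma fan_chord_closed a b k : (0 < k < p%:Z)%R ->
  (forall m : int, ~~ (b < a + m * p%:Z <= b + k)%R) ->
  hurwitz_closed L (X a) (y b k).
Proof.
move=> kp ab; have [m] := int_mod_window a b p_gt0; have := ab m => {}ab am.
have [am'|am'] : (a + m * p%:Z < b + p%:Z)%R \/ (a = b + (1 - m) * p%:Z)%R by lia.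
  apply: hurwitz_closedC => //; first exact: Ly.
  by apply: y_commute_X => //; exists m; lia.
rewrite -(y_turn b (1 - m) kp) am'.
move: (b + (1 - m) * p%:Z)%R => c.
by apply: (hurwitz_closedI (LX (c + k)) (LX (c + k))); rewrite Xy1 ?Xy2 //.
Qed.

Lemma chord_fan_closed a b k : (0 < k < p%:Z)%R ->
  (forall m : int, ~~ (a <= b + m * p%:Z < a + k)%R) ->
  hurwitz_closed L (y a k) (X b).
Proof.
move=> kp ab; have [m] := int_mod_window b (a - 1) p_gt0; have := ab m => {}ab am.
have [am'|am'] : (a + k < b + m * p%:Z < a + p%:Z)%R \/ (b = a - m * p%:Z + k)%R by lia.
  apply: hurwitz_closedC => //; first exact: Ly.
  by apply/commute_sym/y_commute_X => //; exists m; lia.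
have -> : y a k = y (a - m * p%:Z) k by rewrite -(y_turn a (- m) kp) mulNr.
rewrite am'; move: (a - m * p%:Z)%R => c.
by apply: (hurwitz_closedI (LX c) (LX c)); rewrite Xy2 ?Xy1 //.
Qed.

Lemma chord_chord_closed a k b l : (0 < k < p%:Z)%R -> (0 < l < p%:Z)%R ->
  (forall m : int, (b < a + m * p%:Z <= b + l)%R = (b < a + k + m * p%:Z <= b + l)%R) ->
  hurwitz_closed L (y a k) (y b l).
Proof.
move=> kp lp ab; have [m am] := int_mod_window a b p_gt0.
have := ab m; have := ab (m - 1)%R; rewrite -(y_turn a m kp).
have [e eE] : exists e : int, (a + m * p%:Z = b + e)%R.
  by exists (a + m * p%:Z - b)%R; lia.
have -> : (a + k + m * p%:Z = b + e + k)%R by lia.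
have -> : (a + (m - 1) * p%:Z = b + e - p%:Z)%R by lia.
have -> : (a + k + (m - 1) * p%:Z = b + e + k - p%:Z)%R by lia.
rewrite {}eE in am * => {ab a m} ab1 ab0.
have Lyk c i : (0 < i)%R -> (i < p%:Z)%R -> L (y c i) by move=> i0 ip; apply: Ly; lia.
have [el|el] : (e <= l)%R \/ (l < e)%R by lia.
  have [ekl|ekl] : (e + k < l)%R \/ (l = e + k)%R by lia.
    apply: hurwitz_closedC; [exact: Ly|exact: Ly|].
    by apply/commute_sym/chord_nested; lia.
  rewrite ekl; have [|||t1 t2] := @chord_triangle b e k; [lia|lia|lia|].
  have L3 : L (y b e) by apply: Lyk; lia.
  by apply: (hurwitz_closedI L3 L3); rewrite ?t1 ?t2.
(* With [b] as origin, the first chord starts after the second one. It ends before the next copy of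
   [b], or exactly there, or beyond the whole next copy of the second chord; in the last case
   [e = p] means a common starting point. *)
have [ekp|[ekp|ekp]] : (e + k < p%:Z)%R \/ (e = p%:Z - k)%R \/ (p%:Z + l < e + k)%R by lia.
- apply: hurwitz_closedC; [exact: Ly|exact: Ly|].
  by apply/commute_sym/chord_disjoint; lia.
- have -> : y (b + e) k = y (b - k) k.
    by rewrite -[RHS](y_turn _ 1) //; congr y; lia.
  have [|||t1 t2] := @chord_triangle (b - k) k l; [lia|lia|lia|].
  rewrite subrK in t1 t2.
  have L3 : L (y (b - k) (k + l)) by apply: Lyk; lia.
  by apply: (hurwitz_closedI L3 L3); rewrite ?t1 ?t2.
have -> : y (b + e) k = y (b + e - p%:Z) k.
  by rewrite -[RHS](y_turn _ 1) //; congr y; lia.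
have [ep|ep] : (e < p%:Z)%R \/ e = p by lia.
  apply: hurwitz_closedC; [exact: Ly|exact: Ly|].
  have := @chord_nested (b + e - p%:Z)%R k (p%:Z - e)%R l.
  by rewrite (_ : b + e - p%:Z + (p%:Z - e) = b)%R; [apply|]; lia.
rewrite ep addrK; have [|||t1 t2] := @chord_triangle b l (k - l); [lia|lia|lia|].
rewrite [(l + _)%R]addrC subrK in t1 t2.
have L3 : L (y (b + l) (k - l)) by apply: Lyk; lia.
by apply: (hurwitz_closedI L3 L3); rewrite ?t1 ?t2.
Qed.

End FanCalculus.

(** * Closure of the set of lifts under non-crossing Hurwitz moves *)

Section LiftSet.
Variables (G : groupType) (X y z : int -> int -> G) (p q : nat).
Hypotheses (p_gt0 : (0 < p)%N) (q_gt0 : (0 < q)%N).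
Hypothesis X_turn : forall a b m : int,
  X (a + m * p%:Z)%R (b + m * q%:Z)%R = X a b.
Hypothesis y_turn : forall a k m : int, (0 < k < p%:Z)%R ->
  y (a + m * p%:Z)%R k = y a k.
Hypothesis z_turn : forall b k m : int, (0 < k < q%:Z)%R ->
  z (b + m * q%:Z)%R k = z b k.
Hypothesis X_y : forall a b k : int, (0 < k < p%:Z)%R ->
  X a b * y a k = X (a + k)%R b * X a b /\
  y a k * X (a + k)%R b = X (a + k)%R b * X a b.
Hypothesis X_z : forall a b k : int, (0 < k < q%:Z)%R ->
  X a (b + k)%R * z b k = X a b * X a (b + k)%R /\
  z b k * X a b = X a b * X a (b + k)%R.
Hypothesis X_y_commute : forall a b k e : int, (0 < k < e)%R -> (e < p%:Z)%R ->
  commute (X (a + e)%R b) (y a k).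
Hypothesis X_z_commute : forall a b k e : int, (0 < k < e)%R -> (e < q%:Z)%R ->
  commute (X a (b + e)%R) (z b k).
Hypothesis X_affine : forall a b : int,
  X (a + p%:Z)%R b * X a b = X a b * X (a - p%:Z)%R b.
Hypothesis X_X_commute : forall a b i j : int,
  (0 < i < p%:Z)%R -> (0 < j < q%:Z)%R ->
  commute (X (a + i)%R (b + j)%R) (X a b).

Variant arc_lift : G -> Prop :=
| LiftX a b : arc_lift (X a b)
| LiftY a k : (0 < k < p%:Z)%R -> arc_lift (y a k)
| LiftZ b k : (0 < k < q%:Z)%R -> arc_lift (z b k).

Local Notation closed := (hurwitz_closed arc_lift).

(** After a simultaneous turn the first arc ends at [a' + i] and [b' + j] with [0 < i <= p] and
    [0 <= j < q]. The value [i = p] means a common outer endpoint and [j = 0] a common inner one.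
    Both together give the affine relation, exactly one a triangle, neither a commutation. *)
Lemma closed_XX (a b a' b' : int) :
  (forall m : int, (a' < a + m * p%:Z)%R = (b' <= b + m * q%:Z)%R) ->
  closed (X a b) (X a' b').
Proof.
move=> ab; have [m am] := int_mod_window a a' p_gt0.
have := ab m; have := ab (m - 1)%R; rewrite -(X_turn a b m).
have [i iE] : exists i : int, (a + m * p%:Z = a' + i)%R.
  by exists (a + m * p%:Z - a')%R; lia.
have [j jE] : exists j : int, (b + m * q%:Z = b' + j)%R.
  by exists (b + m * q%:Z - b')%R; lia.
have -> : (a + (m - 1) * p%:Z = a' + i - p%:Z)%R by lia.
have -> : (b + (m - 1) * q%:Z = b' + j - q%:Z)%R by lia.
rewrite {}iE {}jE in am * => jq j0 {ab}.
have [->|j1] : j = 0%R \/ (0 < j)%R by lia.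
  rewrite addr0; have [ip|->] : (i < p%:Z)%R \/ i = p by lia.
    have ip' : (0 < i < p%:Z)%R by lia.
    have [Xy yX] := X_y a' b' ip'.
    by apply: (hurwitz_closedI (LiftY a' ip') (LiftY a' ip')).
  apply: (hurwitz_closedI (LiftX (a' + p%:Z + p%:Z) b') (LiftX (a' - p%:Z) b')).
    by rewrite [RHS]X_affine addrK.
  exact: X_affine.
have [ip|->] : (i < p%:Z)%R \/ i = p by lia.
  apply: hurwitz_closedC; try exact: LiftX.
  by apply: X_X_commute; lia.
have jq' : (0 < q%:Z - j < q%:Z)%R by lia.
have [Xz zX] := X_z (a' + p%:Z) (b' + j) jq'.
have <- : X (a' + p%:Z) (b' + j + (q%:Z - j)) = X a' b'.
  by rewrite -[RHS](X_turn _ _ 1); congr X; lia.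
by apply: (hurwitz_closedI (LiftZ (b' + j) jq') (LiftZ (b' + j) jq')).
Qed.

Let X_y_comm b (a k e m : int) : (0 < k < e)%R -> (e < p%:Z)%R ->
  commute (X (a + e + m * p%:Z)%R b) (y a k).
Proof.
move=> ke ep; rewrite -(X_turn _ _ (- m)) (_ : _ + - m * _ = a + e)%R; last by lia.
exact: X_y_commute.
Qed.

Let Xy1 b (a k : int) : (0 < k < p%:Z)%R -> X a b * y a k = X (a + k)%R b * X a b.
Proof. by case/(X_y a b). Qed.

Let Xy2 b (a k : int) : (0 < k < p%:Z)%R ->
  y a k * X (a + k)%R b = X (a + k)%R b * X a b.
Proof. by case/(X_y a b). Qed.

Lemma closed_XY a b c k : (0 < k < p%:Z)%R ->
  (forall m : int, ~~ (c < a + m * p%:Z <= c + k)%R) -> closed (X a b) (y c k).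
Proof.
exact: (fan_chord_closed (X := X^~ b) p_gt0 (Xy1 b) (Xy2 b) y_turn (X_y_comm b)
  (LiftX^~ b) LiftY).
Qed.

Lemma closed_YX a b c k : (0 < k < p%:Z)%R ->
  (forall m : int, ~~ (c <= a + m * p%:Z < c + k)%R) -> closed (y c k) (X a b).
Proof.
exact: (chord_fan_closed (X := X^~ b) p_gt0 (Xy1 b) (Xy2 b) y_turn (X_y_comm b)
  (LiftX^~ b) LiftY).
Qed.

Lemma closed_YY a k b l : (0 < k < p%:Z)%R -> (0 < l < p%:Z)%R ->
  (forall m : int, (b < a + m * p%:Z <= b + l)%R = (b < a + k + m * p%:Z <= b + l)%R) ->
  closed (y a k) (y b l).
Proof.
exact: (chord_chord_closed (X := X^~ 0%R) p_gt0 (Xy1 0) (Xy2 0) y_turn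
  (X_y_comm 0) LiftY).
Qed.

(* Negating the inner indices makes X and z into a fan with its chords. *)
Let X' a (c : int) : G := X a (- c)%R.
Let y' (c k : int) : G := z (- c - k)%R k.

Let Xz1 a (c k : int) : (0 < k < q%:Z)%R -> X' a c * y' c k = X' a (c + k)%R * X' a c.
Proof. by move=> /(X_z a (- c - k)%R) []; rewrite subrK /X' opprD. Qed.

Let Xz2 a (c k : int) : (0 < k < q%:Z)%R ->
  y' c k * X' a (c + k)%R = X' a (c + k)%R * X' a c.
Proof. by move=> /(X_z a (- c - k)%R) []; rewrite subrK /X' opprD. Qed.

Let y'_turn (c k m : int) : (0 < k < q%:Z)%R -> y' (c + m * q%:Z)%R k = y' c k.
Proof.
by move=> kq; rewrite /y' -[RHS](z_turn _ (- m) kq); congr z; lia.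
Qed.

Let X'_y'_comm a (c k e m : int) : (0 < k < e)%R -> (e < q%:Z)%R ->
  commute (X' a (c + e + m * q%:Z)%R) (y' c k).
Proof.
move=> ke eq; rewrite /X' -(X_turn _ _ (m + 1)).
rewrite (_ : - _ + _ = - c - k + (k + q%:Z - e))%R; last by lia.
by apply: X_z_commute; lia.
Qed.

Let Ly' (c k : int) : (0 < k < q%:Z)%R -> arc_lift (y' c k).
Proof. exact: LiftZ. Qed.

Let LX' a c : arc_lift (X' a c).
Proof. exact: LiftX. Qed.

Let zE b k : z b k = y' (- b - k)%R k.
Proof. by rewrite /y'; congr z; lia. Qed.

Let XE a b : X a b = X' a (- b)%R.
Proof. by rewrite /X' opprK. Qed.

Lemma closed_XZ a b c k : (0 < k < q%:Z)%R ->
  (forall m : int, ~~ (c <= b + m * q%:Z < c + k)%R) -> closed (X a b) (z c k).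
Proof.
move=> kq H; rewrite zE XE.
apply: (fan_chord_closed q_gt0 (Xz1 a) (Xz2 a) y'_turn (X'_y'_comm a) (LX' a) Ly' kq).
by move=> m; have := H (- m)%R; lia.
Qed.

Lemma closed_ZX a b c k : (0 < k < q%:Z)%R ->
  (forall m : int, ~~ (c < b + m * q%:Z <= c + k)%R) -> closed (z c k) (X a b).
Proof.
move=> kq H; rewrite zE XE.
apply: (chord_fan_closed q_gt0 (Xz1 a) (Xz2 a) y'_turn (X'_y'_comm a) (LX' a) Ly' kq).
by move=> m; have := H (- m)%R; lia.
Qed.

Lemma closed_ZZ b k c l : (0 < k < q%:Z)%R -> (0 < l < q%:Z)%R ->
  (forall m : int, (c <= b + m * q%:Z < c + l)%R = (c <= b + k + m * q%:Z < c + l)%R) ->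
  closed (z b k) (z c l).
Proof.
move=> kq lq H; rewrite !zE.
apply: (chord_chord_closed q_gt0 (Xz1 0) (Xz2 0) y'_turn (X'_y'_comm 0) Ly' kq lq).
by move=> m; have := H (- m)%R; lia.
Qed.

(** Conjugation by [y a k] sends [X a c] to [X (a + k) c] for every [c]. It therefore fixes [z b l],
    which is given by the same expression in crossing arcs from any outer point. *)
Lemma y_z_commute a k b l : (0 < k < p%:Z)%R -> (0 < l < q%:Z)%R ->
  commute (y a k) (z b l).
Proof.
move=> kp lq.
have XJ c : X a c ^ y a k = X (a + k) c.
  by have [Xy yX] := X_y a c kp; rewrite /conjg Xy -yX mulKg.
have zE' c : z b l = X c b ^ X c (b + l).
  by have [Xz zX] := X_z c b lq; rewrite /conjg -Xz mulKg.
have : z b l ^ y a k = z b l by rewrite {1}(zE' a) conjJg !XJ -zE'.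
by move=> zy; rewrite /commute -{1}zy /conjg mulVKg.
Qed.

End LiftSet.

(** * The action on the integers *)

Section PeriodicPermutations.
Variable n : nat.
Implicit Types (a b z k : int) (f : int -> int).

Definition modeq a b : bool := (n %| (a - b)%R)%Z.

Lemma modeqP a b : reflect (exists k, a = b + k * n%:Z)%R (modeq a b).
Proof.
apply: (iffP dvdzP) => -[k kE]; exists k; last by rewrite kE addrC addKr.
by rewrite -kE addrC subrK.
Qed.

Lemma modeq_refl a : modeq a a.
Proof. by apply/modeqP; exists 0%R; lia. Qed.

Lemma modeq_sym a b : modeq a b = modeq b a.
Proof. by apply/modeqP/modeqP => -[k ->]; exists (- k)%R; lia. Qed.

Lemma modeq_trans b a c : modeq a b -> modeq b c -> modeq a c.
Proof. by move=> /modeqP[k ->] /modeqP[l ->]; apply/modeqP; exists (l + k)%R; lia. Qed.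

Lemma modeq_eqr z a b : modeq a b -> modeq z a = modeq z b.
Proof.
move=> ab; apply/idP/idP => za; apply: modeq_trans za _ => //.
by rewrite modeq_sym.
Qed.

Lemma modeqDr c a b : modeq (a + c) (b + c) = modeq a b.
Proof. by rewrite /modeq opprD addrACA subrr addr0. Qed.

Lemma modeq_period a b k : modeq (a + k * n%:Z) b = modeq a b.
Proof.
have H : modeq (a + k * n%:Z) a by apply/modeqP; exists k.
by apply/idP/idP; apply: modeq_trans => //; rewrite modeq_sym.
Qed.

Lemma modeq_small a b : (0 < `|a - b| < n)%N -> modeq a b = false.
Proof.
move=> /andP[ab0 abn]; apply/negP; rewrite /modeq dvdzE => /dvdn_leq /= /(_ ab0).
by lia.
Qed.

(** The reflection of the affine symmetric group exchanging [a + k n] and [b + k n] for all [k]; it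
    is meaningful when [a] and [b] are incongruent. *)
Definition rf a b z : int :=
  (if modeq z a then z - a + b else if modeq z b then z - b + a else z)%R.

Definition periodic f := forall z k, f (z + k * n%:Z)%R = (f z + k * n%:Z)%R.

Lemma rf_periodic a b : periodic (rf a b).
Proof. by move=> z k; rewrite /rf !modeq_period; do !case: ifP => _; lia. Qed.

Lemma rf_l a b : rf a b a = b.
Proof. by rewrite /rf modeq_refl; lia. Qed.

Lemma rf_r a b : modeq a b = false -> rf a b b = a.
Proof. by move=> ab; rewrite /rf modeq_sym ab modeq_refl; lia. Qed.

Lemma rf_out a b z : modeq z a = false -> modeq z b = false -> rf a b z = z.
Proof. by rewrite /rf => -> ->. Qed.

Lemma rfC a b : modeq a b = false -> rf a b =1 rf b a.
Proof.
move=> ab z; rewrite /rf; case: ifP => za; case: ifP => zb //.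
by rewrite (modeq_trans _ zb) ?ab // modeq_sym in ab *.
Qed.

Lemma rfK a b : modeq a b = false -> involutive (rf a b).
Proof.
move=> ab z.
have [/modeqP[k ->]|za] := boolP (modeq z a); first by rewrite !rf_periodic rf_l rf_r.
have [/modeqP[k ->]|zb] := boolP (modeq z b); first by rewrite !rf_periodic rf_r // rf_l.
by rewrite !rf_out //; apply/negbTE.
Qed.

Lemma rf_conj f a b z : modeq a b = false -> periodic f -> injective f ->
  f (rf a b z) = rf (f a) (f b) (f z).
Proof.
move=> ab fp fi.
have fm u v : modeq (f u) (f v) = modeq u v.
  apply/modeqP/modeqP => -[k kE]; exists k; last by rewrite kE fp.
  by apply: fi; rewrite fp.
have [/modeqP[k ->]|za] := boolP (modeq z a).
  by rewrite !(fp, rf_periodic) !rf_l.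
have [/modeqP[k ->]|zb] := boolP (modeq z b).
  by rewrite !(fp, rf_periodic) !rf_r ?fm.
by rewrite !rf_out ?fm //; apply/negbTE.
Qed.

Definition sw (i : int) := rf i (i + 1).

End PeriodicPermutations.

Section CoxeterAction.
Variable n : nat.
Hypothesis n_gt1 : (1 < n)%N.
Local Notation modeq := (modeq n).
Local Notation rf := (rf n).
Local Notation sw := (sw n).

Lemma modeq_succ (i : int) : modeq i (i + 1) = false.
Proof. by apply: modeq_small; lia. Qed.

Lemma swK i : involutive (sw i).
Proof. exact/rfK/modeq_succ. Qed.

Definition ordz (z : int) : 'I_n := Ordinal (ltn_pmod `|(z %% n)%Z|%N (ltnW n_gt1)).

Lemma ordzE z : (ordz z : int) = (z %% n)%Z.
Proof.
have nN0 : (n%:Z != 0)%R by lia.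
have n0 : (0 < n%:Z)%R by lia.
have := ltz_pmod z n0; have := modz_ge0 z nN0; rewrite /=.
by move: (_ %% _)%Z => r r0 rn; rewrite modn_small; lia.
Qed.

Lemma modeq_ordz z : modeq (ordz z) z.
Proof.
by apply/modeqP; exists (- (z %/ n)%Z)%R; rewrite ordzE {2}(divz_eq z n); lia.
Qed.

Lemma ordz_eq z z' : (ordz z == ordz z') = modeq z z'.
Proof.
apply/eqP/idP => [zz|zz].
  by apply: (modeq_trans _ (modeq_ordz z')); rewrite -zz modeq_sym modeq_ordz.
apply/val_inj/eqP/negPn/negP => zz'.
have : modeq (ordz z) (ordz z').
  apply: modeq_trans (modeq_ordz z) _; apply: modeq_trans zz _.
  by rewrite modeq_sym modeq_ordz.
rewrite modeq_small //; move: zz' (ltn_ord (ordz z)) (ltn_ord (ordz z')).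
by move: (ordz z) (ordz z') => v w /=; lia.
Qed.

Lemma ordz_nat (i : 'I_n) : ordz i = i.
Proof.
apply/val_inj/eqP/negPn/negP => ii.
have := modeq_ordz i; rewrite modeq_small //.
by move: ii (ltn_ord (ordz i)) (ltn_ord i); move: (ordz i) => j /=; lia.
Qed.

Lemma ordzS z : ordz (z + 1) = ordS (ordz z).
Proof.
apply/eqP; rewrite -(ordz_nat (ordS _)) ordz_eq.
rewrite -[nat_of_ord (ordS _)]/((ordz z).+1 %% n)%N.
have := modeq_ordz z; rewrite -(modeqDr _ 1) modeq_sym => H.
apply: modeq_trans H _; move: (ordz z : nat) => {z}u.
apply/modeqP; exists (u.+1 %/ n)%N; have := divn_eq u.+1 n.
by move: (u.+1 %/ n)%N (u.+1 %% n)%N => v r; lia.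
Qed.

Lemma affA_adjE (i j : int) :
  affA_adj (ordz i) (ordz j) = modeq j (i + 1) || modeq i (j + 1).
Proof. by rewrite /affA_adj -!ordzS !ordz_eq. Qed.

Lemma affA_adj_far (i j : int) : (i + 2 <= j <= i + n%:Z - 2)%R ->
  (ordz i != ordz j) && ~~ affA_adj (ordz i) (ordz j).
Proof.
move=> ij; rewrite ordz_eq affA_adjE (modeq_sym n j) !modeq_small //; try lia.
Qed.

Lemma sw_periodic i : periodic n (sw i).
Proof. exact: rf_periodic. Qed.

Lemma sw_conj i a b z : modeq a b = false ->
  sw i (rf a b z) = rf (sw i a) (sw i b) (sw i z).
Proof. by move=> ab; apply: rf_conj ab (@sw_periodic i) (can_inj (swK i)). Qed.

Lemma sw_sw i j z : sw i (sw j z) = rf (sw i j) (sw i (j + 1)) (sw i z).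
Proof. exact/sw_conj/modeq_succ. Qed.

Lemma sw_l i : sw i i = (i + 1)%R.
Proof. exact: rf_l. Qed.

Lemma sw_r i : sw i (i + 1) = i.
Proof. exact/rf_r/modeq_succ. Qed.

Lemma sw_out i z : modeq z i = false -> modeq z (i + 1) = false -> sw i z = z.
Proof. exact: rf_out. Qed.

Lemma sw_braid i z : (2 < n)%N -> sw i (sw (i + 1) (sw i z)) = rf i (i + 1 + 1) z.
Proof.
move=> n3; rewrite sw_sw swK sw_r.
by rewrite sw_out // modeq_small //; lia.
Qed.

Lemma sw_braid' i z : (2 < n)%N -> sw (i + 1) (sw i (sw (i + 1) z)) = rf i (i + 1 + 1) z.
Proof.
move=> n3; rewrite (sw_sw (i + 1)) swK sw_l.
by rewrite sw_out // modeq_small //; lia.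
Qed.

Lemma sw_comm i j z : modeq i j = false -> modeq i (j + 1) = false ->
  modeq j (i + 1) = false -> sw i (sw j z) = sw j (sw i z).
Proof.
move=> ij ij1 ji1; rewrite sw_sw.
have -> : sw i j = j by apply: sw_out; rewrite // modeq_sym.
have -> // : sw i (j + 1) = (j + 1)%R.
by apply: sw_out; rewrite ?modeqDr modeq_sym.
Qed.

Lemma sw_mod i j : modeq i j -> sw i =1 sw j.
Proof.
move=> ij z; rewrite /sw /rf !(modeq_eqr z ij) (@modeq_eqr n z (i + 1) (j + 1)) ?modeqDr //.
by do !case: ifP => _; lia.
Qed.

Definition act (u : seq ('I_n * bool)) (z : int) : int :=
  foldr (fun a : 'I_n * bool => sw (a.1 : nat)) z u.

Lemma act_cat u v z : act (u ++ v) z = act u (act v z).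
Proof. exact: foldr_cat. Qed.

Lemma act_pres_eq u v : pres_eq (coxeter_rel (@affA_mx n)) u v -> act u =1 act v.
Proof.
elim=> {u v} // [u v _ uv z|u v w _ uv _ vw z|u u' v v' _ uu _ vv z|x b z|u v [x y] z].
- by rewrite uv.
- by rewrite uv vw.
- by rewrite !act_cat uu vv.
- exact: swK.
rewrite /affA_mx; case: eqP => [<-|/eqP xy]; first by rewrite /= swK.
rewrite -(ordz_nat x) -(ordz_nat y) ordz_eq in xy.
rewrite -{1}(ordz_nat x) -{1}(ordz_nat y) affA_adjE.
case: (boolP (_ || _)) => [adj|]; last first.
  rewrite negb_or => /andP[yx yx']; rewrite /= sw_comm ?swK //; exact/negbTE.
case: eqP => [//|n2]; have {n2}n3 : (2 < n)%N by lia.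
have H (i j t : int) : modeq j (i + 1) -> sw i (sw j (sw i t)) = sw j (sw i (sw j t)).
  move=> ji; rewrite !(sw_mod ji); rewrite sw_braid // sw_braid' //.
rewrite /=; case/orP: adj => adj.
  by rewrite (H _ _ _ adj) !swK.
by rewrite -(H _ _ _ adj) !swK.
Qed.

End CoxeterAction.

(** * Descents and shortening of words *)

Section CoxeterGroup.
Variable n : nat.
Hypothesis n_gt1 : (1 < n)%N.
Local Notation W := (affW n).
Local Notation modeq := (modeq n).
Local Notation sw := (sw n).
Local Notation ordz := (ordz n_gt1).

Definition pact (w : W) : int -> int := act (pres_repr w).

Lemma pact_class u : pact (pres_class _ u) =1 act u.
Proof. exact/(act_pres_eq n_gt1)/pres_reprE. Qed.

Lemma pactM v w z : pact (v * w) z = pact v (pact w z).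
Proof.
by rewrite -(pres_reprK v) -(pres_reprK w) [_ * _]pmulE !pact_class act_cat.
Qed.

Lemma pact1 z : pact 1 z = z.
Proof. exact: (pact_class [::]). Qed.

Lemma pact_simple (i : 'I_n) : pact (simple_refl i) =1 sw i.
Proof. by move=> z; rewrite (pact_class [:: (i, false)]). Qed.

Lemma pact_periodic w : periodic n (pact w).
Proof.
move=> z k; rewrite /pact; elim: (pres_repr w) => //= a u ->; exact: sw_periodic.
Qed.

Lemma pactV w z : pact w^-1 (pact w z) = z.
Proof. by rewrite -pactM mulVg pact1. Qed.

Lemma pactVK w z : pact w (pact w^-1 z) = z.
Proof. by rewrite -pactM mulgV pact1. Qed.

Lemma pact_inj w : injective (pact w).
Proof. exact: can_inj (pactV w). Qed.

Lemma modeq_pact w a b : modeq (pact w a) (pact w b) = modeq a b.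
Proof.
apply/modeqP/modeqP => -[k kE]; exists k; last by rewrite kE pact_periodic.
by apply: (@pact_inj w); rewrite pact_periodic.
Qed.

Definition sW (z : int) : W := simple_refl (ordz z).

Lemma sW_nat (i : 'I_n) : sW i = simple_refl i.
Proof. by rewrite /sW ordz_nat. Qed.

Lemma pact_sW i : pact (sW i) =1 sw i.
Proof. by move=> z; rewrite pact_simple (sw_mod n_gt1 (modeq_ordz n_gt1 i)). Qed.

Lemma sW_mod i j : modeq i j -> sW i = sW j.
Proof. by rewrite -(ordz_eq n_gt1) /sW => /eqP ->. Qed.

Lemma affW_rel (i j : 'I_n) m : affA_mx i j = m ->
  \prod_(x <- flatten (nseq m [:: i; j])) simple_refl x = 1 :> W.
Proof. by move=> <-; rewrite (pres_relP (CoxeterRel _ i j)) big_nil. Qed.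

Lemma simple_refl_sqr (i : 'I_n) : simple_refl i * simple_refl i = 1 :> W.
Proof.
have := @affW_rel i i 1; rewrite /affA_mx eqxx => /(_ erefl).
by rewrite /= !big_cons big_nil mulg1.
Qed.

Lemma sW_sqr i : sW i * sW i = 1.
Proof. exact: simple_refl_sqr. Qed.

Lemma sWV i : (sW i)^-1 = sW i.
Proof. exact/mulg1_eq/sW_sqr. Qed.

Lemma sWK i w : w * sW i * sW i = w.
Proof. by rewrite -mulgA sW_sqr mulg1. Qed.

Lemma sW_comm i j : modeq i j = false -> modeq i (j + 1) = false ->
  modeq j (i + 1) = false -> sW i * sW j = sW j * sW i.
Proof.
move=> ij ij1 ji1; have := @affW_rel (ordz i) (ordz j) 2.
rewrite /affA_mx ordz_eq ij affA_adjE ji1 ij1 => /(_ erefl).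
rewrite /= !big_cons big_nil mulg1 mulgA => H.
by rewrite -(mulg1_eq H) invgM !sWV.
Qed.

Lemma sW_braid i : (2 < n)%N -> sW i * sW (i + 1) * sW i = sW (i + 1) * sW i * sW (i + 1).
Proof.
move=> n3; have := @affW_rel (ordz i) (ordz (i + 1)) 3.
rewrite /affA_mx ordz_eq modeq_succ // affA_adjE modeq_refl /=.
have -> : (n == 2) = false by lia.
move=> /(_ erefl); rewrite !big_cons big_nil mulg1 => H.
have {}H : sW i * sW (i + 1) * sW i * (sW (i + 1) * sW i * sW (i + 1)) = 1.
  by rewrite -!mulgA.
by rewrite -(mulg1_eq H) !invgM !sWV !mulgA.
Qed.

Lemma sW_braidV i : (2 < n)%N ->
  sW i * sW (i - 1) * sW i = sW (i - 1) * sW i * sW (i - 1).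
Proof. by move=> n3; have := sW_braid (i - 1) n3; rewrite subrK. Qed.

Definition prodW (u : seq 'I_n) : W := \prod_(i <- u) simple_refl i.

Lemma prodW_rcons u i : prodW (rcons u i) = prodW u * simple_refl i.
Proof. by rewrite /prodW -cats1 big_cat big_seq1. Qed.

Lemma word_ex w : exists u, w = prodW u.
Proof.
elim/pres_ind: w => [|i _ [u ->]|i _ [u ->]]; first by exists [::]; rewrite /prodW big_nil.
  by exists (i :: u); rewrite /prodW big_cons.
exists (i :: u); rewrite /prodW big_cons; congr (_ * _).
exact/mulg1_eq/simple_refl_sqr.
Qed.

(** Induction on the word, by the position of its last letter [i] relative to [j]: equal, adjacent
    on either side, or commuting. In the adjacent cases the descent is compared with the descents of
    the shorter word [w] at [j] and at [i]. *)
Lemma descent_shorten u (j : int) : (pact (prodW u) (j + 1) < pact (prodW u) j)%R ->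
  exists2 u', prodW u' = prodW u * sW j & (size u' < size u)%N.
Proof.
have [k] := ubnP (size u); elim: k u j => // k IHk u j.
case: (lastP u) => [|{}u i]; first by rewrite /prodW big_nil !pact1; lia.
rewrite size_rcons ltnS prodW_rcons -(sW_nat i) => uk; move: (i : int) => {}i.
set w := prodW u => desc.
have [ij|/negbTE ij] := boolP (modeq i j).
  by exists u => //; rewrite (sW_mod ij) sWK.
have two_steps u1 : prodW u1 = w * sW i -> (size u1 < size u)%N ->
    exists2 u', prodW u' = w * sW i * sW j & (size u' < (size u).+1)%N.
  move=> u1E u1u; have := IHk u1 j; rewrite u1E => -[||u2 u2E u2u1] //; first by lia.
  by exists u2 => //; lia.
have [ij1|/negbTE ij1] := boolP (modeq i (j + 1)).
  have iE := sW_mod ij1; rewrite iE in desc two_steps *.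
  move: desc; rewrite !pactM !pact_sW sw_l.
  (* For [n = 2] the letters [j + 1] and [j - 1] coincide and there is no braid relation.
     Periodicity turns the hypothesis into [w j + 4 < w (j + 1)], so [w] already has a descent at
     [j + 1]. *)
  have [n2|n3] : n = 2 \/ (2 < n)%N by lia.
    have -> : sw (j + 1) j = (j - 1)%R.
      have {2}-> : j = (j + 1 + 1 + (-1) * n%:Z)%R by lia.
      by rewrite sw_periodic sw_r // n2; lia.
    have e1 : (pact w (j + 1 + 1) = pact w j + 2)%R.
      rewrite (_ : j + 1 + 1 = j + 1 * n%:Z)%R; last by lia.
      by rewrite pact_periodic n2.
    have e2 : (pact w (j - 1) = pact w (j + 1) - 2)%R.
      rewrite (_ : j - 1 = j + 1 + (-1) * n%:Z)%R; last by lia.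
      by rewrite pact_periodic n2.
    rewrite e1 e2 => desc; have [//||u1 u1E u1u] := IHk u (j + 1)%R; first by rewrite -/w; lia.
    exact: two_steps u1E u1u.
  have -> : sw (j + 1) j = j by apply: sw_out; apply: modeq_small; lia.
  (* If [w] descends at [j], it can be shortened by [s j] and then by [s (j + 1)]; the braid
     relation then expresses the target by appending two letters. Otherwise [w] descends at [j + 1],
     and two successive shortenings reach the target directly. *)
  move=> desc; have [wj|wj] := ltP (pact w (j + 1)) (pact w j).
    have [//|//|u1 u1E u1u] := IHk u j.
    have [||u2 u2E u2u] := IHk u1 (j + 1)%R; first by lia.
      rewrite u1E -/w !pactM !pact_sW sw_r //.
      by have -> : sw j (j + 1 + 1) = (j + 1 + 1)%R
        by apply: sw_out; apply: modeq_small; lia.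
    exists (rcons (rcons u2 (ordz j)) (ordz (j + 1))); last by rewrite !size_rcons; lia.
    rewrite !prodW_rcons u2E u1E -!/(sW _) -/w -!mulgA; congr (_ * _).
    by rewrite !mulgA sW_braid // !sWK.
  have [//||u1 u1E u1u] := IHk u (j + 1)%R; last exact: two_steps u1E u1u.
  by rewrite -/w; lia.
have [ij2|/negbTE ij2] := boolP (modeq i (j - 1)).
  have iE := sW_mod ij2; rewrite iE in desc two_steps *.
  have n3 : (2 < n)%N.
    have [n2|//] : n = 2 \/ (2 < n)%N by lia.
    move: ij1; rewrite (_ : j + 1 = j - 1 + 1 * n%:Z)%R; last by lia.
    by rewrite modeq_sym modeq_period modeq_sym ij2.
  move: desc; rewrite !pactM !pact_sW.
  have -> : sw (j - 1) (j + 1) = (j + 1)%R by apply: sw_out; apply: modeq_small; lia.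
  have -> : sw (j - 1) j = (j - 1)%R by rewrite -{2}[j](subrK 1%R) sw_r.
  move=> desc; have [wj|wj] := ltP (pact w (j + 1)) (pact w j).
    have [//|//|u1 u1E u1u] := IHk u j.
    have [||u2 u2E u2u] := IHk u1 (j - 1)%R; first by lia.
      rewrite u1E -/w !pactM !pact_sW subrK sw_l.
      by have -> : sw j (j - 1) = (j - 1)%R by apply: sw_out; apply: modeq_small; lia.
    exists (rcons (rcons u2 (ordz j)) (ordz (j - 1))); last by rewrite !size_rcons; lia.
    rewrite !prodW_rcons u2E u1E -!/(sW _) -/w -!mulgA; congr (_ * _).
    by rewrite !mulgA sW_braidV // !sWK.
  have [//||u1 u1E u1u] := IHk u (j - 1)%R; last exact: two_steps u1E u1u.
  by rewrite -/w subrK; lia.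
have far (z : int) : modeq i z = false -> modeq (i + 1) z = false -> sw i z = z.
  by move=> iz iz1; apply: sw_out; rewrite modeq_sym.
have ji1 : modeq j (i + 1) = false.
  by rewrite -(modeqDr _ (-1)) addrK modeq_sym.
move: desc; rewrite !pactM !pact_sW !far ?modeqDr 1?[modeq (i + 1) j]modeq_sym // => desc.
have [//|//|u1 u1E u1u] := IHk u j.
exists (rcons u1 (ordz i)); last by rewrite size_rcons; lia.
by rewrite prodW_rcons u1E -!/(sW _) -/w -!mulgA (sW_comm ij).
Qed.

End CoxeterGroup.

(** * Hurwitz moves and reflections *)

Section Hurwitz.
Variable G : groupType.
Implicit Types ts a b : seq G.

Inductive hurwitz : seq G -> seq G -> Prop :=
| hurwitz_refl ts : hurwitz ts ts
| hurwitz_l a t1 t2 b ts : hurwitz (a ++ t2 ^ t1^-1 :: t1 :: b) ts ->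
    hurwitz (a ++ t1 :: t2 :: b) ts
| hurwitz_r a t1 t2 b ts : hurwitz (a ++ t2 :: t1 ^ t2 :: b) ts ->
    hurwitz (a ++ t1 :: t2 :: b) ts.

Lemma hurwitz_trans ts2 ts1 ts3 :
  hurwitz ts1 ts2 -> hurwitz ts2 ts3 -> hurwitz ts1 ts3.
Proof.
by elim=> {ts1 ts2} // [a t1 t2 b ts _ IH|a t1 t2 b ts _ IH] /IH;
   [apply: hurwitz_l|apply: hurwitz_r].
Qed.

Lemma hurwitz_sym ts1 ts2 : hurwitz ts1 ts2 -> hurwitz ts2 ts1.
Proof.
elim=> {ts1 ts2} [ts|a t1 t2 b ts _ IH|a t1 t2 b ts _ IH]; first exact: hurwitz_refl.
  apply: (hurwitz_trans IH); apply: hurwitz_r.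
  by rewrite conjgKV; apply: hurwitz_refl.
apply: (hurwitz_trans IH); apply: hurwitz_l.
by rewrite conjgK; apply: hurwitz_refl.
Qed.

Lemma hurwitz_cat a b ts1 ts2 : hurwitz ts1 ts2 -> hurwitz (a ++ ts1 ++ b) (a ++ ts2 ++ b).
Proof.
have E a' b' x y : a ++ (a' ++ x :: y :: b') ++ b = (a ++ a') ++ x :: y :: (b' ++ b).
  by rewrite -!catA.
elim=> {ts1 ts2} [ts|a' t1 t2 b' ts _ IH|a' t1 t2 b' ts _ IH].
- exact: hurwitz_refl.
- by rewrite E in IH; rewrite E; apply: hurwitz_l.
- by rewrite E in IH; rewrite E; apply: hurwitz_r.
Qed.

Lemma hurwitz_size ts1 ts2 : hurwitz ts1 ts2 -> size ts1 = size ts2.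
Proof. by elim=> {ts1 ts2} // a t1 t2 b ts _ <-; rewrite !size_cat. Qed.

Lemma hurwitz_prod ts1 ts2 : hurwitz ts1 ts2 ->
  \prod_(t <- ts1) t = \prod_(t <- ts2) t.
Proof.
elim=> {ts1 ts2} // a t1 t2 b ts _ <-; rewrite !big_cat /= !big_cons; congr (_ * _).
  by rewrite /conjg invgK !mulgA mulgVK.
by rewrite /conjg !mulgA mulgV mul1g.
Qed.

Lemma hurwitz_move b t :
  hurwitz (rcons b t) (t ^ (\prod_(x <- b) x)^-1 :: b).
Proof.
elim: b t => [|x b IHb] t.
  by rewrite big_nil invg1 conjg1; apply: hurwitz_refl.
rewrite rcons_cons; apply: (hurwitz_trans (ts2 := x :: t ^ (\prod_(x <- b) x)^-1 :: b)).
  by have := hurwitz_cat [:: x] [::] (IHb t); rewrite !cats0.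
apply: (@hurwitz_l [::]); rewrite big_cons invgM conjgM /=; exact: hurwitz_refl.
Qed.

Lemma hurwitz_all (P : G -> Prop) ts1 ts2 :
  (forall t1 t2, P t1 -> P t2 -> P (t1 ^ t2)) ->
  (forall t1 t2, P t1 -> P t2 -> P (t2 ^ t1^-1)) ->
  hurwitz ts1 ts2 -> (forall t, t \in ts1 -> P t) -> (forall t, t \in ts2 -> P t).
Proof.
move=> PJ PJV; elim=> {ts1 ts2} // a t1 t2 b ts _ IH H; apply: IH => t;
  have {}H x : x \in a ++ t1 :: t2 :: b -> P x by exact: H.
  rewrite mem_cat !inE => /orP[ta|/or3P[/eqP ->|/eqP->|tb]].
  - by apply: H; rewrite mem_cat ta.
  - by apply: PJV; apply: H; rewrite mem_cat !inE eqxx !orbT.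
  - by apply: H; rewrite mem_cat !inE eqxx !orbT.
  - by apply: H; rewrite mem_cat !inE tb !orbT.
rewrite mem_cat !inE => /orP[ta|/or3P[/eqP ->|/eqP->|tb]].
- by apply: H; rewrite mem_cat ta.
- by apply: H; rewrite mem_cat !inE eqxx !orbT.
- by apply: PJ; apply: H; rewrite mem_cat !inE eqxx !orbT.
- by apply: H; rewrite mem_cat !inE tb !orbT.
Qed.

End Hurwitz.

(** * Faithfulness of the action and the exchange condition *)

Section Reflections.
Variable n : nat.
Hypothesis n_gt1 : (1 < n)%N.
Local Notation W := (affW n).
Local Notation modeq := (modeq n).
Local Notation rf := (rf n).
Local Notation sw := (sw n).
Local Notation sW := (sW n_gt1).

Lemma prodW_cat u v : prodW (u ++ v) = prodW u * prodW v :> W.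
Proof. exact: big_cat. Qed.

Lemma prodW_cons i u : prodW (i :: u) = simple_refl i * prodW u :> W.
Proof. exact: big_cons. Qed.

(** If a nonempty word acts trivially, the word without its last letter [i] acts as [s i] and so has
    a descent at [i]. Hence the element has an expression shorter than the given word, and induction
    on the size applies. *)
Lemma pact_faithful (v w : W) : pact v =1 pact w -> v = w.
Proof.
suff H (u : seq 'I_n) : pact (prodW u) =1 id -> prodW u = 1.
  move=> vw; apply: divg1_eq; have [u uE] := word_ex (v * w^-1).
  rewrite uE; apply: H => z; rewrite -uE pactM // vw -pactM // mulgV pact1 //.
have [k] := ubnP (size u); elim: k u => // k IHk u.
case: (lastP u) => [|{}u i] uk uid; first by rewrite /prodW big_nil.
have wE z : pact (prodW u) z = sw i z.
  have := uid (sw i z); rewrite prodW_rcons (pactM n_gt1) (pact_simple n_gt1) swK //.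
have [|u1 u1E u1u] := @descent_shorten n n_gt1 u i.
  by rewrite !wE sw_r // sw_l; lia.
rewrite prodW_rcons -(sW_nat n_gt1) -u1E; apply: IHk; first by rewrite size_rcons in uk; lia.
by move=> z; rewrite u1E (sW_nat n_gt1) -prodW_rcons.
Qed.

Lemma reflectionJ t w : is_reflection t -> is_reflection (t ^ w : W).
Proof. by case=> i [v ->]; exists i, (v * w); rewrite conjgM. Qed.

Lemma simple_reflection i : is_reflection (simple_refl i : W).
Proof. by exists i, 1; rewrite conjg1. Qed.

Lemma reflection_sqr (t : W) : is_reflection t -> t * t = 1.
Proof. by case=> i [v ->]; rewrite -conjMg simple_refl_sqr conj1g. Qed.

Lemma reflectionV (t : W) : is_reflection t -> t^-1 = t.
Proof. by move/reflection_sqr/mulg1_eq. Qed.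

Lemma pactJ (t : W) a b (w : W) : modeq a b = false -> pact t =1 rf a b ->
  pact (t ^ w) =1 rf (pact w^-1 a) (pact w^-1 b).
Proof.
move=> ab tab z; rewrite /conjg !(pactM n_gt1) tab.
rewrite (rf_conj _ ab (pact_periodic _)) ?(pactV n_gt1) //.
exact: pact_inj.
Qed.

Lemma reflection_rf (t : W) : is_reflection t ->
  exists a b : int, [/\ (a < b)%R, modeq a b = false & pact t =1 rf a b].
Proof.
case=> i [w ->]; have := pactJ w (modeq_succ n_gt1 i) (pact_simple n_gt1 i).
set a := pact w^-1 i; set b := pact w^-1 _ => tab.
have ab : modeq a b = false by rewrite (modeq_pact n_gt1) modeq_succ.
have [ltab|ltba|eqab] := ltgtP a b; first by exists a, b.
  exists b, a; split=> // [|z]; first by rewrite modeq_sym.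
  by rewrite tab rfC.
by rewrite eqab modeq_refl in ab.
Qed.

(** Conjugating by [s a] moves the left endpoint from [a + 1] to [a]. When [b] is congruent to
    [a + 1] this also moves [b - 1] to [b], so in that case both endpoints are pulled in. *)
Lemma reflection_ex (a b : int) : (a < b)%R -> modeq a b = false ->
  exists2 t : W, is_reflection t & pact t =1 rf a b.
Proof.
have [k] := ubnP `|b - a|; elim: k a b => // k IHk a b abk ltab ab.
have [->|ba1] : b = (a + 1)%R \/ (a + 1 < b)%R by lia.
  by exists (sW a); [apply: simple_reflection|apply: pact_sW].
have step a' b' : (a' < b')%R -> modeq a' b' = false -> (`|b' - a'| < k)%N ->
    sw a a' = a -> sw a b' = b -> exists2 t : W, is_reflection t & pact t =1 rf a b.
  move=> lt' ab' k' aE bE; have [//|//|//|t tr tE] := IHk a' b'.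
  exists (t ^ sW a); first exact: reflectionJ.
  by move=> z; rewrite (pactJ _ ab' tE) sWV !(pact_sW n_gt1) aE bE.
have [a1b|/negbTE a1b] := boolP (modeq (a + 1) b); last first.
  apply: (step (a + 1)%R b) => //; first by lia.
    exact: sw_r.
  by rewrite sw_out // modeq_sym.
have bE : sw a (b - 1) = b.
  have /modeqP[l lE] : modeq (b - 1) a by rewrite -(modeqDr _ 1) subrK modeq_sym.
  by rewrite lE sw_periodic sw_l; lia.
have ab1 : modeq (a + 1) (b - 1) = false.
  apply/negbTE/negP => H; have := modeq_trans H; move=> /(_ (a : int)).
  rewrite -[modeq (b - 1) a](modeqDr _ 1) subrK modeq_sym a1b modeq_sym modeq_succ //.
  by move/(_ isT).
apply: (step (a + 1)%R (b - 1)%R) => //; [|by lia|exact: sw_r].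
have /modeqP[l lE] := a1b; suff : (a + 1 <> b - 1)%R /\ (a + 2 <> b)%R by lia.
by split=> [e|e]; move: ab1; rewrite ?e ?modeq_refl // -e (_ : a + 2 - 1 = a + 1)%R ?modeq_refl //; lia.
Qed.

Lemma sw_flip i (x y : int) : (x < y)%R -> (sw i y < sw i x)%R -> modeq x i /\ y = (x + 1)%R.
Proof. by rewrite /sw /rf; do !case: ifP => // _; lia. Qed.

(** Strong exchange: reading the word from the right, some letter first reverses the images of [a]
    and [b]. There the images are consecutive integers exchanged by that letter, so by faithfulness
    [t] is the conjugate of the letter by the suffix after it. *)
Lemma exchange u (t : W) (a b : int) : modeq a b = false -> pact t =1 rf a b ->
  (a < b)%R -> (pact (prodW u) b < pact (prodW u) a)%R ->
  exists u1 i u2, u = u1 ++ i :: u2 /\ prodW u * t = prodW (u1 ++ u2).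
Proof.
move=> ab tab ltab; elim: u => [|i u IHu]; first by rewrite /prodW big_nil !(pact1 n_gt1); lia.
rewrite prodW_cons !(pactM n_gt1) !(pact_simple n_gt1) => desc.
have [/IHu [u1 [j [u2 [uE utE]]]]|le_ab] := ltP (pact (prodW u) b) (pact (prodW u) a).
  exists (i :: u1), j, u2; rewrite uE; split=> //.
  by rewrite cat_cons [RHS]prodW_cons -utE uE mulgA.
have ltw : (pact (prodW u) a < pact (prodW u) b)%R.
  rewrite lt_neqAle le_ab andbT; apply/eqP => /(@pact_inj _ n_gt1 (prodW u)) e.
  by rewrite e in ltab; lia.
have [ai bE] := sw_flip ltw desc.
exists [::], i, u; split=> //; rewrite cat0s.
suff -> : t = simple_refl i ^ prodW u.
  by rewrite /conjg !mulgA mulgK simple_refl_sqr mul1g.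
apply: pact_faithful => z; apply: (@pact_inj _ n_gt1 (prodW u)).
rewrite tab (rf_conj _ ab (pact_periodic _) (@pact_inj _ n_gt1 (prodW u))) bE.
rewrite /conjg !(pactM n_gt1) (pactVK n_gt1) (pact_simple n_gt1).
by rewrite -/(sw _ _) (sw_mod n_gt1 ai).
Qed.

End Reflections.

(** * Transitivity of the Hurwitz action *)

Section HurwitzTransitivity.
Variable n : nat.
Hypothesis n_gt1 : (1 < n)%N.
Local Notation W := (affW n).
Local Notation modeq := (modeq n).
Local Notation rf := (rf n).
Implicit Types (t w y : W) (ts : seq W) (u : seq 'I_n).

Lemma len_ex w : exists k, `[< exists2 u, size u = k & w = prodW u >].
Proof. by have [u uE] := word_ex w; exists (size u); apply/asboolP; exists u. Qed.

Definition len w : nat := ex_minn (len_ex w).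

Lemma len_word w : exists2 u, size u = len w & w = prodW u.
Proof. by rewrite /len; case: ex_minnP => k /asboolP. Qed.

Lemma len_prodW u : (len (prodW u) <= size u)%N.
Proof. by rewrite /len; case: ex_minnP => k _; apply; apply/asboolP; exists u. Qed.

Lemma len1 : len 1 = 0%N.
Proof. by have := len_prodW [::]; rewrite /prodW big_nil leqn0 => /eqP. Qed.

Section OneReflection.
Variables (t : W) (a b : int).
Hypotheses (tr : is_reflection t) (tE : pact t =1 rf a b).
Hypotheses (ab : modeq a b = false) (ltab : (a < b)%R).

Lemma len_descent w : (pact w b < pact w a)%R -> (len (w * t) < len w)%N.
Proof.
have [u <- wE] := len_word w; rewrite {1 2}wE => desc.
have [u1 [i [u2 [uE wtE]]]] := exchange n_gt1 ab tE ltab desc.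
by rewrite wE wtE uE (leq_ltn_trans (len_prodW _)) // !size_cat /=; lia.
Qed.

Lemma len_ascent w : (pact w a < pact w b)%R -> (len w < len (w * t))%N.
Proof.
move=> asc; rewrite -{1}[w]mulg1 -(reflection_sqr tr) mulgA; apply: len_descent.
by rewrite !(pactM n_gt1) !tE rf_l rf_r.
Qed.

Lemma len_descentP w : (len (w * t) < len w)%N = (pact w b < pact w a)%R.
Proof.
have [ltw|ltw|/(@pact_inj _ n_gt1 w) e] := ltgtP (pact w a) (pact w b).
- by apply/negbTE; rewrite -leqNgt ltnW // len_ascent.
- exact: len_descent.
- by move: ltab; rewrite e ltxx.
Qed.

End OneReflection.

Lemma len_reflection w t : is_reflection t -> (len (w * t) < len w)%N = ~~ (len w < len (w * t))%N.
Proof.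
move=> tr; have [a [b [ltab ab tE]]] := reflection_rf n_gt1 tr.
have [ltw|ltw|/(@pact_inj _ n_gt1 w) e] := ltgtP (pact w a) (pact w b).
- by rewrite (len_ascent tr tE) // (len_descentP tr tE) // ; lia.
- have := len_descent tE ab ltab ltw; lia.
- by move: ltab; rewrite e ltxx.
Qed.

Lemma rf_rf (a b c z : int) : modeq a b = false -> modeq b c ->
  rf a b (rf a c z) =
  (if modeq z a then z + (c - b) else if modeq z b then z - (c - b) else z)%R.
Proof.
move=> ab bc.
have rf1 d k : rf a d (a + k * n%:Z)%R = (d + k * n%:Z)%R by rewrite rf_periodic rf_l.
have rf2 d k : modeq a d = false -> rf a d (d + k * n%:Z)%R = (a + k * n%:Z)%R.
  by move=> ad; rewrite rf_periodic rf_r.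
have ac : modeq a c = false by rewrite -(modeq_eqr a bc).
have [/modeqP[k ->]|/negbTE za] := boolP (modeq z a).
  rewrite rf1; have /modeqP[l ->] : modeq c b by rewrite modeq_sym.
  rewrite (_ : b + l * n%:Z + k * n%:Z = b + (l + k) * n%:Z)%R; last by lia.
  by rewrite rf2 //; lia.
have [/modeqP[k ->]|/negbTE zb] := boolP (modeq z b); last first.
  by rewrite !rf_out // -(modeq_eqr z bc).
have /modeqP[l lE] := bc.
rewrite (_ : b + k * n%:Z = c + (l + k) * n%:Z)%R; last by lia.
by rewrite rf2 // rf1; lia.
Qed.

(* With D = y a - y b, the reflection r through (a, b + K n) is a descent of y
   exactly for 0 <= K n < D (when a < b + K n); taking K maximal makes the
   other factor of t1 * t2 = r * r' a descent of y * r. *)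
Lemma len_translation y t1 t2 (a b b' : int) :
  modeq a b = false -> modeq b b' -> (b' < b)%R -> (a < b')%R ->
  pact t1 =1 rf a b -> pact t2 =1 rf a b' ->
  (pact y b < pact y a)%R -> (len (y * t1 * t2) < len y)%N.
Proof.
move=> ab bb' ltb' ltab' t1E t2E desc.
pose D := (pact y a - pact y b)%R.
have n0 : (0 < n%:Z)%R by lia.
have nN0 : (n%:Z != 0)%R by lia.
have [K [K0 KD DK]] : exists K : int, [/\ (0 <= K)%R, (K * n%:Z < D)%R & (D < (K + 1) * n%:Z)%R].
  have DE := divz_eq D n; have D0 := modz_ge0 D nN0; have Dn := ltz_pmod D n0.
  have DN : (D %% n)%Z != 0%R.
    apply/negP => /eqP e; move: ab; rewrite -(modeq_pact n_gt1 y).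
    by move/modeqP; case; exists (D %/ n)%Z; move: DE; rewrite e /D; lia.
  exists (D %/ n)%Z; split.
  - by rewrite divz_ge0 // /D; lia.
  - by move: DE D0 DN; move: (_ %/ _)%Z (_ %% _)%Z => k r; lia.
  - by move: DE Dn; rewrite mulrDl; move: (_ %/ _)%Z (_ %% _)%Z => k r; lia.
have [m mE] : exists m : int, (b = b' + m * n%:Z)%R by apply/modeqP.
have m1 : (1 * n%:Z <= m * n%:Z)%R.
  have : (0 < m * n%:Z)%R by lia.
  by rewrite pmulr_lgt0 // => m0; rewrite ler_pM2r //; lia.
have KN : (0 <= K * n%:Z)%R by apply: mulr_ge0; lia.
have ab' : modeq a b' = false by rewrite -(modeq_eqr a bb').
have abK (d : int) : modeq a d = false -> modeq a (d + K * n%:Z) = false.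
  by rewrite (modeq_sym n a) => ad; rewrite modeq_sym modeq_period.
have [||r rr rE] := @reflection_ex n n_gt1 a (b + K * n%:Z); [lia|exact: abK|].
have [||r' rr' r'E] := @reflection_ex n n_gt1 a (b' + K * n%:Z); [lia|exact: abK|].
have -> : y * t1 * t2 = y * r * r'.
  rewrite -!mulgA; congr (_ * _); apply: (pact_faithful n_gt1) => z.
  rewrite !(pactM n_gt1) t1E t2E rE r'E rf_rf // rf_rf ?abK //; last first.
    by rewrite modeqDr.
  rewrite (modeq_eqr z (a := b + K * n%:Z) (b := b)); last by rewrite modeq_period modeq_refl.
  by do !case: ifP => _; lia.
have lt1 : (len (y * r) < len y)%N.
  by apply: (len_descent rE); rewrite ?abK ?pact_periodic //; rewrite /D in KD; lia.
apply: ltn_trans lt1; apply: (len_descent r'E); rewrite ?abK //; first by lia.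
rewrite !(pactM n_gt1) !rE rf_l (_ : b' + K * n%:Z = b + K * n%:Z + (- m) * n%:Z)%R; last by lia.
rewrite rf_periodic rf_r ?abK // !pact_periodic.
by move: DK; rewrite /D mulrDl; lia.
Qed.

Lemma rf_shift (a b k : int) : modeq a b = false -> rf (a + k * n%:Z) (b + k * n%:Z) =1 rf a b.
Proof.
have pE (e : int) z : modeq z (e + k * n%:Z) = modeq z e.
  by rewrite modeq_sym modeq_period modeq_sym.
by move=> ab z; rewrite /rf !pE; do !case: ifP => _; lia.
Qed.

(** A rank-two statement in the subgroup generated by the two reflections. If neither second step is
    a descent, the resulting inequalities contradict each other unless both endpoint classes agree
    in order; then the product is a translation and [len_translation] applies. *)
Lemma len_two_descents y t1 t2 : is_reflection t1 -> is_reflection t2 -> t1 <> t2 ->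
  (len (y * t1) < len y)%N -> (len (y * t2) < len y)%N ->
  (len (y * t1 * t2) < len y)%N \/ (len (y * t2 * t1) < len y)%N.
Proof.
move=> r1 r2 t12 l1 l2.
have [a [b [ltab ab t1E]]] := reflection_rf n_gt1 r1.
have [c [d [ltcd cd t2E]]] := reflection_rf n_gt1 r2.
have [lt|ge1] := boolP (len (y * t1 * t2) < len (y * t1))%N.
  by left; apply: ltn_trans lt l1.
have [lt|ge2] := boolP (len (y * t2 * t1) < len (y * t2))%N.
  by right; apply: ltn_trans lt l2.
have ya : (pact y b < pact y a)%R by rewrite -(len_descentP r1 t1E).
(* The endpoints of [t2] matter only up to a common translation, so a congruence with an endpoint of
   [t1] can be made an equality. *)
have ineqs k : let c' := (c + k * n%:Z)%R in let d' := (d + k * n%:Z)%R in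
   [/\ (c' < d')%R, modeq c' d' = false, pact t2 =1 rf c' d', (pact y d' < pact y c')%R &
   (pact y (rf a b c') <= pact y (rf a b d'))%R /\ (pact y (rf c' d' a) <= pact y (rf c' d' b))%R].
  move=> c' d'; have cd' : modeq c' d' = false by rewrite modeqDr.
  have t2E' : pact t2 =1 rf c' d' by move=> z; rewrite rf_shift.
  have lt' : (c' < d')%R by rewrite /c' /d'; lia.
  split=> //; first by rewrite -(len_descentP r2 t2E').
  move: ge1 ge2; rewrite (len_descentP r2 t2E') // (len_descentP r1 t1E) //.
  by rewrite !(pactM n_gt1) -!t1E -!t2E' -!leNgt.
have at_class (e e' : int) : modeq e e' -> exists k : int, (e + k * n%:Z = e')%R.
  by rewrite modeq_sym => /modeqP[k kE]; exists k.
have [/at_class[k kE]|/negbTE ca] := boolP (modeq c a).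
  have [] := ineqs k; rewrite {}kE; move: (d + _)%R => {c cd ltcd t2E ineqs} {}d ltad ad t2E yd [].
  have [db|/negbTE db] := boolP (modeq d b); last first.
    rewrite rf_l (rf_out _ db) ?rf_l 1?modeq_sym // => le1.
    have -> : rf a d b = b by apply: rf_out; rewrite modeq_sym.
    move=> le2; have /(@pact_inj _ n_gt1 y) bd : pact y b = pact y d by lia.
    by rewrite bd modeq_refl in db.
  move=> _ _; have [ltbd|ltdb|bd] := ltgtP b d.
  - right; apply: (len_translation (a := a) (b := d) (b' := b)) => //.
  - left; apply: (len_translation (a := a) (b := b) (b' := d)) => //.
    by rewrite modeq_sym.
  - by case: t12; apply: (pact_faithful n_gt1) => z; rewrite t1E t2E bd.
have [/at_class[k kE]|/negbTE db] := boolP (modeq d b).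
  have [] := ineqs k; have := ca; rewrite -(modeq_period n c a k).
  rewrite {}kE; move: (c + _)%R => {ca cd ltcd t2E ineqs} {}c ca ltcb cb t2E yc [].
  rewrite rf_r // (rf_out ca cb) rf_r // => le1.
  have -> : rf c b a = a by apply: rf_out; rewrite // modeq_sym.
  move=> le2; have /(@pact_inj _ n_gt1 y) ac : pact y a = pact y c by lia.
  by rewrite ac modeq_refl in ca.
have [/at_class[k kE]|/negbTE cb] := boolP (modeq c b).
  have [] := ineqs k; have := db; rewrite -(modeq_period n d b k).
  rewrite {}kE; move: (d + _)%R => {ca cd db ltcd t2E ineqs} {}d db ltbd bd t2E yd [].
  have [/modeqP[l lE]|/negbTE da] := boolP (modeq d a).
    by move: ltbd yd; rewrite lE pact_periodic; lia.
  by rewrite rf_r // (rf_out da db); lia.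
have [/at_class[k kE]|/negbTE da] := boolP (modeq d a).
  have [] := ineqs k; have := cb; rewrite -(modeq_period n c b k).
  rewrite {}kE; move: (c + _)%R => {ca db cb cd ltcd t2E ineqs} {}c cb ltca ca t2E yc [].
  by rewrite rf_l (rf_out ca cb); lia.
have [_ _ _ ] := ineqs 0%R; rewrite !mul0r !addr0 => yd [].
by rewrite (rf_out ca cb) (rf_out da db); lia.
Qed.

(** The sum of the lengths of the partial products, the starting point excluded. A Hurwitz move
    changes only one of them, which makes this the measure for [straighten]. *)
Fixpoint height w ts : nat :=
  if ts is t :: ts' then (len (w * t) + height (w * t) ts')%N else 0%N.

Fixpoint increasing w ts : Prop :=
  if ts is t :: ts' then (len w < len (w * t))%N /\ increasing (w * t) ts' else True.

Definition reflections ts := forall t, t \in ts -> is_reflection t.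

Lemma height_cat w ts1 ts2 :
  height w (ts1 ++ ts2) = (height w ts1 + height (w * \prod_(t <- ts1) t) ts2)%N.
Proof.
elim: ts1 w => [|t ts1 IH] w /=; first by rewrite big_nil mulg1.
by rewrite IH big_cons mulgA addnA.
Qed.

Lemma reflections_cat ts1 ts2 :
  reflections (ts1 ++ ts2) <-> reflections ts1 /\ reflections ts2.
Proof.
split=> [r|[r1 r2] t]; last by rewrite mem_cat => /orP[/r1|/r2].
by split=> t tts; apply: r; rewrite mem_cat tts ?orbT.
Qed.

Lemma reflections_cons t ts :
  reflections (t :: ts) <-> is_reflection t /\ reflections ts.
Proof.
split=> [r|[r1 r2] t']; last by rewrite inE => /predU1P[->|/r2].
by split=> [|t' tts]; apply: r; rewrite inE ?eqxx // tts orbT.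
Qed.

Lemma hurwitz_reflections ts1 ts2 :
  hurwitz ts1 ts2 -> reflections ts1 -> reflections ts2.
Proof. by apply: hurwitz_all => t1 t2 r1 r2; apply: reflectionJ. Qed.

Lemma increasing_or_peak w ts : reflections ts ->
  [\/ increasing w ts,
      (exists t ts', ts = t :: ts' /\ (len (w * t) < len w)%N) |
      exists a t1 t2 b, let v := w * \prod_(t <- a) t in
        [/\ ts = a ++ t1 :: t2 :: b, (len v < len (v * t1))%N &
            (len (v * t1 * t2) < len (v * t1))%N]].
Proof.
elim: ts w => [|t ts IH] w; first by constructor 1.
case/reflections_cons => tr tsr.
have [lt|] := boolP (len w < len (w * t))%N; last first.
  by rewrite -len_reflection // => lt; constructor 2; exists t, ts.
have [inc|[t2 [b [tsE desc]]]|[a [t1 [t2 [b [tsE l1 l2]]]]]] := IH (w * t) tsr.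
- by constructor 1.
- by constructor 3; exists [::], t, t2, b; rewrite /= big_nil mulg1 tsE.
- by constructor 3; exists (t :: a), t1, t2, b; rewrite /= big_cons mulgA tsE.
Qed.

(** At a peak [v < v * t1 > v * t1 * t2], both [t1] and [t2] are descents of [v * t1]. If they are
    equal they cancel and the factorization shortens. Otherwise [len_two_descents] says which
    Hurwitz move replaces the peak by a lower element. Starting from 1 excludes an initial
    descent. *)
Lemma straighten ts : reflections ts ->
  (exists ts', [/\ reflections ts', (size ts' < size ts)%N &
     \prod_(t <- ts') t = \prod_(t <- ts) t]) \/
  (exists2 ts', hurwitz ts ts' & increasing 1 ts').
Proof.
have [k] := ubnP (height 1 ts); elim: k ts => // k IH ts hk tsr.
have [inc|[t [ts' [_]]]|[a [t1 [t2 [b [tsE]]]]]] := increasing_or_peak 1 tsr.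
- by right; exists ts => //; apply: hurwitz_refl.
- by rewrite len1; lia.
rewrite mul1g; set v := \prod_(t <- a) t => l1 l2.
move: tsr; rewrite {1}tsE => /reflections_cat[ra /reflections_cons[r1 /reflections_cons[r2 rb]]].
have [t12|t12] := pselect (t1 = t2).
  left; exists (a ++ b); split; first by apply/reflections_cat.
    by rewrite tsE !size_cat /=; lia.
  by rewrite tsE !big_cat /= !big_cons t12 (mulgA t2 t2) reflection_sqr // mul1g.
have hE ts' s1 s2 : ts' = a ++ s1 :: s2 :: b -> s1 * s2 = t1 * t2 ->
    (len (v * s1) < len (v * t1))%N -> (height 1 ts' < k)%N.
  move=> -> ss lt; apply: leq_trans (_ : height 1 ts <= k)%N; last by lia.
  by rewrite tsE !height_cat /= mul1g -/v -!(mulgA v) ss ltn_add2l ltn_add2r.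
have concl ts' : hurwitz ts ts' -> (height 1 ts' < k)%N ->
    (exists ts', [/\ reflections ts', (size ts' < size ts)%N &
     \prod_(t <- ts') t = \prod_(t <- ts) t]) \/
    (exists2 ts', hurwitz ts ts' & increasing 1 ts').
  move=> hts hk'; have [|[us [ru us1 us2]]|[us us1 us2]] := IH ts' hk'.
  - by apply: hurwitz_reflections hts _; rewrite tsE; apply/reflections_cat; split=> //;
       do 2?[apply/reflections_cons; split=> //].
  - by left; exists us; rewrite (hurwitz_size hts) us2 (hurwitz_prod hts).
  - by right; exists us => //; apply: hurwitz_trans hts us1.
have l0 : (len (v * t1 * t1) < len (v * t1))%N.
  by rewrite -mulgA reflection_sqr // mulg1.
have [lt|lt] := len_two_descents r1 r2 t12 l0 l2.
  apply: (concl (a ++ t2 :: t1 ^ t2 :: b)).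
    by rewrite tsE; apply/hurwitz_r/hurwitz_refl.
  apply: hE; first by []; first by rewrite /conjg mulVKg.
  by move: lt; rewrite -(mulgA v t1 t1) reflection_sqr // mulg1.
apply: (concl (a ++ t2 ^ t1^-1 :: t1 :: b)).
  by rewrite tsE; apply/hurwitz_l/hurwitz_refl.
apply: hE; first by []; first by rewrite /conjg invgK -!mulgA mulVg mulg1.
by rewrite /conjg invgK reflectionV // !mulgA.
Qed.

Lemma increasing_rcons w ts t : increasing w (rcons ts t) ->
  (len (w * \prod_(x <- ts) x) < len (w * \prod_(x <- ts) x * t))%N.
Proof.
elim: ts w => [|x ts IH] w /=; first by rewrite big_nil mulg1 => -[].
by move=> [_ /IH]; rewrite big_cons mulgA.
Qed.

(** A word avoiding the letter [i] maps the integers up to [i] into themselves, whereas [s i] sends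
    [i] to [i + 1]. *)
Lemma prodW_neq1 i u : i \notin u -> prodW (i :: u) <> 1.
Proof.
move=> iu e; have H (z : int) : (z <= (i : nat)%:Z)%R -> (pact (prodW u) z <= (i : nat)%:Z)%R.
  elim: u iu {e} z => [|j u IH] ju z zi; first by rewrite /prodW big_nil (pact1 n_gt1).
  rewrite prodW_cons (pactM n_gt1) (pact_simple n_gt1).
  move: ju; rewrite inE negb_or => /andP[ij ju].
  have := IH ju z zi; move: (pact _ z) => x xi.
  rewrite /sw /rf; case: ifP => xj; last by case: ifP => _; lia.
  have [xi'|xi'] : (x = (i : nat)%:Z)%R \/ (x < (i : nat)%:Z)%R by lia.
    by move: ij; rewrite -(ordz_nat n_gt1 i) -(ordz_nat n_gt1 j) ordz_eq -xi' xj.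
  by lia.
have := H _ (lexx _); suff -> : pact (prodW u) (i : nat) = ((i : nat)%:Z + 1)%R by lia.
rewrite -[RHS](sw_l n) -(pact_simple n_gt1) -[in RHS](pact1 n_gt1 (i : nat)) -e prodW_cons.
by rewrite -(pactM n_gt1) mulgA simple_refl_sqr mul1g.
Qed.

Lemma increasing_last u ts : prodW u = \prod_(t <- ts) t -> reflections ts ->
  increasing 1 ts -> (0 < size u)%N -> uniq u ->
  exists ts' t u1 i u2, [/\ ts = rcons ts' t, u = u1 ++ i :: u2 &
    \prod_(x <- ts') x = prodW (u1 ++ u2)].
Proof.
case: (lastP ts) => [|{}ts t] uE tsr inc u0 uu.
  case: u uE u0 uu => // i u e _ /andP[iu _].
  by case: (prodW_neq1 iu); rewrite e big_nil.
have tr : is_reflection t by apply: tsr; rewrite mem_rcons inE eqxx.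
have := increasing_rcons inc; rewrite mul1g => lt.
have tsE : \prod_(x <- ts) x = prodW u * t.
  by rewrite uE -cats1 big_cat /= big_seq1 -mulgA reflection_sqr // mulg1.
have [a [b [ltab ab tE]]] := reflection_rf n_gt1 tr.
have : (len (prodW u * t) < len (prodW u))%N.
  by rewrite -tsE; move: lt; rewrite tsE -mulgA reflection_sqr // mulg1 -tsE.
rewrite (len_descentP tr tE ab ltab) => desc.
have [u1 [i [u2 [uu' utE]]]] := exchange n_gt1 ab tE ltab desc.
by exists ts, t, u1, i, u2; rewrite tsE.
Qed.

Lemma reflection_length_uniq u ts : uniq u -> reflections ts ->
  prodW u = \prod_(t <- ts) t -> (size u <= size ts)%N.
Proof.
have [k] := ubnP (size ts); elim: k u ts => // k IH u ts tsk uu tsr uE.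
have [->//|u0] := posnP (size u).
have [[us [usr us_ts usE]]|[us ts_us inc]] := straighten tsr.
  by apply: leq_trans (IH u us _ uu usr _) (ltnW us_ts); rewrite ?usE //; lia.
have usr := hurwitz_reflections ts_us tsr.
rewrite (hurwitz_prod ts_us) in uE; rewrite (hurwitz_size ts_us) in tsk *.
have [us' [t [u1 [i [u2 [usE uE' us'E]]]]]] := increasing_last uE usr inc u0 uu.
have : (size (u1 ++ u2) <= size us')%N.
  apply: IH; rewrite ?us'E //; first by rewrite usE size_rcons in tsk; lia.
    by apply: subseq_uniq uu; rewrite uE'; apply: cat_subseq (subseq_cons _ _).
  by move=> x xus; apply: usr; rewrite usE mem_rcons inE xus orbT.
by rewrite usE uE' size_rcons !size_cat /=; lia.
Qed.

(** Stated for arbitrary words with distinct letters so that the induction may delete one. Once the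
    factorization is increasing, the factors before the last one multiply to [u] without some letter
    [i], and moving the last factor left past the letters after [i] turns it into [s i]. *)
Lemma hurwitz_transitive u ts : uniq u -> reflections ts ->
  prodW u = \prod_(t <- ts) t -> size ts = size u ->
  hurwitz ts [seq simple_refl i | i <- u].
Proof.
have [k] := ubnP (size ts); elim: k u ts => // k IH u ts tsk uu tsr uE tsu.
have [/size0nil u0|u0] := posnP (size u).
  by rewrite u0 in tsu *; rewrite (size0nil tsu); apply: hurwitz_refl.
have [[us [usr us_ts usE]]|[us ts_us inc]] := straighten tsr.
  have := @reflection_length_uniq u us uu usr _; rewrite usE => /(_ uE).
  by rewrite -tsu; lia.
apply: (hurwitz_trans ts_us).
have usr := hurwitz_reflections ts_us tsr.
rewrite (hurwitz_prod ts_us) in uE; rewrite (hurwitz_size ts_us) in tsk tsu.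
have [us' [t [u1 [i [u2 [usE uE' us'E]]]]]] := increasing_last uE usr inc u0 uu.
have us'_u : hurwitz us' [seq simple_refl j | j <- u1 ++ u2].
  apply: IH; rewrite ?us'E //.
  - by rewrite usE size_rcons in tsk; lia.
  - by apply: subseq_uniq uu; rewrite uE'; apply: cat_subseq (subseq_cons _ _).
  - by move=> x xus; apply: usr; rewrite usE mem_rcons inE xus orbT.
  - by move: tsu; rewrite usE uE' size_rcons !size_cat /=; lia.
have := hurwitz_cat [::] [:: t] us'_u; rewrite !cat0s !cats1 -usE.
move/hurwitz_trans; apply; rewrite map_cat -cats1 -catA cats1.
have := hurwitz_cat [seq simple_refl j | j <- u1] [::]
  (hurwitz_move [seq simple_refl j | j <- u2] t).
rewrite !cats0 uE' map_cat /=.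
suff -> : t ^ (\prod_(x <- [seq simple_refl j | j <- u2]) x)^-1 = simple_refl i by [].
rewrite big_map -/(prodW u2); have : prodW u = prodW (u1 ++ u2) * t.
  by rewrite -us'E uE usE -cats1 big_cat /= big_seq1.
rewrite uE' !prodW_cat prodW_cons -mulgA => /mulgI e.
by rewrite /conjg invgK mulgA -e mulgK.
Qed.

End HurwitzTransitivity.

(** * Non-crossing arcs in the annulus *)

Section Circle.
Variables p q : nat.
Hypotheses (p_gt0 : (0 < p)%N) (q_gt0 : (0 < q)%N).
Local Notation n := (p + q)%N.
Implicit Types (a b k l m z : int).

(* The integers congruent to 1, ..., p modulo n are the lifts of the outer
   marked points, listed increasingly by out with out 0 = p; the others are the
   lifts of the inner ones, listed by inn with inn 0 = p + 1. *)
Definition out a : int := ((a + p%:Z - 1) %/ p)%Z * n%:Z + ((a + p%:Z - 1) %% p)%Z + 1.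
Definition inn b : int := (b %/ q)%Z * n%:Z + (b %% q)%Z + p%:Z + 1.

Lemma div_ex (d : nat) z : (0 < d)%N ->
  exists k r, [/\ z = (k * d%:Z + r)%R, (0 <= r < d%:Z)%R, (z %/ d)%Z = k & (z %% d)%Z = r].
Proof.
move=> d0; exists (z %/ d)%Z, (z %% d)%Z; split=> //; first exact: divz_eq.
have dN0 : (d%:Z != 0)%R by lia.
have d0' : (0 < d%:Z)%R by lia.
by have := modz_ge0 z dN0; have := ltz_pmod z d0'; lia.
Qed.

Lemma outE k r : (0 <= r < p%:Z)%R -> out (k * p%:Z + r - p%:Z + 1) = (k * n%:Z + r + 1)%R.
Proof.
move=> rp; rewrite /out (_ : _ + p%:Z - 1 = k * p%:Z + r)%R; last by lia.
rewrite divzMDl ?modzMDl; last by lia.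
by rewrite divz_small ?modz_small ?addr0 //; lia.
Qed.

Lemma innE k r : (0 <= r < q%:Z)%R -> inn (k * q%:Z + r) = (k * n%:Z + r + p%:Z + 1)%R.
Proof.
move=> rq; rewrite /inn divzMDl ?modzMDl; last by lia.
by rewrite divz_small ?modz_small ?addr0 //; lia.
Qed.

Lemma outP a : exists k r, [/\ (0 <= r < p%:Z)%R, a = (k * p%:Z + r - p%:Z + 1)%R &
  out a = (k * n%:Z + r + 1)%R].
Proof.
have [k [r [e rp _ _]]] := div_ex (a + p%:Z - 1) p_gt0.
have aE : a = (k * p%:Z + r - p%:Z + 1)%R by lia.
by exists k, r; split; rewrite // aE outE.
Qed.

Lemma innP b : exists k r, [/\ (0 <= r < q%:Z)%R, b = (k * q%:Z + r)%R &
  inn b = (k * n%:Z + r + p%:Z + 1)%R].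
Proof.
have [k [r [e rq _ _]]] := div_ex b q_gt0.
by exists k, r; split; rewrite // e innE.
Qed.

Lemma out_turn a m : out (a + m * p%:Z) = (out a + m * n%:Z)%R.
Proof.
have [k [r [rp aE ->]]] := outP a.
rewrite (_ : a + m * p%:Z = (k + m) * p%:Z + r - p%:Z + 1)%R; last by lia.
by rewrite outE //; lia.
Qed.

Lemma inn_turn b m : inn (b + m * q%:Z) = (inn b + m * n%:Z)%R.
Proof.
have [k [r [rq bE ->]]] := innP b.
rewrite (_ : b + m * q%:Z = (k + m) * q%:Z + r)%R; last by lia.
by rewrite innE //; lia.
Qed.

Lemma out_or_inn z : (exists a, z = out a) \/ (exists b, z = inn b).
Proof.
have n0 : (0 < n)%N by lia.
have [k [r [e rn _ _]]] := div_ex (z - 1) n0.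
have [rp|rp] : (r < p%:Z)%R \/ (p%:Z <= r)%R by lia.
  by left; exists (k * p%:Z + r - p%:Z + 1)%R; rewrite outE; lia.
by right; exists (k * q%:Z + (r - p%:Z))%R; rewrite innE; lia.
Qed.

Definition code z : bool * int :=
  let k := ((z - 1) %/ n)%Z in let r := ((z - 1) %% n)%Z in
  if (r < p%:Z)%R then (true, k * p%:Z + r - p%:Z + 1)%R
  else (false, k * q%:Z + (r - p%:Z))%R.

Lemma code_out a : code (out a) = (true, a).
Proof.
have [k [r [rp aE ->]]] := outP a; rewrite /code addrK.
rewrite divzMDl ?modzMDl; last by lia.
by rewrite divz_small ?modz_small ?addr0 ?aE; first (case: ifP => // ; lia); lia.
Qed.

Lemma code_inn b : code (inn b) = (false, b).
Proof.
have [k [r [rq bE ->]]] := innP b; rewrite /code addrK -addrA.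
rewrite divzMDl ?modzMDl; last by lia.
rewrite divz_small ?modz_small ?addr0 ?bE; try lia.
by case: ifP => [|_]; [lia|congr (_, _); lia].
Qed.

(* Clockwise order on the boundary of the universal cover of the annulus. *)
Definition prec_code (c d : bool * int) : bool :=
  match c, d with
  | (true, a), (true, b) => (a < b)%R
  | (true, _), (false, _) => true
  | (false, _), (true, _) => false
  | (false, a), (false, b) => (b < a)%R
  end.

Definition prec z z' := prec_code (code z) (code z').

Lemma precC y z : y <> z -> prec y z = ~~ prec z y.
Proof.
have [[a ->]|[a ->]] := out_or_inn y; have [[b ->]|[b ->]] := out_or_inn z;
  rewrite /prec ?code_out ?code_inn //= => ab.
  have : a <> b by move=> e; apply: ab; rewrite e.
  by lia.
have : a <> b by move=> e; apply: ab; rewrite e.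
by lia.
Qed.

(* The arcs {y, g y} and {z, f z} may share an endpoint, and then this fixes
   which of them comes first. Written as a parity, the condition is preserved
   by Hurwitz moves for formal reasons. *)
Definition noncross (f g : int -> int) := forall y z,
  prec y z (+) prec (g y) z (+) (prec y (f z) (+) prec (g y) (f z)) = false.

(** The arc of [f] does not cross its own translates. Comparisons are reversed between the two sides
    so that the half-open intervals agree when [y] and [z] belong to the same arc. *)
Definition simple_arc (f : int -> int) := forall y z,
  prec y (f z) (+) prec (f y) (f z) = prec z y (+) prec z (f y).

Lemma noncrossE f g y z : noncross f g ->
  prec y (f z) (+) prec (g y) (f z) = prec y z (+) prec (g y) z.
Proof.
by move/(_ y z); case: (prec y z (+) _); case: (prec y (f z) (+) _).
Qed.

Lemma noncrossE' f g y z : noncross f g ->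
  prec (g y) z (+) prec (g y) (f z) = prec y z (+) prec y (f z).
Proof.
move=> fg; have := noncrossE y z fg.
by case: (prec (g y) (f z)); case: (prec y (f z)); case: (prec y z); case: (prec _ z).
Qed.

Lemma noncrossI f g : (forall y z,
  prec y (f z) (+) prec (g y) (f z) = prec y z (+) prec (g y) z) -> noncross f g.
Proof. by move=> H y z; rewrite H addbb. Qed.

Lemma noncrossI' f g : (forall y z,
  prec (g y) z (+) prec (g y) (f z) = prec y z (+) prec y (f z)) -> noncross f g.
Proof.
move=> H; apply: noncrossI => y z; have := H y z.
by case: (prec (g y) (f z)); case: (prec y (f z)); case: (prec y z); case: (prec _ z).
Qed.

Lemma noncross_conjl f1 f2 g : noncross f1 g -> noncross f2 g ->
  noncross (fun z => f1 (f2 (f1 z))) g.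
Proof. by move=> g1 g2; apply: noncrossI => y z; rewrite !noncrossE. Qed.

Lemma noncross_conjr f g1 g2 : noncross f g1 -> noncross f g2 ->
  noncross f (fun z => g1 (g2 (g1 z))).
Proof. by move=> fg1 fg2; apply: noncrossI' => y z; rewrite !noncrossE'. Qed.

(** The condition on [f] converts a comparison with [f z] on the right into one with [z] on the
    left. Then [g] can be removed by non-crossing, and the condition is applied backwards. *)
Lemma noncross_hurwitzl f g : involutive f -> simple_arc f -> noncross f g ->
  noncross (fun z => f (g (f z))) f.
Proof.
move=> fK fs fg; apply: noncrossI => y z.
by rewrite fs (noncrossE' _ _ fg) -fs fK.
Qed.

Lemma noncross_hurwitzr f g : involutive g -> simple_arc g -> noncross f g ->
  noncross g (fun z => g (f (g z))).
Proof.
move=> gK gs fg; apply: noncrossI' => y z.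
have E u : prec u z (+) prec u (g z) = prec z (g u) (+) prec (g z) (g u) by rewrite gs.
by rewrite E gK (noncrossE _ _ fg) -E.
Qed.

Lemma noncross_eq f f' g g' : f =1 f' -> g =1 g' -> noncross f g -> noncross f' g'.
Proof. by move=> ff' gg' fg y z; rewrite -ff' -gg'; apply: fg. Qed.

Lemma prec_oo a b : prec (out a) (out b) = (a < b)%R.
Proof. by rewrite /prec !code_out. Qed.
Lemma prec_oi a b : prec (out a) (inn b) = true.
Proof. by rewrite /prec code_out code_inn. Qed.
Lemma prec_io a b : prec (inn a) (out b) = false.
Proof. by rewrite /prec code_out code_inn. Qed.
Lemma prec_ii a b : prec (inn a) (inn b) = (b < a)%R.
Proof. by rewrite /prec !code_inn. Qed.

Definition precE := (prec_oo, prec_oi, prec_io, prec_ii).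

Local Notation rf := (rf n).

Lemma rf_moved x x' z : modeq n x x' = false ->
  [\/ rf x x' z = z,
      (exists k, z = x + k * n%:Z /\ rf x x' z = x' + k * n%:Z)%R |
      (exists k, z = x' + k * n%:Z /\ rf x x' z = x + k * n%:Z)%R].
Proof.
move=> xx'; have [/modeqP[k ->]|/negbTE zx] := boolP (modeq n z x).
  by constructor 2; exists k; rewrite rf_periodic rf_l.
have [/modeqP[k ->]|/negbTE zx'] := boolP (modeq n z x').
  by constructor 3; exists k; rewrite rf_periodic rf_r.
by constructor 1; rewrite rf_out.
Qed.

Lemma noncross_rf x x' w w' : modeq n x x' = false -> modeq n w w' = false ->
  (forall k l,
    prec (w + k * n%:Z) (x + l * n%:Z) (+) prec (w' + k * n%:Z) (x + l * n%:Z) =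
    prec (w + k * n%:Z) (x' + l * n%:Z) (+) prec (w' + k * n%:Z) (x' + l * n%:Z)) ->
  noncross (rf x x') (rf w w').
Proof.
move=> xx ww H y z.
have [->|[k [-> ->]]|[k [-> ->]]] := rf_moved y ww; first by rewrite !addbb.
  have [->|[l [-> ->]]|[l [-> ->]]] := rf_moved z xx; first by rewrite addbb.
  - by rewrite H addbb.
  - by rewrite H addbb.
have [->|[l [-> ->]]|[l [-> ->]]] := rf_moved z xx; first by rewrite addbb.
- by rewrite ![prec (w' + _) _ (+) _]addbC H addbb.
- by rewrite ![prec (w' + _) _ (+) _]addbC H addbb.
Qed.

Lemma rf_fixed_neq x x' y z : modeq n x x' = false ->
  rf x x' y <> y -> rf x x' z = z -> z <> y /\ z <> rf x x' y.
Proof.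
move=> xx' ym zf; split=> e; first by rewrite -e in ym.
by apply: ym; rewrite -[RHS](rfK xx') -e.
Qed.

Lemma simple_arc_rf x x' : modeq n x x' = false ->
  (forall k l,
    prec (x + k * n%:Z) (x' + l * n%:Z) (+) prec (x' + k * n%:Z) (x' + l * n%:Z) =
    prec (x + l * n%:Z) (x + k * n%:Z) (+) prec (x + l * n%:Z) (x' + k * n%:Z)) ->
  (forall k l,
    prec (x + k * n%:Z) (x + l * n%:Z) (+) prec (x' + k * n%:Z) (x + l * n%:Z) =
    prec (x' + l * n%:Z) (x + k * n%:Z) (+) prec (x' + l * n%:Z) (x' + k * n%:Z)) ->
  simple_arc (rf x x').
Proof.
move=> xx H1 H2 y z.
have [ym|ym] := eqVneq (rf x x' y) y; first by rewrite ym !addbb.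
have [zm|zm] := eqVneq (rf x x' z) z.
  have [zy zy'] := rf_fixed_neq xx (elimN eqP ym) zm.
  by rewrite zm (precC (nesym zy)) (precC (nesym zy')) addbN addNb negbK.
move/eqP: ym; move/eqP: zm.
have [//|[k [-> ->]]|[k [-> ->]]] := rf_moved y xx;
  have [//|[l [-> ->]]|[l [-> ->]]] := rf_moved z xx => _ _.
- exact: H1.
- exact: H2.
- by rewrite addbC H1 addbC.
- by rewrite addbC H2 addbC.
Qed.

Lemma modeq_oi a b : modeq n (out a) (inn b) = false.
Proof.
apply/negbTE/negP => /modeqP[k]; rewrite -inn_turn => /(congr1 code).
by rewrite code_out code_inn.
Qed.

Lemma modeq_oo a k : (0 < k < p%:Z)%R -> modeq n (out a) (out (a + k)) = false.
Proof.
move=> kp; apply/negbTE/negP => /modeqP[m]; rewrite -out_turn => /(congr1 code).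
rewrite !code_out => -[e]; have [m0|[m0|m0]] : m = 0%R \/ (0 < m)%R \/ (m < 0)%R by lia.
- by rewrite m0 in e; lia.
- by nia.
- by nia.
Qed.

Lemma modeq_ii b k : (0 < k < q%:Z)%R -> modeq n (inn b) (inn (b + k)) = false.
Proof.
move=> kq; apply/negbTE/negP => /modeqP[m]; rewrite -inn_turn => /(congr1 code).
rewrite !code_inn => -[e]; have [m0|[m0|m0]] : m = 0%R \/ (0 < m)%R \/ (m < 0)%R by lia.
- by rewrite m0 in e; lia.
- by nia.
- by nia.
Qed.

End Circle.

Section Arcs.
Variables p q : nat.
Hypotheses (p_gt0 : (0 < p)%N) (q_gt0 : (0 < q)%N).
Local Notation n := (p + q)%N.
Implicit Types (a b c k l m : int).
Local Notation rf := (rf n).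
Local Notation out := (out p q).
Local Notation inn := (inn p q).
Local Notation noncross := (noncross p q).
Local Notation simple_arc := (simple_arc p q).
Local Notation pE := (precE p_gt0 q_gt0).

(** Distinct translates differ by at least a full turn on both boundaries. This puts the products
    with [p] and [q] in a form where the case checks become linear. *)
Lemma turn_cases k l : [\/ k = l,
  (k * p%:Z + p%:Z <= l * p%:Z)%R /\ (k * q%:Z + q%:Z <= l * q%:Z)%R |
  (l * p%:Z + p%:Z <= k * p%:Z)%R /\ (l * q%:Z + q%:Z <= k * q%:Z)%R].
Proof.
have [kl|kl|->] := ltgtP k l; last by constructor 1.
  by constructor 2; split; nia.
by constructor 3; split; nia.
Qed.

Let outT a m : out (a + m * p%:Z) = (out a + m * n%:Z)%R.
Proof. exact: out_turn. Qed.

Let innT b m : inn (b + m * q%:Z) = (inn b + m * n%:Z)%R.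
Proof. exact: inn_turn. Qed.

Lemma simple_arc_oi a b : simple_arc (rf (out a) (inn b)).
Proof.
apply: simple_arc_rf => //; first exact: modeq_oi.
  by move=> k l; rewrite -!outT -!innT !pE; have [->|[]|[]] := turn_cases k l; lia.
by move=> k l; rewrite -!outT -!innT !pE; have [->|[]|[]] := turn_cases k l; lia.
Qed.

Lemma simple_arc_oo a c : (0 < c < p%:Z)%R -> simple_arc (rf (out a) (out (a + c))).
Proof.
move=> cp; apply: simple_arc_rf => //; first exact: modeq_oo.
  by move=> k l; rewrite -!outT !pE; have [->|[]|[]] := turn_cases k l; lia.
by move=> k l; rewrite -!outT !pE; have [->|[]|[]] := turn_cases k l; lia.
Qed.

Lemma simple_arc_ii a c : (0 < c < q%:Z)%R -> simple_arc (rf (inn a) (inn (a + c))).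
Proof.
move=> cq; apply: simple_arc_rf => //; first exact: modeq_ii.
  by move=> k l; rewrite -!innT !pE; have [->|[]|[]] := turn_cases k l; lia.
by move=> k l; rewrite -!innT !pE; have [->|[]|[]] := turn_cases k l; lia.
Qed.

Let rfo a x m : rf (out a) x (out (a + m * p%:Z)) = (x + m * n%:Z)%R.
Proof. by rewrite outT rf_periodic rf_l. Qed.

Let rfi a x m : rf (inn a) x (inn (a + m * q%:Z)) = (x + m * n%:Z)%R.
Proof. by rewrite innT rf_periodic rf_l. Qed.

Let rfo0 a x : rf (out a) x (out a) = x. Proof. exact: rf_l. Qed.
Let rfi0 a x : rf (inn a) x (inn a) = x. Proof. exact: rf_l. Qed.

Definition rfE := (rfo, rfi, rfo0, rfi0).

(** This and the following extractions evaluate the parity at one chosen endpoint of each arc, which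
    yields exactly the inequalities required by the closure lemmas for lifts. *)
Lemma noncross_oi_oi a b a' b' : noncross (rf (out a) (inn b)) (rf (out a') (inn b')) ->
  forall m, (a' < a + m * p%:Z)%R = (b' <= b + m * q%:Z)%R.
Proof.
by move=> H m; have := H (out a') (out (a + m * p%:Z)); rewrite !rfE -innT !pE; lia.
Qed.

Lemma noncross_oi_oo a b c k :
  noncross (rf (out a) (inn b)) (rf (out c) (out (c + k))) ->
  forall m, ~~ (c < a + m * p%:Z <= c + k)%R.
Proof.
by move=> H m; have := H (out c) (out (a + m * p%:Z)); rewrite !rfE -innT !pE; lia.
Qed.

Lemma noncross_oo_oi a b c k : (0 < k)%R ->
  noncross (rf (out c) (out (c + k))) (rf (out a) (inn b)) ->
  forall m, ~~ (c <= a + m * p%:Z < c + k)%R.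
Proof.
move=> k0 H m; have := H (out a) (out (c + (- m) * p%:Z)).
by rewrite !rfE -!outT !pE; lia.
Qed.

Lemma noncross_oo_oo a k b l :
  noncross (rf (out a) (out (a + k))) (rf (out b) (out (b + l))) -> (0 < l)%R ->
  forall m, (b < a + m * p%:Z <= b + l)%R = (b < a + k + m * p%:Z <= b + l)%R.
Proof.
move=> H l0 m; have := H (out b) (out (a + m * p%:Z)); rewrite !rfE -!outT !pE; lia.
Qed.

Lemma noncross_oi_ii a b c k :
  noncross (rf (out a) (inn b)) (rf (inn c) (inn (c + k))) -> (0 < k)%R ->
  forall m, ~~ (c <= b + m * q%:Z < c + k)%R.
Proof.
move=> H k0 m; have := H (inn c) (out (a + m * p%:Z)); rewrite !rfE -innT !pE; lia.
Qed.

Lemma noncross_ii_oi a b c k : (0 < k)%R ->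
  noncross (rf (inn c) (inn (c + k))) (rf (out a) (inn b)) ->
  forall m, ~~ (c < b + m * q%:Z <= c + k)%R.
Proof.
move=> k0 H m; have := H (out a) (inn (c + (- m) * q%:Z)).
by rewrite !rfE -!innT !pE; lia.
Qed.

Lemma noncross_ii_ii a k b l :
  noncross (rf (inn a) (inn (a + k))) (rf (inn b) (inn (b + l))) -> (0 < l)%R ->
  forall m, (b <= a + m * q%:Z < b + l)%R = (b <= a + k + m * q%:Z < b + l)%R.
Proof.
move=> H l0 m; have := H (inn b) (inn (a + m * q%:Z)); rewrite !rfE -!innT !pE; lia.
Qed.

Local Ltac arcs :=
  let k := fresh "k" in let l := fresh "l" in
  intros k l; rewrite -?outT -?innT !pE;
  case: (turn_cases k l) => [|[]|[]]; try (move=> ->); lia.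

(** From here on the pairs of letters of the standard word are checked in order of occurrence. The
    arc from [out 1] to [inn (q - 1)] is [s n], the one from [out 0] to [inn 0] is [s p], and the
    remaining letters join neighbours on one boundary. *)
Lemma noncross_last_inner c : (0 <= c <= q%:Z - 2)%R ->
  noncross (rf (out 1) (inn (q%:Z - 1))) (rf (inn c) (inn (c + 1))).
Proof.
by move=> cq; apply: noncross_rf => //; [exact: modeq_oi|apply: modeq_ii; lia|arcs].
Qed.

Lemma noncross_last_outer c : (1 - p%:Z <= c <= - 1)%R ->
  noncross (rf (out 1) (inn (q%:Z - 1))) (rf (out c) (out (c + 1))).
Proof.
by move=> cp; apply: noncross_rf => //; [exact: modeq_oi|apply: modeq_oo; lia|arcs].
Qed.

Lemma noncross_last_first :
  noncross (rf (out 1) (inn (q%:Z - 1))) (rf (out 0) (inn 0)).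
Proof. by apply: noncross_rf => //; [exact: modeq_oi|exact: modeq_oi|arcs]. Qed.

Lemma noncross_inner_inner c d : (0 <= d)%R -> (d < c <= q%:Z - 2)%R ->
  noncross (rf (inn c) (inn (c + 1))) (rf (inn d) (inn (d + 1))).
Proof.
by move=> d0 dc; apply: noncross_rf => //; [apply: modeq_ii; lia|apply: modeq_ii; lia|arcs].
Qed.

Lemma noncross_outer_outer c d : (1 - p%:Z <= c < d)%R -> (d <= - 1)%R ->
  noncross (rf (out c) (out (c + 1))) (rf (out d) (out (d + 1))).
Proof.
by move=> cd d1; apply: noncross_rf => //; [apply: modeq_oo; lia|apply: modeq_oo; lia|arcs].
Qed.

Lemma noncross_inner_outer c d (e f : int) : (0 < e < q%:Z)%R -> (0 < f < p%:Z)%R ->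
  noncross (rf (inn c) (inn (c + e))) (rf (out d) (out (d + f))).
Proof. by move=> eq fp; apply: noncross_rf => //; [exact: modeq_ii|exact: modeq_oo|arcs]. Qed.

Lemma noncross_inner_first c : (0 <= c <= q%:Z - 2)%R ->
  noncross (rf (inn c) (inn (c + 1))) (rf (out 0) (inn 0)).
Proof.
by move=> cq; apply: noncross_rf => //; [apply: modeq_ii; lia|exact: modeq_oi|arcs].
Qed.

Lemma noncross_outer_first c : (1 - p%:Z <= c <= - 1)%R ->
  noncross (rf (out c) (out (c + 1))) (rf (out 0) (inn 0)).
Proof.
by move=> cp; apply: noncross_rf => //; [apply: modeq_oo; lia|exact: modeq_oi|arcs].
Qed.

End Arcs.

(** * The Artin group *)

Section Artin.
Variable n : nat.
Hypothesis n_gt1 : (1 < n)%N.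
Local Notation W := (affW n).
Local Notation B := (affA_artin n).
Local Notation modeq := (modeq n).
Local Notation ordz := (ordz n_gt1).
Local Notation sW := (sW n_gt1).

Definition sB (z : int) : B := pres_gen _ (ordz z).

Lemma sB_nat (i : 'I_n) : sB i = pres_gen _ i.
Proof. by rewrite /sB ordz_nat. Qed.

Lemma sB_mod i j : modeq i j -> sB i = sB j.
Proof. by rewrite -(ordz_eq n_gt1) /sB => /eqP ->. Qed.

Lemma sB_period i : sB (i + n%:Z) = sB i.
Proof. by apply: sB_mod; rewrite -[(n%:Z)%R]mul1r modeq_period modeq_refl. Qed.

Lemma sB_braid : (3 <= n)%N -> forall i : int,
  sB i * sB (i + 1)%R * sB i = sB (i + 1)%R * sB i * sB (i + 1)%R.
Proof.
move=> n3 i; have := pres_relP (AffABraid (ordz i) n3).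
by rewrite !big_cons big_nil !mulg1 -ordzS !mulgA.
Qed.

Lemma sB_commute (i j : int) : (i + 2 <= j <= i + n%:Z - 2)%R -> commute (sB i) (sB j).
Proof.
move=> /(affA_adj_far n_gt1)/andP[ij adj].
by have := pres_relP (AffAComm ij adj); rewrite !big_cons big_nil !mulg1.
Qed.

Lemma artin_lift_ex (G : groupType) (f : int -> G) :
  (forall i j : int, modeq i j -> f i = f j) ->
  ((3 <= n)%N -> forall i : int, f i * f (i + 1)%R * f i = f (i + 1)%R * f i * f (i + 1)%R) ->
  (forall i j : int, modeq i j = false -> modeq i (j + 1) = false ->
     modeq j (i + 1) = false -> commute (f i) (f j)) ->
  exists F : UMagmaMorphism.type B G, forall z, F (sB z) = f z.
Proof.
move=> fmod fbraid fcomm.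
have [|F FE] := @pres_lift_ex _ (@affA_braid_rel n) G (fun i : 'I_n => f i).
  move=> _ _ [i n3|i j ij adj].
    rewrite !big_cons big_nil !mulg1.
    have -> : f (ordS i) = f ((i : nat)%:Z + 1)%R.
      by apply: fmod; rewrite -{1}(ordz_nat n_gt1 i) -ordzS modeq_ordz.
    by rewrite !mulgA fbraid.
  rewrite !big_cons big_nil !mulg1; apply: fcomm.
  - by apply/negbTE; rewrite -(ordz_eq n_gt1) !ordz_nat.
  - apply/negbTE; move: adj; rewrite -{1}(ordz_nat n_gt1 i) -{1}(ordz_nat n_gt1 j).
    by rewrite affA_adjE negb_or => /andP[].
  - apply/negbTE; move: adj; rewrite -{1}(ordz_nat n_gt1 i) -{1}(ordz_nat n_gt1 j).
    by rewrite affA_adjE negb_or => /andP[].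
by exists F => z; rewrite /sB FE; apply/fmod/modeq_ordz.
Qed.

Lemma artin_shift_ex (c : int) :
  exists F : UMagmaMorphism.type B B, forall z, F (sB z) = sB (z + c)%R.
Proof.
apply: (artin_lift_ex (f := fun z => sB (z + c)%R)) => [i j ij|n3 i|i j ij ij1 ji1].
- by apply: sB_mod; rewrite modeqDr.
- by rewrite addrAC sB_braid.
rewrite /commute; have := @pres_relP _ _ _ _ (@AffAComm n (ordz (i + c)) (ordz (j + c)) _ _).
rewrite !big_cons big_nil !mulg1; apply; rewrite ?ordz_eq ?affA_adjE ?modeqDr ?ij //.
by rewrite ![(_ + c + 1)%R]addrAC !modeqDr ij1 ji1.
Qed.

Lemma artin_proj_ex : exists F : UMagmaMorphism.type B W, forall z, F (sB z) = sW z.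
Proof.
apply: artin_lift_ex => [i j|n3 i|i j]; [exact: sW_mod|exact: sW_braid|exact: sW_comm].
Qed.

Lemma artin_ind (P : B -> Prop) :
  P 1 -> (forall z g, P g -> P (sB z * g)) ->
  (forall z g, P g -> P ((sB z)^-1 * g)) -> forall g, P g.
Proof.
by move=> P1 PM PV; apply: pres_ind => // i g /= Pg; rewrite -sB_nat; [apply: PM|apply: PV].
Qed.

Lemma artin_hom_ext (G : groupType) (F F' : UMagmaMorphism.type B G) :
  (forall z, F (sB z) = F' (sB z)) -> F =1 F'.
Proof. by move=> FF; apply: pres_hom_ext => i; rewrite -sB_nat FF. Qed.

End Artin.

(** * Images of the lifts as periodic transpositions *)

Section ArtinLifts.
Variables p q : nat.
Hypotheses (p_gt0 : (0 < p)%N) (q_gt0 : (0 < q)%N).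
Local Notation n := (p + q)%N.
Hypothesis n_gt1 : (1 < n)%N.
Local Notation W := (affW n).
Local Notation B := (affA_artin n).
Local Notation modeq := (modeq n).
Local Notation rf := (rf n).
Local Notation sw := (sw n).
Local Notation sW := (sW n_gt1).
Local Notation sB := (sB n_gt1).
Local Notation out := (out p q).
Local Notation inn := (inn p q).

Variables (sg sgi : UMagmaMorphism.type B B) (pi : UMagmaMorphism.type B W).
Hypothesis sgs : forall z, sg (sB z) = sB (z + 1).
Hypothesis sgis : forall z, sgi (sB z) = sB (z - 1).
Hypothesis pis : forall z, pi (sB z) = sW z.

Lemma sgK : cancel sg sgi.
Proof.
move=> g; rewrite -[RHS]/(idfun g); apply: (@artin_hom_ext n n_gt1 B (sgi \o sg) idfun) => z /=.
by rewrite sgs sgis addrK.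
Qed.

Lemma sgiK : cancel sgi sg.
Proof.
move=> g; rewrite -[RHS]/(idfun g); apply: (@artin_hom_ext n n_gt1 B (sg \o sgi) idfun) => z /=.
by rewrite sgis sgs subrK.
Qed.

Lemma sg_iter g : iter n sg g = g.
Proof.
have it1 k : iter k sg 1 = 1 by elim: k => //= k ->; rewrite gmulf1.
have itM k x y : iter k sg (x * y) = iter k sg x * iter k sg y.
  by elim: k => //= k ->; rewrite gmulfM.
have itV k x : iter k sg x^-1 = (iter k sg x)^-1.
  by elim: k => //= k ->; rewrite gmulfV.
have its k z : iter k sg (sB z) = sB (z + k%:Z).
  by elim: k => [|k IHk] /=; rewrite ?addr0 // IHk sgs; congr sB; lia.
by elim/(artin_ind (n_gt1 := n_gt1)): g => [|z g IHg|z g IHg];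
  rewrite ?it1 // itM ?itV its sB_period IHg.
Qed.

Local Notation X := (cross_lift sB p q sg sgi).
Local Notation Y := (outer_lift sB p q sg sgi).
Local Notation Z := (inner_lift sB p q sg sgi).
Local Notation u := (inner_word sB p q).
Local Notation v := (outer_word sB p).
Local Notation Fo := (outer_turn sB p q sg).
Local Notation Fi := (inner_turn sB p sg).
Local Notation cB := (cox_word sB p q).

Let per := @sB_period n n_gt1.
Let braid := @sB_braid n n_gt1.
Let comm := @sB_commute n n_gt1.

Definition pactB (g : B) : int -> int := pact (pi g).

Lemma pactBM g h z : pactB (g * h) z = pactB g (pactB h z).
Proof. by rewrite /pactB gmulfM pactM. Qed.

Lemma pactBV g z : pactB g^-1 (pactB g z) = z.
Proof. by rewrite /pactB gmulfV pactV. Qed.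

Lemma pactBVK g z : pactB g (pactB g^-1 z) = z.
Proof. by rewrite /pactB gmulfV pactVK. Qed.

Lemma pactB_s i : pactB (sB i) =1 sw i.
Proof. by move=> z; rewrite /pactB pis pact_sW. Qed.

Lemma pactB_periodic g : periodic n (pactB g).
Proof. exact: pact_periodic. Qed.

Lemma sw_succ (i z : int) : sw (i + 1) (z + 1) = (sw i z + 1)%R.
Proof. by rewrite /sw /rf !modeqDr; do !case: ifP => _; lia. Qed.

Lemma pactB_sg g z : pactB (sg g) (z + 1) = (pactB g z + 1)%R.
Proof.
elim/(artin_ind (n_gt1 := n_gt1)): g z => [|i g IHg|i g IHg] z.
- by rewrite gmulf1 /pactB gmulf1 !pact1.
- by rewrite gmulfM !pactBM IHg sgs !pactB_s sw_succ.
have VE j x : pactB (sB j)^-1 x = sw j x.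
  by rewrite /pactB gmulfV pis sWV pact_sW.
by rewrite gmulfM gmulfV !pactBM IHg sgs !VE sw_succ.
Qed.

(** A descending word acts as a periodic cycle on [i, ..., i + k]. Composed with the translation by
    1 it fixes the points of one boundary and advances those of the other. *)
Lemma pactB_dn (i : int) k : (k < n)%N ->
  [/\ pactB (dn sB i k) i = (i + k%:Z)%R,
      forall j : int, (1 <= j <= k%:Z)%R -> pactB (dn sB i k) (i + j) = (i + j - 1)%R &
      forall z : int, (i + k%:Z < z < i + n%:Z)%R -> pactB (dn sB i k) z = z].
Proof.
have swo (j z : int) : (j + 1 < z < j + n%:Z)%R -> sw j z = z.
  by move=> jz; apply: sw_out; apply: modeq_small; lia.
elim: k i => [|k IHk] i kn.
  have P1 z : pactB (dn sB i 0) z = z by rewrite /pactB gmulf1 pact1.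
  by split=> [|j|z _]; rewrite ?P1 ?addr0 //; lia.
have [d1 d2 d3] := IHk (i + 1)%R (ltnW kn).
have PS z : pactB (dn sB i k.+1) z = pactB (dn sB (i + 1) k) (sw i z).
  by rewrite [dn _ _ _]/= pactBM pactB_s.
split=> [|j jk|z iz].
- by rewrite PS sw_l d1; lia.
- rewrite PS; have [->|j1] : j = 1%R \/ (1 < j)%R by lia.
    rewrite sw_r // (_ : pactB _ i = i); first by lia.
    have := d3 (i + 1 * n%:Z)%R; rewrite pactB_periodic => d3'.
    by have := d3' _; lia.
  rewrite swo; last by lia.
  have := d2 (j - 1)%R; rewrite (_ : i + 1 + (j - 1) = i + j)%R; last by lia.
  by move=> ->; lia.
by rewrite PS swo ?d3 //; lia.
Qed.

(** The permutation whose conjugation realizes [outer_turn] on the integers. The translation by 1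
    stands for the shift [sg]. *)
Definition outer_step (z : int) : int := pactB u (z + 1).
Definition inner_step (z : int) : int := pactB v^-1 (z + 1).

Lemma outer_step_periodic : periodic n outer_step.
Proof. by move=> z k; rewrite /outer_step addrAC pactB_periodic. Qed.

Lemma inner_step_periodic : periodic n inner_step.
Proof. by move=> z k; rewrite /inner_step addrAC pactB_periodic. Qed.

Lemma outer_step_turn (z k : int) : outer_step (k * n%:Z + z) = (k * n%:Z + outer_step z)%R.
Proof. by rewrite addrC outer_step_periodic addrC. Qed.

Lemma inner_step_turn (z k : int) : inner_step (k * n%:Z + z) = (k * n%:Z + inner_step z)%R.
Proof. by rewrite addrC inner_step_periodic addrC. Qed.

Lemma pactB_v : pactB v^-1 =1 pactB (dn sB 1 p).
Proof.
have H k (i : int) : (pi (up sB i k))^-1 = pi (dn sB i k).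
  elim: k i => [|k IHk] i; first by rewrite !gmulf1 invg1.
  by rewrite [up _ _ _]/= [dn _ _ _]/= !gmulfM invgM IHk !pis sWV.
by move=> z; rewrite /pactB gmulfV H.
Qed.

Lemma outer_step_out a : outer_step (out a) = out (a + 1).
Proof.
have [k [r [rp aE ->]]] := outP p_gt0 q_gt0 a.
have qn : (q < n)%N by lia.
have [d1 d2 d3] := pactB_dn (p%:Z + 1) qn.
rewrite -addrA outer_step_turn aE /outer_step (_ : u = dn sB (p%:Z + 1) q) //.
have [rp'|rp'] : (r = p%:Z - 1)%R \/ (r + 1 < p%:Z)%R by lia.
  rewrite (_ : k * p%:Z + r - p%:Z + 1 + 1 = (k + 1) * p%:Z + 0 - p%:Z + 1)%R; last by lia.
  rewrite (_ : r + 1 + 1 = p%:Z + 1)%R; last by lia.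
  by rewrite outE ?d1 //; lia.
rewrite (_ : k * p%:Z + r - p%:Z + 1 + 1 = k * p%:Z + (r + 1) - p%:Z + 1)%R; last by lia.
rewrite outE //; last by lia.
have := d3 (r + 1 + 1 + 1 * n%:Z)%R; rewrite pactB_periodic => d3'.
rewrite (_ : pactB _ _ = r + 1 + 1)%R; first by lia.
by apply: (addIr (1 * n%:Z)%R); apply: d3'; lia.
Qed.

Lemma outer_step_inn b : outer_step (inn b) = inn b.
Proof.
have [k [r [rq bE ->]]] := innP p_gt0 q_gt0 b.
have qn : (q < n)%N by lia.
have [d1 d2 d3] := pactB_dn (p%:Z + 1) qn.
rewrite -!addrA outer_step_turn /outer_step (_ : u = dn sB (p%:Z + 1) q) //.
rewrite (_ : r + (p%:Z + 1) + 1 = p%:Z + 1 + (r + 1))%R; last by lia.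
by rewrite d2; lia.
Qed.

Lemma inner_step_out a : inner_step (out a) = out a.
Proof.
have [k [r [rp aE ->]]] := outP p_gt0 q_gt0 a.
have pn : (p < n)%N by lia.
have [d1 d2 d3] := pactB_dn 1 pn.
rewrite -!addrA inner_step_turn /inner_step pactB_v (_ : r + 1 + 1 = 1 + (r + 1))%R; last by lia.
by rewrite d2; lia.
Qed.

Lemma inner_step_inn b : inner_step (inn b) = inn (b + 1).
Proof.
have [k [r [rq bE ->]]] := innP p_gt0 q_gt0 b.
have pn : (p < n)%N by lia.
have [d1 d2 d3] := pactB_dn 1 pn.
rewrite -!addrA inner_step_turn bE /inner_step pactB_v.
have [rq'|rq'] : (r = q%:Z - 1)%R \/ (r + 1 < q%:Z)%R by lia.
  rewrite (_ : k * q%:Z + r + 1 = (k + 1) * q%:Z + 0)%R; last by lia.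
  rewrite (_ : r + (p%:Z + 1) + 1 = 1 + 1 * n%:Z)%R; last by lia.
  by rewrite innE // pactB_periodic d1; lia.
rewrite -[in RHS]addrA innE //; last by lia.
by rewrite d3; lia.
Qed.

Lemma outer_step_inj : injective outer_step.
Proof. by move=> z z' /(can_inj (pactBV u)); lia. Qed.

Lemma inner_step_inj : injective inner_step.
Proof. by move=> z z' /(can_inj (pactBV v^-1)); lia. Qed.

Lemma pactB_outer_turn g z : pactB (Fo g) (outer_step z) = outer_step (pactB g z).
Proof.
by rewrite /outer_step /= /twist /conjg invgK !pactBM pactBV pactB_sg.
Qed.

Lemma pactB_inner_turn g z : pactB (Fi g) (inner_step z) = inner_step (pactB g z).
Proof.
by rewrite /inner_step /= /twist /conjg !pactBM pactBVK pactB_sg.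
Qed.

Lemma outer_step_surj z : exists z', z = outer_step z'.
Proof. by exists (pactB u^-1 z - 1)%R; rewrite /outer_step subrK pactBVK. Qed.

Lemma inner_step_surj z : exists z', z = inner_step z'.
Proof. by exists (pactB v z - 1)%R; rewrite /inner_step subrK pactBV. Qed.

Lemma pactB_outer_turn_rf g x x' : modeq x x' = false ->
  pactB (Fo g) =1 rf (outer_step x) (outer_step x') <-> pactB g =1 rf x x'.
Proof.
move=> xx; split=> H z.
  by apply: outer_step_inj; rewrite -pactB_outer_turn H (rf_conj _ xx outer_step_periodic outer_step_inj).
have [z' ->] := outer_step_surj z.
by rewrite pactB_outer_turn H (rf_conj _ xx outer_step_periodic outer_step_inj).
Qed.

Lemma pactB_inner_turn_rf g x x' : modeq x x' = false ->
  pactB (Fi g) =1 rf (inner_step x) (inner_step x') <-> pactB g =1 rf x x'.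
Proof.
move=> xx; split=> H z.
  by apply: inner_step_inj; rewrite -pactB_inner_turn H (rf_conj _ xx inner_step_periodic inner_step_inj).
have [z' ->] := inner_step_surj z.
by rewrite pactB_inner_turn H (rf_conj _ xx inner_step_periodic inner_step_inj).
Qed.

Lemma cross_lift_succ_outer a b : X (a + 1) b = Fo (X a b).
Proof. exact/iterz1/outer_unturnK/sgiK. Qed.

Lemma cross_lift_succ_inner b : X 0 (b + 1) = Fi (X 0 b).
Proof. exact/iterz1/inner_unturnK/sgiK. Qed.

Lemma pactB_cross a b : pactB (X a b) =1 rf (out a) (inn b).
Proof.
have moi a' b' : modeq (out a') (inn b') = false by exact: modeq_oi.
have X00 : pactB (X 0 0) =1 rf (out 0) (inn 0).
  have -> : out 0 = p.
    rewrite (_ : 0 = 0 * p%:Z + (p%:Z - 1) - p%:Z + 1)%R; last by lia.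
    by rewrite outE //; lia.
  have -> : inn 0 = (p%:Z + 1)%R.
    rewrite (_ : 0 = 0 * q%:Z + 0)%R; last by lia.
    by rewrite innE //; lia.
  exact: pactB_s.
have X0b : pactB (X 0 b) =1 rf (out 0) (inn b).
  elim/int_ind: b => [|b IHb|b IHb] //.
    have -> : (b.+1%:Z = b%:Z + 1)%R by lia.
    by rewrite cross_lift_succ_inner -inner_step_inn -{1}(inner_step_out 0); apply/pactB_inner_turn_rf.
  apply/(@pactB_inner_turn_rf _ (out 0) (inn (- b.+1%:Z))) => //.
  by rewrite -cross_lift_succ_inner inner_step_out inner_step_inn (_ : - b.+1%:Z + 1 = - b%:Z)%R //; lia.
elim/int_ind: a => [|a IHa|a IHa] //.
  have -> : (a.+1%:Z = a%:Z + 1)%R by lia.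
  rewrite cross_lift_succ_outer -outer_step_out -(outer_step_inn b).
  by apply/pactB_outer_turn_rf; rewrite ?outer_step_inn.
apply/(@pactB_outer_turn_rf _ (out (- a.+1%:Z)) (inn b)) => //.
by rewrite -cross_lift_succ_outer outer_step_out outer_step_inn (_ : - a.+1%:Z + 1 = - a%:Z)%R //; lia.
Qed.

Local Notation L := (arc_lift X Y Z p q).
Local Notation noncross := (noncross p q).

Let hXt := cross_lift_periodic p_gt0 q_gt0 per braid comm sgs sgK sgiK sg_iter.
Let hyt := outer_lift_periodic p_gt0 q_gt0 per braid comm sgs sgK sgiK sg_iter.
Let hzt := inner_lift_periodic p_gt0 q_gt0 per braid comm sgs sgK sgiK sg_iter.
Let hXy := cross_outer p_gt0 q_gt0 per braid comm sgs sgK sgiK.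
Let hXz := cross_inner p_gt0 q_gt0 per braid comm sgs sgK sgiK.
Let hXyc := cross_outer_commute p_gt0 q_gt0 per braid comm sgs sgK sgiK.
Let hXzc := cross_inner_commute p_gt0 q_gt0 per braid comm sgs sgK sgiK sg_iter.
Let hXa := cross_affine p_gt0 q_gt0 per braid comm sgs sgK sgiK sg_iter.
Let hXX := cross_cross_commute p_gt0 q_gt0 per braid comm sgs sgK sgiK.

Lemma pactB_involution t x x' : modeq x x' = false -> pactB t =1 rf x x' ->
  pactB t^-1 =1 rf x x'.
Proof. by move=> xx tE z; rewrite -{1}[z](rfK xx) -tE pactBV. Qed.

Lemma pactBJ t h x x' w w' : modeq x x' = false -> modeq w w' = false ->
  pactB t =1 rf x x' -> pactB h =1 rf w w' ->
  pactB (t ^ h) =1 rf (rf w w' x) (rf w w' x').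
Proof.
move=> xx ww tE hE z; rewrite /conjg !pactBM tE hE (pactB_involution ww hE).
by rewrite (rf_conj _ xx (@rf_periodic n w w') (can_inj (rfK ww))) (rfK ww).
Qed.

Lemma pactB_outer a k : (0 < k < p%:Z)%R -> pactB (Y a k) =1 rf (out a) (out (a + k)).
Proof.
move=> kp z; have moo := modeq_oo p_gt0 q_gt0 a kp.
have moi := modeq_oi p_gt0 q_gt0.
have -> : Y a k = X (a + k) 0 ^ X a 0.
  by have [e _] := hXy a 0 kp; rewrite /conjg -e mulKg.
have e : rf (out a) (inn 0) (out (a + k)) = out (a + k).
  by apply: rf_out => //; rewrite modeq_sym.
rewrite (pactBJ _ _ (pactB_cross _ _) (pactB_cross _ _)) // rf_r // e.
by rewrite rfC // modeq_sym.
Qed.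

Lemma pactB_inner b k : (0 < k < q%:Z)%R -> pactB (Z b k) =1 rf (inn b) (inn (b + k)).
Proof.
move=> kq z; have mii := modeq_ii p_gt0 q_gt0 b kq.
have moi := modeq_oi p_gt0 q_gt0.
have -> : Z b k = X 0 b ^ X 0 (b + k).
  by have [e _] := hXz 0 b kq; rewrite /conjg -e mulKg.
have e : rf (out 0) (inn (b + k)) (inn b) = inn b.
  by apply: rf_out => //; rewrite modeq_sym.
rewrite (pactBJ _ _ (pactB_cross _ _) (pactB_cross _ _)) // rf_l e.
by rewrite rfC // modeq_sym.
Qed.

Lemma arc_lift_rf t : L t -> exists x x', [/\ modeq x x' = false,
  pactB t =1 rf x x' & simple_arc p q (rf x x')].
Proof.
case=> [a b|a k kp|b k kq].
- exists (out a), (inn b); split; [exact: modeq_oi|exact: pactB_cross|exact: simple_arc_oi].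
- exists (out a), (out (a + k)); split; [exact: modeq_oo|exact: pactB_outer|exact: simple_arc_oo].
- exists (inn b), (inn (b + k)); split; [exact: modeq_ii|exact: pactB_inner|exact: simple_arc_ii].
Qed.

Local Ltac lift_hyp :=
  first [exact: hXt | exact: hyt | exact: hzt | exact: hXy | exact: hXz
        | exact: hXyc | exact: hXzc | exact: hXa | exact: hXX | done].

Lemma arc_lift_closed t1 t2 : L t1 -> L t2 -> noncross (pactB t1) (pactB t2) ->
  hurwitz_closed L t1 t2.
Proof.
have yz a k b l (kp : (0 < k < p%:Z)%R) (lq : (0 < l < q%:Z)%R) :
    commute (Y a k) (Z b l) by apply: (y_z_commute (p := p) (q := q) (X := X)); try lift_hyp.
case=> [a b|a k kp|b k kq] [a' b'|a' l lp|b' l lq].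
- move/(noncross_eq (pactB_cross _ _) (pactB_cross _ _)) => nc.
  apply: closed_XX; try lift_hyp.
  exact: noncross_oi_oi nc.
- move/(noncross_eq (pactB_cross _ _) (pactB_outer _ lp)) => nc.
  apply: closed_XY; try lift_hyp.
  exact: noncross_oi_oo nc.
- move/(noncross_eq (pactB_cross _ _) (pactB_inner _ lq)) => nc.
  apply: closed_XZ; try lift_hyp.
  by apply: noncross_oi_ii nc _; lia.
- move/(noncross_eq (pactB_outer _ kp) (pactB_cross _ _)) => nc.
  apply: closed_YX; try lift_hyp.
  by apply: noncross_oo_oi nc; lia.
- move/(noncross_eq (pactB_outer _ kp) (pactB_outer _ lp)) => nc.
  apply: closed_YY; try lift_hyp.
  by apply: noncross_oo_oo nc _; lia.
- by move=> _; apply: hurwitz_closedC; [exact: LiftY|exact: LiftZ|exact: yz].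
- move/(noncross_eq (pactB_inner _ kq) (pactB_cross _ _)) => nc.
  apply: closed_ZX; try lift_hyp.
  by apply: noncross_ii_oi nc; lia.
- by move=> _; apply: hurwitz_closedC; [exact: LiftZ|exact: LiftY|exact/commute_sym/yz].
- move/(noncross_eq (pactB_inner _ kq) (pactB_inner _ lq)) => nc.
  apply: closed_ZZ; try lift_hyp.
  by apply: noncross_ii_ii nc _; lia.
Qed.

Lemma rf_eq_l x x' w w' : modeq w w' = false -> x <> x' -> rf x x' =1 rf w w' ->
  (exists k : int, x = w + k * n%:Z /\ x' = w' + k * n%:Z)%R \/
  (exists k : int, x = w' + k * n%:Z /\ x' = w + k * n%:Z)%R.
Proof.
move=> ww xx e; have := e x; rewrite rf_l => xE.
have [e'|[k [e1 e2]]|[k [e1 e2]]] := rf_moved x ww.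
- by case: xx; rewrite xE e'.
- by left; exists k; rewrite xE e1 -e2 -e1.
- by right; exists k; rewrite xE e1 -e2 -e1.
Qed.

Lemma out_inj a b : out a = out b -> a = b.
Proof. by move/(congr1 (code p q)); rewrite !code_out // => -[]. Qed.

Lemma inn_inj a b : inn a = inn b -> a = b.
Proof. by move/(congr1 (code p q)); rewrite !code_inn // => -[]. Qed.

Lemma out_inn a b : out a <> inn b.
Proof. by move/(congr1 (code p q)); rewrite code_out // code_inn. Qed.

(** A periodic transposition determines its pair of endpoints up to a swap and a common translation.
    Translations are absorbed by the periodicity of the lifts; a swap would mix the boundaries or
    make the span of a chord negative. *)
Lemma arc_lift_inj t1 t2 : L t1 -> L t2 -> pactB t1 =1 pactB t2 -> t1 = t2.
Proof.
have oi a b : modeq (out a) (inn b) = false by exact: modeq_oi.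
have oo (a k : int) (kp : (0 < k < p%:Z)%R) : modeq (out a) (out (a + k)) = false by exact: modeq_oo.
have ii (b k : int) (kq : (0 < k < q%:Z)%R) : modeq (inn b) (inn (b + k)) = false by exact: modeq_ii.
have oT (a m : int) : (out a + m * n%:Z = out (a + m * p%:Z))%R by rewrite out_turn.
have iT (b m : int) : (inn b + m * n%:Z = inn (b + m * q%:Z))%R by rewrite inn_turn.
have neq x x' : modeq x x' = false -> x <> x' by move=> xx e; rewrite e modeq_refl in xx.
have trans x x' w w' s t : pactB s =1 rf x x' -> pactB t =1 rf w w' ->
    pactB s =1 pactB t -> rf x x' =1 rf w w'.
  by move=> sE tE st z; rewrite -sE -tE.
case=> [a b|a k kp|b k kq] [a' b'|a' l lp|b' l lq].
- move/(trans _ _ _ _ _ _ (pactB_cross _ _) (pactB_cross _ _)).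
  case/(rf_eq_l (oi _ _) (neq _ _ (oi _ _))) => -[m []]; rewrite oT iT.
    by move=> /out_inj -> /inn_inj ->; apply: hXt.
  by move/out_inn.
- move/(trans _ _ _ _ _ _ (pactB_cross _ _) (pactB_outer _ lp)).
  by case/(rf_eq_l (oo _ _ lp) (neq _ _ (oi _ _))) => -[m [_]]; rewrite oT => /esym/out_inn.
- move/(trans _ _ _ _ _ _ (pactB_cross _ _) (pactB_inner _ lq)).
  by case/(rf_eq_l (ii _ _ lq) (neq _ _ (oi _ _))) => -[m []]; rewrite iT => /out_inn.
- move/(trans _ _ _ _ _ _ (pactB_outer _ kp) (pactB_cross _ _)).
  by case/(rf_eq_l (oi _ _) (neq _ _ (oo _ _ kp))) => -[m []]; rewrite oT iT;
    [move=> _ /out_inn|move=> /out_inn].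
- move/(trans _ _ _ _ _ _ (pactB_outer _ kp) (pactB_outer _ lp)).
  case/(rf_eq_l (oo _ _ lp) (neq _ _ (oo _ _ kp))) => -[m []]; rewrite !oT.
    move=> /out_inj e /out_inj e'; have -> : k = l by lia.
    by rewrite e; apply: hyt.
  by move=> /out_inj e /out_inj e'; lia.
- move/(trans _ _ _ _ _ _ (pactB_outer _ kp) (pactB_inner _ lq)).
  by case/(rf_eq_l (ii _ _ lq) (neq _ _ (oo _ _ kp))) => -[m []]; rewrite iT => /out_inn.
- move/(trans _ _ _ _ _ _ (pactB_inner _ kq) (pactB_cross _ _)).
  by case/(rf_eq_l (oi _ _) (neq _ _ (ii _ _ kq))) => -[m []]; rewrite oT iT;
    [move=> /esym/out_inn|move=> _ /esym/out_inn].
- move/(trans _ _ _ _ _ _ (pactB_inner _ kq) (pactB_outer _ lp)).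
  by case/(rf_eq_l (oo _ _ lp) (neq _ _ (ii _ _ kq))) => -[m []]; rewrite oT => /esym/out_inn.
- move/(trans _ _ _ _ _ _ (pactB_inner _ kq) (pactB_inner _ lq)).
  case/(rf_eq_l (ii _ _ lq) (neq _ _ (ii _ _ kq))) => -[m []]; rewrite !iT.
    move=> /inn_inj e /inn_inj e'; have -> : k = l by lia.
    by rewrite e; apply: hzt.
  by move=> /inn_inj e /inn_inj e'; lia.
Qed.

Fixpoint pairwise_noncross (ts : seq B) : Prop :=
  if ts is t :: ts' then
    (forall t', t' \in ts' -> noncross (pactB t) (pactB t')) /\ pairwise_noncross ts'
  else True.

Lemma pairwise_noncross_cat ts1 ts2 : pairwise_noncross (ts1 ++ ts2) <->
  [/\ pairwise_noncross ts1, pairwise_noncross ts2 &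
   forall t1 t2, t1 \in ts1 -> t2 \in ts2 -> noncross (pactB t1) (pactB t2)].
Proof.
elim: ts1 => [|t ts1 IH] /=; first by split=> [?|[]].
split=> [[H1 /IH[H2 H3 H4]]|[[H1 H2] H3 H4]].
  split=> //; first by split=> // t' t'1; apply: H1; rewrite mem_cat t'1.
  move=> t1 t2; rewrite inE => /predU1P[->|t11] t22; last exact: H4.
  by apply: H1; rewrite mem_cat t22 orbT.
split; last by apply/IH; split=> // t1 t2 t11; apply: H4; rewrite inE t11 orbT.
by move=> t'; rewrite mem_cat => /orP[/H1//|]; apply: H4; rewrite inE eqxx.
Qed.

Lemma pairwise_noncross_map (f : nat -> B) m k :
  (forall i j, (m <= i < j)%N -> (j < m + k)%N -> noncross (pactB (f i)) (pactB (f j))) ->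
  pairwise_noncross [seq f i | i <- iota m k].
Proof.
elim: k m => //= k IHk m H; split; last first.
  by apply: IHk => i j ij jk; apply: H; lia.
by move=> t' /mapP[i]; rewrite mem_iota => ik ->; apply: H; lia.
Qed.

Definition std_word : seq int :=
  [seq (n%:Z - i%:Z)%R | i <- iota 0 q] ++ [seq (i%:Z)%R | i <- iota 1 p].

Lemma cox_std_word : cB = \prod_(i <- std_word) sB i.
Proof.
rewrite big_cat !big_map /=; congr (_ * _).
  have H k m (i : int) : (i + k%:Z + m%:Z = n%:Z + 1)%R ->
      dn sB i k = \prod_(j <- iota m k) sB (n%:Z - j%:Z).
    elim: k m => [|k IHk] m; first by rewrite big_nil.
    move=> e; rewrite dnS /= big_cons -IHk; last by lia.
    by congr (sB _ * _); lia.
  by apply: H; lia.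
have H k (i : nat) : up sB i k = \prod_(j <- iota i k) sB j.
  elim: k i => [|k IHk] i; first by rewrite big_nil.
  rewrite /= big_cons -IHk; congr (_ * up _ _ _); lia.
exact: H.
Qed.

Local Ltac simple_hyp :=
  first [exact: per | exact: braid | exact: comm | exact: sgs | exact: sgK | exact: sgiK
        | exact: sg_iter | done | lia].

Lemma pactB_simple (j : int) : (1 <= j <= n%:Z)%R ->
  [\/ j = n /\ pactB (sB j) =1 rf (out 1) (inn (q%:Z - 1)),
      (p%:Z < j < n%:Z)%R /\ pactB (sB j) =1 rf (inn (j - p%:Z - 1)) (inn (j - p%:Z - 1 + 1)),
      j = p /\ pactB (sB j) =1 rf (out 0) (inn 0) |
      (j < p%:Z)%R /\ pactB (sB j) =1 rf (out (j - p%:Z)) (out (j - p%:Z + 1))] /\ L (sB j).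
Proof.
move=> jn; have [jE|[jE|[jE|jE]]] :
  (j = n%:Z)%R \/ (p%:Z < j < n%:Z)%R \/ (j = p%:Z)%R \/ (j < p%:Z)%R by lia.
- have XE : X 1 (q%:Z - 1) = sB n%:Z by apply: cross_lift_last; try simple_hyp.
  rewrite jE -XE; split; last exact: LiftX.
  by constructor 1; split=> //; apply: pactB_cross.
- have ZE : Z (j - p%:Z - 1) 1 = sB j by apply: inner_lift_simple; try simple_hyp.
  rewrite -ZE.
  have q1 : (0 < (1 : int) < q%:Z)%R by lia.
  split; last exact: LiftZ.
  by constructor 2; split=> //; apply: pactB_inner.
- rewrite jE; split; last exact: (LiftX X Y Z p q 0 0).
  by constructor 3; split=> //; apply: (pactB_cross 0 0).
have YE : Y (j - p%:Z) 1 = sB j by apply: outer_lift_simple; try simple_hyp.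
rewrite -YE.
have p1 : (0 < (1 : int) < p%:Z)%R by lia.
split; last exact: LiftY.
by constructor 4; split=> //; apply: pactB_outer.
Qed.

Lemma noncross_inner_letters (i j : int) : (p%:Z < j < i)%R -> (i <= n%:Z)%R ->
  noncross (pactB (sB i)) (pactB (sB j)).
Proof.
move=> ji i_n; have [ii _] := @pactB_simple i ltac:(lia).
have [jj _] := @pactB_simple j ltac:(lia).
case: ii => -[iE iP]; case: jj => -[jE jP]; try lia;
  apply: (noncross_eq (fsym iP) (fsym jP)).
  by apply: noncross_last_inner; lia.
by apply: noncross_inner_inner; lia.
Qed.

Lemma noncross_inner_outer_letters (i j : int) : (p%:Z < i <= n%:Z)%R -> (1 <= j <= p%:Z)%R ->
  noncross (pactB (sB i)) (pactB (sB j)).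
Proof.
move=> i_n jp; have [ii _] := @pactB_simple i ltac:(lia).
have [jj _] := @pactB_simple j ltac:(lia).
case: ii => -[iE iP]; case: jj => -[jE jP]; try lia;
  apply: (noncross_eq (fsym iP) (fsym jP)).
- exact: noncross_last_first.
- by apply: noncross_last_outer; lia.
- by apply: noncross_inner_first; lia.
- by apply: noncross_inner_outer; lia.
Qed.

Lemma noncross_outer_letters (i j : int) : (1 <= i < j)%R -> (j <= p%:Z)%R ->
  noncross (pactB (sB i)) (pactB (sB j)).
Proof.
move=> ij jp; have [ii _] := @pactB_simple i ltac:(lia).
have [jj _] := @pactB_simple j ltac:(lia).
case: ii => -[iE iP]; case: jj => -[jE jP]; try lia;
  apply: (noncross_eq (fsym iP) (fsym jP)).
  by apply: noncross_outer_first; lia.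
by apply: noncross_outer_outer; lia.
Qed.

Lemma std_word_noncross : pairwise_noncross [seq sB i | i <- std_word].
Proof.
rewrite map_cat -!map_comp; apply/pairwise_noncross_cat; split.
- by apply: pairwise_noncross_map => i j ij jq; apply: noncross_inner_letters; lia.
- by apply: pairwise_noncross_map => i j ij jq; apply: noncross_outer_letters; lia.
move=> _ _ /mapP[i ii ->] /mapP[j jj ->]; rewrite !mem_iota in ii jj.
by apply: noncross_inner_outer_letters; lia.
Qed.

Lemma std_word_range (i : int) : i \in std_word -> (1 <= i <= n%:Z)%R.
Proof.
by rewrite mem_cat => /orP[] /mapP[j]; rewrite mem_iota => ji ->; lia.
Qed.

Lemma arc_lift_simple (i : 'I_n) : L (sB i).
Proof.
have [j [jn ji]] : exists j : int, (1 <= j <= n%:Z)%R /\ modeq j i.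
  have [i0|i0] : i = 0 :> nat \/ (0 < i)%N by lia.
    by exists (n%:Z)%R; split; [lia|apply/modeqP; exists 1%R; lia].
  by exists i; split; [have := ltn_ord i; lia|apply: modeq_refl].
by rewrite -(sB_mod n_gt1 ji); have [_] := pactB_simple jn.
Qed.

End ArtinLifts.

(** * Coxeter elements up to conjugacy *)

Section CoxeterElements.
Variables (G : groupType) (s : int -> G) (n : nat).
Hypothesis scomm : forall i j : int,
  (i + 2 <= j <= i + n%:Z - 2)%R -> commute (s i) (s j).

(* Conjugation sorts the letters of a Coxeter element of type A_m; the
   conjugating element avoids s 1 and s m, so that the induction can proceed
   with the letter s (m + 1). *)
Lemma path_coxeter_conj m (l : seq nat) : (0 < m < n)%N -> perm_eq l (iota 1 m) ->
  exists p (g : G), [/\ (0 < p <= m)%N,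
    (\prod_(i <- l) s i%:Z) ^ g = dn s (p%:Z + 1) (m - p) * up s 1 p &
    forall h, (forall j : int, (2 <= j <= m%:Z - 1)%R -> commute h (s j)) -> commute h g].
Proof.
elim: m l => // m IHm l mn lm.
have m1l : m.+1 \in l by rewrite (perm_mem lm) mem_iota; lia.
have lu : uniq l by rewrite (perm_uniq lm) iota_uniq.
case/splitPr: m1l lm lu => a b lm lu.
have abm : perm_eq (a ++ b) (iota 1 m).
  move: lm; rewrite -[m.+1]addn1 iotaD /= -cat1s perm_catCA perm_sym perm_catC /=.
  by rewrite add1n addn1 perm_cons perm_sym.
have abP i : i \in a ++ b -> (1 <= i <= m)%N.
  by rewrite (perm_mem abm) mem_iota; lia.
have [m0|m0] := posnP m.
  move: abm; rewrite m0 /= => /perm_nilP; case: (a) => //= -> {IHm}.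
  exists 1%N, 1; split=> [||h _]; [by []| |exact: commute1].
  by rewrite big_cons big_nil conjg1 /= mul1g.
have far (c : seq nat) : {subset c <= a ++ b} -> m \notin c ->
    commute (s m.+1%:Z) (\prod_(i <- c) s i%:Z).
  move=> ca mc; rewrite big_seq; apply: commute_prod => i ic.
  have := abP i (ca i ic); have im : i <> m by move=> e; rewrite -e ic in mc.
  by move=> i_m; apply/commute_sym/scomm; lia.
have [|//|p [g [pm gE gh]]] := IHm (a ++ b); first by lia.
have gm : commute (s m.+1%:Z) g by apply: gh => j jm; apply/commute_sym/scomm; lia.
have mab : m \in a ++ b by rewrite (perm_mem abm) mem_iota; lia.
have [ma|ma] := boolP (m \in a); last first.
  exists p, g; split; [by lia| |by move=> h H; apply: gh => j jm; apply: H; lia].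
  have am : commute (s m.+1%:Z) (\prod_(i <- a) s i%:Z).
    by apply: far => // i ia; rewrite mem_cat ia.
  rewrite big_cat /= big_cons mulgA -am -mulgA -big_cat /= conjMg gE conjg_commute //.
  rewrite subSn ?dnS ?mulgA; last by lia.
  by congr (s _ * _ * _); lia.
have mb : m \notin b.
  by move: lu; rewrite cat_uniq => /and3P[_ /hasPn/(_ m) H _]; apply/negP => mb;
     move: (H); rewrite inE mb orbT ma => /(_ isT).
have bm : commute (s m.+1%:Z) (\prod_(i <- b) s i%:Z).
  by apply: far => // i ib; rewrite mem_cat ib orbT.
have E : (\prod_(i <- a ++ m.+1 :: b) s i%:Z) ^ g =
    dn s (p%:Z + 1) (m - p) * (up s 1 p * s m.+1%:Z).
  rewrite big_cat /= big_cons bm mulgA -big_cat /= conjMg gE.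
  by rewrite [s _ ^ g]conjg_commute // mulgA.
have [pm'|pm'] : p = m \/ (p < m)%N by lia.
  exists m.+1, g; split; [by lia| |by move=> h H; apply: gh => j jm; apply: H; lia].
  rewrite E pm' !subnn /= !mul1g -[RHS]/(up s 1 m.+1) upS.
  by congr (_ * s _); lia.
exists p.+1, (g * dn s (p%:Z + 1) (m - p)); split; first by lia.
  rewrite conjgM E /conjg -mulgA mulKg -mulgA.
  have -> : s m.+1%:Z * dn s (p%:Z + 1) (m - p) = dn s (p%:Z + 1) (m - p).+1.
    by rewrite dnS; congr (s _ * _); lia.
  have -> : up s 1 p.+1 = up s 1 p * s (p%:Z + 1) by rewrite upS; congr (_ * s _); lia.
  rewrite subSS -[dn s (p%:Z + 1) _.+1]/(dn s (p%:Z + 1 + 1) (m - p) * s (p%:Z + 1)) !mulgA.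
  congr (_ * _); rewrite (_ : p.+1%:Z + 1 = p%:Z + 1 + 1)%R; last by lia.
  apply: dn_commute => j jp; apply/commute_sym/up_commute => i ip.
  by apply/commute_sym/scomm; lia.
move=> h H; apply: commuteM; first by apply: gh => j jm; apply: H; lia.
by apply: dn_commute => j jp; apply: H; lia.
Qed.

End CoxeterElements.

(** Conjugation rotates the letter [s 0] to the front, leaving a Coxeter element of type A to sort.
    The sorting element commutes with [s 0], which equals [s n] and completes the descending factor;
    this also gives [q > 0]. *)
Lemma coxeter_element_conj n (n_gt1 : (1 < n)%N) (c : affW n) : coxeter_element c ->
  exists p q (g : affW n), [/\ (0 < p)%N, (0 < q)%N, n = (p + q)%N &
    c ^ g = dn (sW n_gt1) (p%:Z + 1) q * up (sW n_gt1) 1 p].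
Proof.
case=> l [ln ->].
have l0 : ordz n_gt1 0 \in l by rewrite (perm_mem ln) mem_enum.
case/splitPr: l0 ln => a b ln; set o := ordz n_gt1 0.
have sWc (i j : int) : (i + 2 <= j <= i + n%:Z - 2)%R -> commute (sW n_gt1 i) (sW n_gt1 j).
  by move=> ij; apply: sW_comm; apply: modeq_small; lia.
have oE : (o : nat) = 0%N by have := ordzE n_gt1 0; rewrite mod0z => -[].
have iotan : [seq val i | i <- enum 'I_n] = 0%N :: iota 1 n.-1.
  by rewrite val_enum_ord -{1}(prednK (ltnW n_gt1)).
have lm : perm_eq [seq val i | i <- b ++ a] (iota 1 n.-1).
  have := perm_map val ln; rewrite iotan map_cat map_cons (_ : val (ordz n_gt1 0) = 0%N) //.
  by rewrite perm_catC cat_cons perm_cons map_cat.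
have [|p [g [pn gE gh]]] := path_coxeter_conj sWc _ lm; first by lia.
exists p, (n - p)%N, (\prod_(i <- a) simple_refl i * g); split; try lia.
have rot (x y w : affW n) : (x * (y * w)) ^ x = y * (w * x) by rewrite /conjg -!mulgA mulKg.
rewrite conjgM big_cat /= big_cons rot -big_cat /=.
have -> : \prod_(i <- b ++ a) simple_refl i = \prod_(i <- [seq val i | i <- b ++ a]) sW n_gt1 i.
  by rewrite big_map; apply: eq_bigr => i _; rewrite sW_nat.
rewrite conjMg gE conjg_commute; last first.
  by apply: gh => j jn; rewrite -[simple_refl _]/(sW n_gt1 0); apply: sWc; lia.
rewrite (_ : n - p = (n.-1 - p).+1)%N ?dnS; last by lia.
rewrite -[simple_refl _]/(sW n_gt1 0) mulgA; congr (_ * _ * _).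
by apply: sW_mod; apply/modeqP; exists (-1)%R; lia.
Qed.

(** * The dual group *)

Section ReflectionLength.
Variable n : nat.
Hypothesis n_gt1 : (1 < n)%N.
Local Notation W := (affW n).
Implicit Types (v w c h t : W) (ts : seq W).

Lemma lR_ex w : exists ts, [/\ reflections ts, size ts = lR w & w = \prod_(t <- ts) t].
Proof. by rewrite /lR; case: ex_minnP => k /asboolP[ts [tsk tsr wE]] _; exists ts. Qed.

Lemma lR_le ts : reflections ts -> (lR (\prod_(t <- ts) t) <= size ts)%N.
Proof.
by move=> tsr; rewrite /lR; case: ex_minnP => k _; apply; apply/asboolP; exists ts.
Qed.

Lemma reflections_map u : reflections [seq simple_refl i : W | i <- u].
Proof. by move=> _ /mapP[i _ ->]; apply: simple_reflection. Qed.

Lemma lR_uniq u : uniq u -> lR (prodW u : W) = size u.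
Proof.
move=> uu; have [ts [tsr tss uE]] := lR_ex (prodW u).
apply/eqP; rewrite eqn_leq -{2}tss (reflection_length_uniq n_gt1 uu tsr uE) andbT.
have := lR_le (@reflections_map u); rewrite big_map size_map; exact.
Qed.

Lemma lR1 : lR (1 : W) = 0%N.
Proof. by have := @lR_uniq [::] isT; rewrite /prodW big_nil. Qed.

Lemma lR_mul v w : (lR (v * w) <= lR v + lR w)%N.
Proof.
have [vs [vr <- vE]] := lR_ex v; have [ws [wr <- wE]] := lR_ex w.
rewrite {1}vE {1}wE -big_cat -size_cat; apply: lR_le.
exact/reflections_cat.
Qed.

Lemma lR_conj w h : lR (w ^ h) = lR w.
Proof.
have le x y : (lR (x ^ y : W) <= lR x)%N.
  have [ts [tsr <- xE]] := lR_ex x; rewrite {1}xE conjg_prod.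
  rewrite -(size_map (fun t => t ^ y)) -(big_map (fun t => t ^ y) xpredT id).
  by apply: lR_le => _ /mapP[t /tsr tr ->]; apply: reflectionJ.
by apply/eqP; rewrite eqn_leq le -{1}[w](conjgK h) le.
Qed.

Lemma divides_conj v c h : divides v c -> divides (v ^ h) (c ^ h).
Proof.
by case=> v' [-> lE]; exists (v' ^ h); rewrite -conjMg !lR_conj.
Qed.

Section DualGenerators.
Variable c : W.
Local Notation G := (dual_group c).

Lemma divisorP (d : divisors_of c) : divides (val d) c.
Proof. exact/asboolP/(valP d). Qed.

(** Total on [W], with the dummy value 1 off the divisors, so that products of group elements need
    no divisibility proof in the term. *)
Definition dual_gen (v : W) : G :=
  if pselect (divides v c) is left H then
    pres_gen (@dual_rel n c) (Sub v (asboolT H) : divisors_of c)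
  else 1.

Lemma dual_genE (d : divisors_of c) : dual_gen (val d) = pres_gen _ d.
Proof.
rewrite /dual_gen; case: pselect => [H|[]]; last exact: divisorP.
by congr pres_gen; apply: val_inj.
Qed.

Lemma dual_genM v w : divides v c -> divides w c -> divides (v * w) c ->
  lR (v * w) = (lR v + lR w)%N -> dual_gen (v * w) = dual_gen v * dual_gen w.
Proof.
move=> /asboolT dv /asboolT dw /asboolT dvw l.
pose dv' : divisors_of c := Sub v dv; pose dw' : divisors_of c := Sub w dw.
pose dvw' : divisors_of c := Sub (v * w) dvw.
rewrite -[v]/(val dv') -[w]/(val dw') -[LHS]/(dual_gen (val dvw')) !dual_genE.
have := pres_relP (@DualRel n c dv' dw' dvw' erefl l).
by rewrite !big_cons !big_nil !mulg1 => ->.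
Qed.

Lemma dual_hom_ex (H : groupType) (f : W -> H) :
  (forall v w, divides v c -> divides w c -> divides (v * w) c ->
     lR (v * w) = (lR v + lR w)%N -> f (v * w) = f v * f w) ->
  exists F : UMagmaMorphism.type G H, forall v, divides v c -> F (dual_gen v) = f v.
Proof.
move=> fM; have [|F FE] := @pres_lift_ex _ (@dual_rel n c) H (fun d => f (val d)).
  move=> _ _ [w w' ww' wE lE]; rewrite !big_cons !big_nil !mulg1 wE.
  by rewrite fM -?wE //; apply: divisorP.
exists F => v dv; rewrite -[v]/(val (Sub v (asboolT dv) : divisors_of c)).
by rewrite dual_genE FE.
Qed.

Definition reduced ts := [/\ reflections ts, size ts = lR c & \prod_(t <- ts) t = c].

Lemma reduced_hurwitz ts1 ts2 : hurwitz ts1 ts2 -> reduced ts1 -> reduced ts2.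
Proof.
move=> h [r s p]; split; first exact: hurwitz_reflections h r.
  by rewrite -(hurwitz_size h).
by rewrite -(hurwitz_prod h).
Qed.

(** Conjugation by the block [B] moves the prefix [A] to its right: [c = B * (A ^ B * D)].
    Subadditivity and conjugation invariance of [lR], together with the total size being [lR c],
    force all the inequalities to be equalities. *)
Lemma reduced_block a b d : reduced (a ++ b ++ d) ->
  divides (\prod_(t <- b) t) c /\ lR (\prod_(t <- b) t) = size b.
Proof.
case=> /reflections_cat[ra /reflections_cat[rb rd]]; rewrite !size_cat !big_cat /= => sE cE.
have la := lR_le ra; have lb := lR_le rb; have ld := lR_le rd.
move: la lb ld cE.
move: (\prod_(t <- a) t) (\prod_(t <- b) t) (\prod_(t <- d) t) => A B D la lb ld cE.
have cE' : c = B * (A ^ B * D) by rewrite -cE /conjg !mulgA mulgV mul1g.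
have l1 := lR_mul B (A ^ B * D); have l2 := lR_mul (A ^ B) D; rewrite lR_conj in l2.
rewrite -cE' in l1.
have [lc lB] : lR c = (lR B + lR (A ^ B * D))%N /\ lR B = size b.
  move: (lR _) (lR c) (lR A) (lR B) (lR D) la lb ld l1 l2 sE => x y z t w.
  by move: (size a) (size b) (size d) => *; split; lia.
by split=> //; exists (A ^ B * D).
Qed.

Lemma dual_gen_prod a b d : reduced (a ++ b ++ d) ->
  dual_gen (\prod_(t <- b) t) = \prod_(t <- b) dual_gen t.
Proof.
elim: b a => [|t b IHb] a red.
  have [d1 _] := reduced_block red; rewrite !big_nil in d1 *.
  have := dual_genM d1 d1; rewrite mulg1 lR1 => /(_ d1 erefl) e.
  by apply: (mulgI (dual_gen 1)); rewrite -e mulg1.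
have red1 : reduced (a ++ [:: t] ++ b ++ d) by [].
have red2 : reduced ((a ++ [:: t]) ++ b ++ d) by rewrite -catA.
have [dtb ltb] := reduced_block red; have [dt lt] := reduced_block red1.
have [db lb] := reduced_block red2.
rewrite big_seq1 in dt lt; rewrite !big_cons -(IHb _ red2); rewrite big_cons in dtb ltb.
by apply: dual_genM => //; rewrite ltb lt lb.
Qed.

(** All three products equal the generator of the divisor [t1 * t2], because the moved
    factorizations are again reduced. *)
Lemma dual_gen_hurwitz a t1 t2 b : reduced (a ++ t1 :: t2 :: b) ->
  dual_gen t1 * dual_gen t2 = dual_gen (t2 ^ t1^-1) * dual_gen t1 /\
  dual_gen t1 * dual_gen t2 = dual_gen t2 * dual_gen (t1 ^ t2).
Proof.
move=> red; have pair x y : reduced (a ++ x :: y :: b) ->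
    dual_gen x * dual_gen y = dual_gen (x * y).
  move=> redxy; have := @dual_gen_prod a [:: x; y] b redxy.
  by rewrite !big_cons !big_nil !mulg1.
rewrite (pair _ _ red) (pair (t2 ^ t1^-1)) ?(pair t2).
- by rewrite {1}/conjg invgK -!mulgA mulVg mulg1 /conjg mulVKg.
- by apply: reduced_hurwitz red; apply/hurwitz_r/hurwitz_refl.
- by apply: reduced_hurwitz red; apply/hurwitz_l/hurwitz_refl.
Qed.

End DualGenerators.

Lemma dual_conj_hom c c' h : c' = c ^ h ->
  exists F : UMagmaMorphism.type (dual_group c) (dual_group c'),
    forall v, divides v c -> F (dual_gen c v) = dual_gen c' (v ^ h).
Proof.
move=> ->; apply: dual_hom_ex => v w dv dw dvw l; rewrite conjMg.
apply: dual_genM; rewrite -?conjMg ?lR_conj //; exact: divides_conj.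
Qed.

Lemma dual_hom_eq c (H : groupType) (F F' : UMagmaMorphism.type (dual_group c) H) :
  (forall v, divides v c -> F (dual_gen c v) = F' (dual_gen c v)) -> F =1 F'.
Proof.
move=> FF; apply: pres_hom_ext => d; rewrite -dual_genE; apply: FF.
exact: divisorP.
Qed.

Lemma dual_conj_iso c h : isomorphic (dual_group c) (dual_group (c ^ h)).
Proof.
have [F FE] := @dual_conj_hom c _ h erefl.
have [F' F'E] := @dual_conj_hom (c ^ h) c h^-1 (esym (conjgK h c)).
exists F; exists F' => g.
  apply: (@dual_hom_eq c _ (F' \o F) idfun) => v dv /=.
  by rewrite FE // F'E ?conjgK //; apply: divides_conj.
apply: (@dual_hom_eq _ _ (F \o F') idfun) => v dv /=.
by rewrite F'E // FE ?conjgKV // -(conjgK h c); apply: divides_conj.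
Qed.

End ReflectionLength.

Lemma isomorphic_trans (G H K : groupType) :
  isomorphic G H -> isomorphic H K -> isomorphic G K.
Proof.
by move=> [f fb] [g gb]; exists (g \o f); apply: bij_comp.
Qed.

(** * The isomorphism *)

Lemma hurwitz_move_right (G : groupType) (b : seq G) t :
  hurwitz (rcons b t) (t :: [seq x ^ t | x <- b]).
Proof.
elim: b => [|x b IHb]; first exact: hurwitz_refl.
rewrite rcons_cons; apply: (hurwitz_trans (ts2 := x :: t :: [seq x ^ t | x <- b])).
  by have := hurwitz_cat [:: x] [::] IHb; rewrite !cats0.
by apply: (@hurwitz_r _ [::]); apply: hurwitz_refl.
Qed.

(** * The homomorphism from the Artin group to the dual group *)

Section ArtinToDual.
Variable n : nat.
Hypothesis n_gt1 : (1 < n)%N.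
Local Notation W := (affW n).
Local Notation B := (affA_artin n).
Variables (l : seq 'I_n) (c : W).
Hypotheses (ln : perm_eq l (enum 'I_n)) (cE : c = prodW l).
Local Notation gen := (dual_gen c).
Local Notation sW := (sW n_gt1).
Local Notation sB := (sB n_gt1).

Lemma reduced_simple : reduced c [seq simple_refl i | i <- l].
Proof.
split; first exact: reflections_map.
  by rewrite size_map cE lR_uniq // (perm_uniq ln) enum_uniq.
by rewrite big_map cE.
Qed.

(** Each of the two letters is moved to the front of the simple factorization by Hurwitz moves that
    conjugate the factors it passes but leave the letter itself unchanged. The order of occurrence
    in [l] decides which alternative holds. *)
Lemma reduced_pair (i j : int) : modeq n i j = false ->
  exists a, reduced c (sW i :: sW j :: a) \/ reduced c (sW j :: sW i :: a).
Proof.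
move=> ij.
have pair a b d x y : l = a ++ x :: b ++ y :: d ->
    exists a', reduced c (simple_refl x :: simple_refl y :: a').
  move=> lE; have := reduced_simple; rewrite lE map_cat map_cons map_cat map_cons.
  set A := map _ a; set B' := map _ b; set D := map _ d => red.
  exists ([seq t ^ simple_refl y | t <- [seq t ^ simple_refl x | t <- A] ++ B'] ++ D).
  apply: reduced_hurwitz red.
  have h1 := hurwitz_cat [::] (B' ++ simple_refl y :: D) (hurwitz_move_right A (simple_refl x)).
  rewrite /= cat_rcons in h1; apply: (hurwitz_trans h1).
  have := hurwitz_cat [:: simple_refl x] D
    (hurwitz_move_right ([seq t ^ simple_refl x | t <- A] ++ B') (simple_refl y)).
  by rewrite /= cat_rcons -catA.
have il : ordz n_gt1 i \in l by rewrite (perm_mem ln) mem_enum.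
have jl : ordz n_gt1 j \in l by rewrite (perm_mem ln) mem_enum.
case/splitPr: il jl pair => a b; rewrite mem_cat inE => /or3P[ja|/eqP e|jb] pair.
- case/splitPr: ja pair => a1 a2 pair.
  have [a' red] := pair a1 a2 b (ordz n_gt1 j) (ordz n_gt1 i) ltac:(by rewrite -catA).
  by exists a'; right.
- by move: ij; rewrite -(ordz_eq n_gt1) e eqxx.
case/splitPr: jb pair => b1 b2 pair.
have [a' red] := pair a b1 b2 (ordz n_gt1 i) (ordz n_gt1 j) erefl.
by exists a'; left.
Qed.

Lemma artin_to_dual_ex :
  exists F : UMagmaMorphism.type B (dual_group c), forall z, F (sB z) = gen (sW z).
Proof.
apply: artin_lift_ex => [i j ij|n3 i|i j ij ij1 ji1]; first by rewrite (sW_mod n_gt1 ij).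
  (* The two Hurwitz moves produce the same reflection [r = x y x], so [gen x * gen y = gen r * gen
     x = gen y * gen r], and the braid relation follows. *)
  have br x y a : x * y * x = y * x * y -> x^-1 = x -> y^-1 = y -> reduced c (x :: y :: a) ->
      gen x * gen y * gen x = gen y * gen x * gen y.
    move=> xyx xV yV /(@dual_gen_hurwitz n n_gt1 c [::])[e1 e2].
    have e : y ^ x^-1 = x ^ y by rewrite /conjg invgK xV yV !mulgA.
    by rewrite e2 -!mulgA -e -e1.
  have [a [red|red]] := reduced_pair (modeq_succ n_gt1 i).
    by apply: br red; rewrite ?sWV // sW_braid.
  by apply/esym; apply: br red; rewrite ?sWV // sW_braid.
have co x y a : x * y = y * x -> reduced c (x :: y :: a) -> gen x * gen y = gen y * gen x.
  move=> xy /(@dual_gen_hurwitz n n_gt1 c [::])[_ ->].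
  by rewrite conjg_commute.
have sij := sW_comm n_gt1 ij ij1 ji1.
have [a [red|red]] := reduced_pair ij; first exact: co red.
by apply/esym/(co _ _ _ (esym sij) red).
Qed.

End ArtinToDual.

(** * The homomorphism from the dual group to the Artin group *)

Section DualToArtin.
Variables p q : nat.
Hypotheses (p_gt0 : (0 < p)%N) (q_gt0 : (0 < q)%N).
Local Notation n := (p + q)%N.
Hypothesis n_gt1 : (1 < n)%N.
Local Notation W := (affW n).
Local Notation B := (affA_artin n).
Local Notation sW := (sW n_gt1).
Local Notation sB := (sB n_gt1).

Definition std_letters : seq 'I_n := [seq ordz n_gt1 i | i <- std_word p q].
Definition std_cox : W := prodW std_letters.
Local Notation c := std_cox.
Local Notation gen := (dual_gen c).

Lemma std_letters_perm : perm_eq std_letters (enum 'I_n).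
Proof.
have sz : size std_letters = n by rewrite size_map size_cat !size_map !size_iota addnC.
have u : uniq std_letters.
  rewrite map_inj_in_uniq => [|i j /(std_word_range p_gt0 q_gt0 n_gt1) ii
    /(std_word_range p_gt0 q_gt0 n_gt1) jj /eqP].
    rewrite cat_uniq !map_inj_uniq; [|by move=> i j; lia|by move=> i j; lia].
    rewrite !iota_uniq andbT /=; apply/hasPn => _ /mapP[i ii ->]; apply/mapP => -[j jj].
    by rewrite !mem_iota in ii jj; lia.
  rewrite ordz_eq => /modeqP[k e].
  suff : k = 0 by lia.
  have n0 : (0 < n%:Z)%R by lia.
  nia.
have [|//|_ e] := @uniq_min_size _ std_letters (enum 'I_n) u; last exact: uniq_perm (enum_uniq _) e.
  by move=> i _; rewrite mem_enum.
by rewrite sz size_enum_ord.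
Qed.

Variables (sg sgi : UMagmaMorphism.type B B) (pi : UMagmaMorphism.type B W).
Hypothesis sgs : forall z, sg (sB z) = sB (z + 1).
Hypothesis sgis : forall z, sgi (sB z) = sB (z - 1).
Hypothesis pis : forall z, pi (sB z) = sW z.
Variable phi : UMagmaMorphism.type B (dual_group c).
Hypothesis phis : forall z, phi (sB z) = gen (sW z).

Local Notation X := (cross_lift sB p q sg sgi).
Local Notation Y := (outer_lift sB p q sg sgi).
Local Notation Z := (inner_lift sB p q sg sgi).
Local Notation cB := (cox_word sB p q).
Local Notation L := (arc_lift X Y Z p q).

Local Notation N u v := (noncross p q (pactB pi u) (pactB pi v)).

(** The invariant of Hurwitz moves. Non-crossing is what keeps the entries in [L], the product makes
    the map to the Artin group well defined, and the values of [phi] show that it is inverted by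
    [phi]. *)
Definition lifted (ts : seq W) := exists2 us : seq B, ts = [seq pi u | u <- us] &
  [/\ forall u, u \in us -> L u /\ phi u = gen (pi u), pairwise_noncross pi us &
      \prod_(u <- us) u = cB].

Lemma lifted_std : lifted [seq simple_refl i | i <- std_letters].
Proof.
exists [seq sB i | i <- std_word p q].
  by rewrite -!map_comp; apply: eq_map => i /=; rewrite pis.
split; last by rewrite big_map cox_std_word.
  move=> _ /mapP[i ii ->]; rewrite phis pis; split=> //.
  have [_] := pactB_simple p_gt0 q_gt0 sgs sgis pis (std_word_range p_gt0 q_gt0 n_gt1 ii); exact.
exact: (std_word_noncross p_gt0 q_gt0 sgs sgis pis).
Qed.

Lemma pairwise_noncross_move a u1 u2 v w b :
  N v w ->
  (forall t, N u1 t -> N u2 t -> N v t /\ N w t) ->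
  (forall t, N t u1 -> N t u2 -> N t v /\ N t w) ->
  pairwise_noncross pi (a ++ u1 :: u2 :: b) -> pairwise_noncross pi (a ++ v :: w :: b).
Proof.
move=> vw l r /pairwise_noncross_cat[pa [p1 [p2 pb]] ab]; apply/pairwise_noncross_cat.
have tl t : t \in b -> N v t /\ N w t.
  by move=> tb; apply: l; [apply: p1; rewrite inE tb orbT|apply: p2].
have tr t : t \in a -> N t v /\ N t w.
  by move=> ta; apply: r; apply: ab => //; rewrite !inE eqxx ?orbT.
split=> //=.
  split; last by split=> // t /tl[].
  by move=> t; rewrite inE => /predU1P[->|/tl[]].
move=> t1 t2 t1a; have [t1v t1w] := tr _ t1a.
by rewrite !inE => /or3P[/eqP->|/eqP->|t2b] //; apply: ab; rewrite // !inE t2b !orbT.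
Qed.

Lemma lift_involution t : L t -> involutive (pactB pi t) /\ simple_arc p q (pactB pi t).
Proof.
move=> /(arc_lift_rf p_gt0 q_gt0 sgs sgis pis)[x [x' [xx tE ts]]]; split=> [z|y z].
  by rewrite !tE rfK.
by have := ts y z; rewrite -!tE.
Qed.

Lemma pactB_conj h t : L h -> pactB pi (t ^ h) =1 (fun z => pactB pi h (pactB pi t (pactB pi h z))).
Proof.
move=> Lh z; have [hK _] := lift_involution Lh; rewrite /conjg !pactBM //.
by apply: (can_inj hK); rewrite hK pactBVK.
Qed.

Lemma pactB_conjV h t : L h ->
  pactB pi (t ^ h^-1) =1 (fun z => pactB pi h (pactB pi t (pactB pi h z))).
Proof.
move=> Lh z; have [hK _] := lift_involution Lh; rewrite /conjg invgK !pactBM //.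
by congr pactB; congr pactB; apply: (can_inj hK); rewrite hK pactBVK.
Qed.

Lemma map_eq_cat (T1 T2 : Type) (f : T1 -> T2) us a b : [seq f u | u <- us] = a ++ b ->
  exists ua ub, [/\ us = ua ++ ub, a = [seq f u | u <- ua] & b = [seq f u | u <- ub]].
Proof.
move=> e; exists (take (size a) us), (drop (size a) us).
by rewrite cat_take_drop map_take map_drop e take_size_cat // drop_size_cat.
Qed.

Lemma lifted_hurwitz ts1 ts2 : hurwitz ts1 ts2 -> reduced c ts1 -> lifted ts1 -> lifted ts2.
Proof.
elim=> {ts1 ts2} // [a t1 t2 b ts _ IH|a t1 t2 b ts _ IH] red [us usE [usL usN us_c]].
- apply: IH; first by apply: reduced_hurwitz red; apply/hurwitz_l/hurwitz_refl.
  have [e _] := dual_gen_hurwitz n_gt1 red.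
  have [ua [[|u1 [|u2 ub]] [usE' aE]]] := map_eq_cat (esym usE); try by [].
  case=> t1E t2E bE; rewrite {}usE' in usL usN us_c.
  have [L1 phi1] := usL u1 ltac:(by rewrite mem_cat !inE eqxx !orbT).
  have [L2 phi2] := usL u2 ltac:(by rewrite mem_cat !inE eqxx !orbT).
  have N12 : N u1 u2.
    by case/pairwise_noncross_cat: usN => _ [H _] _; apply: H; rewrite inE eqxx.
  have [L3 _] := arc_lift_closed p_gt0 q_gt0 sgs sgis pis L1 L2 N12.
  exists (ua ++ u2 ^ u1^-1 :: u1 :: ub).
    by rewrite map_cat /= gmulfJV t1E t2E aE bE.
  split.
  + move=> u; rewrite mem_cat !inE => /or3P[uu||/orP[/eqP->|uu]]; try exact: L1.
    * by apply: usL; rewrite mem_cat uu.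
    (* The value of [phi] on the conjugated lift is a conjugate of generators; the Hurwitz relation
       in the dual group identifies it with the generator of the conjugated reflection. *)
    * move=> /eqP->; split=> //; rewrite !gmulfJV phi1 phi2 -t1E -t2E.
      by rewrite /conjg invgK mulgA e mulgK.
    * by rewrite -phi1.
    * by apply: usL; rewrite mem_cat !inE uu !orbT.
  + have [i1 s1] := lift_involution L1.
    apply: pairwise_noncross_move usN.
    * by apply: noncross_eq (noncross_hurwitzl i1 s1 N12) => // z; rewrite pactB_conjV.
    * move=> t n1 n2; split=> //.
      by apply: noncross_eq (noncross_conjl n1 n2) => // z; rewrite pactB_conjV.
    * move=> t n1 n2; split=> //.
      by apply: noncross_eq (noncross_conjr n1 n2) => // z; rewrite pactB_conjV.
  by rewrite -us_c; apply/esym/hurwitz_prod/hurwitz_l/hurwitz_refl.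
apply: IH; first by apply: reduced_hurwitz red; apply/hurwitz_r/hurwitz_refl.
have [_ e] := dual_gen_hurwitz n_gt1 red.
have [ua [[|u1 [|u2 ub]] [usE' aE]]] := map_eq_cat (esym usE); try by [].
case=> t1E t2E bE; rewrite {}usE' in usL usN us_c.
have [L1 phi1] := usL u1 ltac:(by rewrite mem_cat !inE eqxx !orbT).
have [L2 phi2] := usL u2 ltac:(by rewrite mem_cat !inE eqxx !orbT).
have N12 : N u1 u2.
  by case/pairwise_noncross_cat: usN => _ [H _] _; apply: H; rewrite inE eqxx.
have [_ L3] := arc_lift_closed p_gt0 q_gt0 sgs sgis pis L1 L2 N12.
exists (ua ++ u2 :: u1 ^ u2 :: ub).
  by rewrite map_cat /= gmulfJ t1E t2E aE bE.
split.
+ move=> u; rewrite mem_cat !inE => /or3P[uu||/orP[/eqP->|uu]].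
  * by apply: usL; rewrite mem_cat uu.
  * by move=> /eqP->.
  * split=> //; rewrite !gmulfJ phi1 phi2 -t1E -t2E.
    by rewrite /conjg e mulKg.
  * by apply: usL; rewrite mem_cat !inE uu !orbT.
+ have [i2 s2] := lift_involution L2.
  apply: pairwise_noncross_move usN.
  * by apply: noncross_eq (noncross_hurwitzr i2 s2 N12) => // z; rewrite pactB_conj.
  * move=> t n1 n2; split=> //.
    by apply: noncross_eq (noncross_conjl n2 n1) => // z; rewrite pactB_conj.
  * move=> t n1 n2; split=> //.
    by apply: noncross_eq (noncross_conjr n2 n1) => // z; rewrite pactB_conj.
by rewrite -us_c; apply/esym/hurwitz_prod/hurwitz_r/hurwitz_refl.
Qed.

Lemma reduced_std : reduced c [seq simple_refl i | i <- std_letters].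
Proof. exact: (reduced_simple n_gt1 std_letters_perm). Qed.

Lemma reduced_lifted ts : reduced c ts -> lifted ts.
Proof.
move=> [tsr tss tsc]; have uniq_std : uniq std_letters.
  by rewrite (perm_uniq std_letters_perm) enum_uniq.
have [_ std_s _] := reduced_std.
apply: (@lifted_hurwitz [seq simple_refl i | i <- std_letters]) reduced_std lifted_std.
apply/hurwitz_sym/hurwitz_transitive => //.
by rewrite tss -std_s size_map.
Qed.

(** The chosen lift is the only one, by [arc_lift_inj]. The default 1 is never met on the factors of
    a reduced factorization of [c]. *)
Definition arc_lift_of (t : W) : B :=
  if pselect (exists u, L u /\ pi u = t) is left H then projT1 (cid H) else 1.

Lemma arc_lift_ofE u : L u -> arc_lift_of (pi u) = u.
Proof.
move=> Lu; rewrite /arc_lift_of; case: pselect => [H|[]]; last by exists u.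
case: cid => u' [Lu' e] /=; apply: (arc_lift_inj p_gt0 q_gt0 sgs sgis pis) => // z.
by rewrite /pactB e.
Qed.

Lemma arc_lift_of_prod ts : reduced c ts -> \prod_(t <- ts) arc_lift_of t = cB.
Proof.
case/reduced_lifted => us -> [usL _ <-]; rewrite big_map big_seq [RHS]big_seq.
by apply: eq_bigr => u /usL[Lu _]; rewrite arc_lift_ofE.
Qed.

Lemma arc_lift_of_gen ts t : reduced c ts -> t \in ts -> phi (arc_lift_of t) = gen t.
Proof.
case/reduced_lifted => us -> [usL _ _] /mapP[u /usL[Lu phiu] ->].
by rewrite arc_lift_ofE.
Qed.

Definition reflection_word (v : W) : seq W := projT1 (cid (lR_ex v)).

Lemma reflection_wordP v : [/\ reflections (reflection_word v),
  size (reflection_word v) = lR v & v = \prod_(t <- reflection_word v) t].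
Proof. by rewrite /reflection_word; case: cid. Qed.

Definition simple_lift (v : W) : B := \prod_(t <- reflection_word v) arc_lift_of t.

Lemma reduced_divisor v : divides v c -> exists ts, reduced c (reflection_word v ++ ts).
Proof.
case=> v' [cE lE]; exists (reflection_word v').
have [r s e] := reflection_wordP v; have [r' s' e'] := reflection_wordP v'.
split; first exact/reflections_cat.
  by rewrite size_cat s s' lE.
by rewrite big_cat /= -e -e' -cE.
Qed.

(* Both words complete to reduced words of c with the same right factor, and
   the lift of a reduced word of c is always cox_word. *)
Lemma simple_liftE ts ts' : reduced c (ts ++ ts') ->
  simple_lift (\prod_(t <- ts) t) = \prod_(t <- ts) arc_lift_of t.
Proof.
move=> red; have [_ l] := @reduced_block _ n_gt1 c [::] ts ts' red.
have [r s e] := reflection_wordP (\prod_(t <- ts) t).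
have red' : reduced c (reflection_word (\prod_(t <- ts) t) ++ ts').
  case: red => /reflections_cat[_ r'] s' p'; split; first exact/reflections_cat.
    by rewrite size_cat s l -size_cat.
  by rewrite big_cat /= -e -p' big_cat.
have := arc_lift_of_prod red; have := arc_lift_of_prod red'; rewrite !big_cat /= => <-.
by move/mulIg.
Qed.

Lemma simple_liftM v w : divides (v * w) c -> lR (v * w) = (lR v + lR w)%N ->
  simple_lift (v * w) = simple_lift v * simple_lift w.
Proof.
move=> [x [cE lE]] l.
have [rv sv ev] := reflection_wordP v; have [rw sw ew] := reflection_wordP w.
have [rx sx ex] := reflection_wordP x.
rewrite [in LHS]ev [in LHS]ew -big_cat /= (@simple_liftE _ (reflection_word x)) ?big_cat //.
split; first by apply/reflections_cat; split=> //; apply/reflections_cat.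
  by rewrite !size_cat sv sw sx -l lE.
by rewrite !big_cat /= -ev -ew -ex cE.
Qed.

Lemma std_cox_iso : isomorphic (dual_group c) B.
Proof.
have [psi psiE] := @dual_hom_ex n c B simple_lift (fun v w _ _ => @simple_liftM v w).
exists psi; exists phi => g.
  apply: (@dual_hom_eq n c _ (phi \o psi) idfun) => v dv /=.
  (* A divisor is a product of reflections occurring in a reduced factorization of [c]. On these
     [phi] of the lift is the generator, and generators multiply along the block. *)
  have [ts red] := reduced_divisor dv; have [_ _ e] := reflection_wordP v.
  rewrite psiE // {2}e (@dual_gen_prod n n_gt1 c [::] _ ts) // gmulf_prod big_seq [RHS]big_seq.
  by apply: eq_bigr => t tv; apply: (arc_lift_of_gen red); rewrite mem_cat tv.
apply: (@artin_hom_ext n n_gt1 _ (psi \o phi) idfun) => z /=.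
have [a red] : exists a, reduced c (sW z :: a).
  have [a [red|red]] := reduced_pair n_gt1 std_letters_perm erefl (modeq_succ n_gt1 z).
    by exists (sW (z + 1) :: a).
  (* Here [sW z] is only the second factor; one Hurwitz move brings it unchanged to the front. *)
  exists ((sW (z + 1)) ^ (sW z) :: a).
  by apply: reduced_hurwitz red; apply: (@hurwitz_r _ [::]); apply: hurwitz_refl.
have [dz _] := @reduced_block _ n_gt1 c [::] [:: sW z] a red; rewrite big_seq1 in dz.
rewrite phis psiE //; have := @simple_liftE [:: sW z] a red; rewrite !big_seq1 => ->.
have zE : sB z = sB (ordz n_gt1 z) by apply: sB_mod; rewrite modeq_sym modeq_ordz.
by rewrite -pis arc_lift_ofE // zE; apply: (arc_lift_simple p_gt0 q_gt0 sgs sgis pis).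
Qed.

End DualToArtin.

Theorem mainTheorem1 (n : nat) (hn : 2 <= n) (c : affW n)
  (hc : coxeter_element c) : isomorphic (dual_group c) (affA_artin n).
Proof.
have [p [q [g [p_gt0 q_gt0 nE cE]]]] := coxeter_element_conj hn hc.
subst n.
have [sg sgs] := artin_shift_ex hn 1; have [sgi sgis] := artin_shift_ex hn (-1).
have [pi pis] := artin_proj_ex hn.
have [phi phis] := artin_to_dual_ex hn (std_letters_perm p_gt0 q_gt0 hn) erefl.
apply: isomorphic_trans (dual_conj_iso c g) _.
(* The sorted form of [c] is the image under [pi] of the lifted Coxeter element, so the
   factorization of the latter into letters is projected to [W]. *)
have -> : c ^ g = std_cox hn.
  have pi_dn k z : pi (dn (sB hn) z k) = dn (sW hn) z k.
    by elim: k z => [|k IHk] z /=; rewrite ?gmulf1 // gmulfM IHk pis.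
  have pi_up k z : pi (up (sB hn) z k) = up (sW hn) z k.
    by elim: k z => [|k IHk] z /=; rewrite ?gmulf1 // gmulfM IHk pis.
  have := congr1 pi (cox_std_word p_gt0 q_gt0 hn).
  rewrite gmulf_prod gmulfM pi_dn pi_up -cE => ->.
  by rewrite /std_cox /prodW big_map; apply: eq_bigr => i _; rewrite pis.
exact: (std_cox_iso p_gt0 q_gt0 sgs sgis pis phis).
Qed.
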